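(* Let $1\le k\le n-1$. For every $R>0$, and for each of the speeds $f=\sqrt[k]{S_k}$ and $f=\dfrac{S_k}{S_{k-1}}$, there exists a non-convex complete $f$-translator $W_R\subset\mathbb{R}^{n+1}$, rotationally symmetric with respect to the $x_{n+1}$-axis, such that: 1. For $f=\sqrt[k]{S_k}$: (a) When $k$ is even, $W_R\setminus B_{R_1}(0)$ with $R_1>R$ possesses two graphical branches $W_R^+,W_R^-:\mathbb{R}^n\setminus B_R(0)\to\mathbb{R}$ smoothly asymptotic to $$W_R^{\pm}(x)=\pm\left(\frac{|x|^2}{2f(0,\mathbf{e})}-\frac{\partial f}{\partial\lambda_1}\bigg|_{(0,\mathbf{e})}\ln(|x|)+O(|x|^{-1})+C^{\pm}\right),\quad\text{as }|x|\to\infty.$$ (b) When $k$ is odd, $W_R$ possesses an $\mathbb{S}^{n-1}$ boundary component, and $W_R\setminus B_{R_1}(0)$ with $R_1>R$ is given by a vertical graph smoothly asymptotic to $$W_R(x)=\frac{|x|^2}{2f(0,\mathbf{e})}-\frac{\partial f}{\partial\lambda_1}\bigg|_{(0,\mathbf{e})}\ln(|x|)+O(|x|^{-1})+C,\quad\text{as }|x|\to\infty.$$ 2. For $f=\dfrac{S_k}{S_{k-1}}$, $W_R\setminus B_{R_1}(0)$ with $R_1>R$ possesses two graphical branches $W_R^+,W_R^-$ such that $$W_R^+(x)=\frac{|x|^2}{2f(0,\mathbf{e})}-\frac{\partial f}{\partial\lambda_1}\bigg|_{(0,\mathbf{e})}\ln(|x|)+O(|x|^{-1})+C^{+},\quad\text{as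 }|x|\to\infty,$$ $$\lim_{|x|\to\infty}|\nabla W_R^{-}(x)|=0.$$ Here $C$, $C^{+}$, $C^{-}$ are constants.
   Context: $\mathbf{e}=(1,\ldots,1)\in\mathbb{R}^{n-1}$, and $(0,\mathbf{e})\in\mathbb{R}^n$. $S_k(\lambda)=\sum_{1\le i_1<\dots<i_k\le n}\lambda_{i_1}\cdots\lambda_{i_k}$ is the $k$-th elementary symmetric polynomial in $\lambda=(\lambda_1,\ldots,\lambda_n)$, with $S_0=1$. The speeds $f=\sqrt[k]{S_k}$ and $f=S_k/S_{k-1}$ are functions on the cone $\Gamma_k=\{\lambda\in\mathbb{R}^n: S_l(\lambda)>0,\ l=1,\ldots,k\}$. $B_\rho(0)$ denotes the ball of radius $\rho$ centred at the origin. For a speed $f$, an $f$-translator is a hypersurface of $\mathbb{R}^{n+1}$ satisfying $f(\lambda)=-\langle\nu,e_{n+1}\rangle$, where $\nu$ is the inward unit normal, $\lambda=(\lambda_1,\ldots,\lambda_n)$ are the principal curvatures with respect to $\nu$, and $e_{n+1}=(0,\ldots,0,1)$; equivalently, it moves by translation in the direction $e_{n+1}$ under the flow with normal velocity $f(\lambda)\nu$. The convention is that for a rotationally symmetric graph $x_{n+1}=u(r)$, $r=|x|$, $x\in\mathbb{R}^n$, the normal is $\nu=\left(\frac{u'}{\sqrt{1+u'^2}}\frac{x}{r},\frac{-1}{\sqrt{1+u'^2}}\right)$ and the principal curvatures are $\lambda_1=\frac{u''}{(1+u'^2)^{3/2}}$ and $\lambda_i=\frac{u'}{r\sqrt{1+u'^2}}$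 for $i=2,\ldots,n$. The hypersurfaces $W_R$ are called wing-like solutions: non-convex rotationally symmetric hypersurfaces about the $x_{n+1}$-axis, with compact (possibly empty) boundary, at distance $R>0$ from the origin, satisfying the translator equation.
   Formalization: In part 2 the claim that |∇W_R^-| tends to 0 is stated only for k ≥ 2; for k = 1 the speed is the mean curvature, the slope v of W_R^- satisfies v' = (1+v²)(1-(n-1)v/r), and v → 0 would force v' → 1, so the claim fails. *)

(* Defs.v *)
(* MathComp / MathComp-Analysis *)
From HB Require Import structures.
From mathcomp Require Import all_boot all_order all_algebra.
From mathcomp Require Import all_classical all_reals all_analysis.

Set Implicit Arguments.
Unset Strict Implicit.
Unset Printing Implicit Defensive.

Import Order.TTheory GRing.Theory Num.Theory.
Import numFieldNormedType.Exports.

Local Open Scope classical_set_scope.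
Local Open Scope ring_scope.

(* The norms that MathComp-Analysis puts on 'rV[R]_n and on products are sup
   norms: they give the right topology and derivatives, but every metric notion
   below (balls, lengths, unit vectors, |x|) uses the Euclidean structure. *)
Section Euclidean.
Variables (R : realType) (n : nat).

Definition dot (x y : 'rV[R]_n) : R := \sum_(i < n) x 0 i * y 0 i.
Definition enorm (x : 'rV[R]_n) : R := Num.sqrt (dot x x).

(* R^(n+1) as R^n * R: the second component is the coordinate x_(n+1). *)
Definition espace : normedModType R := ('rV[R]_n * R)%type.
Definition sdot (p q : espace) : R := dot p.1 q.1 + p.2 * q.2.
Definition snorm (p : espace) : R := Num.sqrt (sdot p p).
Definition e_last : espace := (0, 1).
Definition sball (r : R) : set espace := [set p | snorm p < r].

Definition at_infty : set_system 'rV[R]_n :=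
  filter_from setT (fun r : R => [set x | r <= enorm x]).

Global Instance at_infty_filter : Filter at_infty.
Proof.
apply: filter_from_filter; first by exists 0.
move=> i j _ _; exists (Num.max i j) => // x /=.
by rewrite ge_max => /andP[].
Qed.

Canonical at_infty_filter_on := FilterType at_infty at_infty_filter.

Definition gradient (u : 'rV[R]_n -> R) (x : 'rV[R]_n) : 'rV[R]_n :=
  \row_(i < n) 'D_(delta_mx 0 i) u x.

End Euclidean.

Arguments at_infty : clear implicits.

Section Smooth.
Variables (R : realType) (V : normedModType R).

Fixpoint Cdiff (m : nat) (U : set V) (f : V -> R) : Prop :=
  (forall x, U x -> {for x, continuous f}) /\
  (if m is m'.+1 then
     forall v : V, (forall x, U x -> derivable f x v) /\
                   Cdiff m' U (fun x => 'D_v f x)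
   else True).

Definition smooth_on (U : set V) (f : V -> R) : Prop := forall m, Cdiff m U f.

Definition iter_deriv (vs : seq V) (f : V -> R) : V -> R :=
  foldr (fun v g => fun x => 'D_v g x) f vs.

End Smooth.

Section Speeds.
Variables (R : realType) (n : nat).
Implicit Types (l : 'rV[R]_n) (k : nat).

Definition esym k l : R :=
  \sum_(A : {set 'I_n} | #|A| == k) \prod_(i in A) l 0 i.

(* A speed is a function on R^n together with its natural domain.  A wing has
   vertical tangent spaces and a lower end, where lambda does not belong to
   Gamma_k, so the speeds are extended by their defining formulas to the largest
   set where these make sense as real numbers. *)
Record speed := Speed { speed_dom : set 'rV[R]_n ; speed_fun :> 'rV[R]_n -> R }.

Definition root_speed k : speed :=
  Speed [set l | 0 <= esym k l] (fun l => esym k l `^ (k%:R^-1)).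
Definition quotient_speed k : speed :=
  Speed [set l | esym k.-1 l != 0] (fun l => esym k l / esym k.-1 l).

(* The point (0, 1, ..., 1) and the first vector (1, 0, ..., 0) of the
   canonical basis of R^n. *)
Definition zero_ones : 'rV[R]_n := \row_(i < n) ((i : nat) != 0%N)%:R.
Definition e_first : 'rV[R]_n := \row_(i < n) ((i : nat) == 0%N)%:R.

Definition wing_profile (f : speed) (x : 'rV[R]_n) : R :=
  enorm x ^+ 2 / (2 * f zero_ones) - 'D_e_first f zero_ones * ln (enorm x).

End Speeds.

Section Hypersurfaces.
Variables (R : realType) (n : nat).
Local Notation V := (espace R n).
Implicit Types (W : set V) (p q nu v w : V) (F G : V -> R).

Definition local_equation W p F : Prop :=
  exists U : set V, [/\ open U, U p, smooth_on U F &
    forall q, U q -> (W q <-> F q = 0)].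

Definition interior_point W p : Prop :=
  W p /\ exists F, local_equation W p F /\ exists v, 'D_v F p != 0.

(* Near p, W is {F = 0, G >= 0} with dF and dG linearly independent at p. *)
Definition boundary_point W p : Prop :=
  exists F G (U : set V),
    [/\ [/\ open U, U p, smooth_on U F & smooth_on U G],
        forall q, U q -> (W q <-> F q = 0 /\ 0 <= G q),
        F p = 0 /\ G p = 0 &
        exists v w, 'D_v F p * 'D_w G p - 'D_w F p * 'D_v G p != 0].

(* Smooth embedded hypersurface, possibly with boundary. *)
Definition hypersurface W : Prop :=
  forall p, W p -> interior_point W p \/ boundary_point W p.

Definition boundary W : set V := [set p | W p /\ ~ interior_point W p].

(* nu is a unit normal of W at p, and (tau_i) is an orthonormal basis of the
   tangent space that diagonalizes the second fundamental form
   (X, Y) |-> <D_X nu, Y> = Hess F (X, Y) / c, where grad F (p) = c nu, c > 0.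
   With this sign the graph of a convex function with downward nu has
   nonnegative principal curvatures. *)
Definition principal_curvatures W p nu (l : 'rV[R]_n) : Prop :=
  W p /\ sdot nu nu = 1 /\
  exists F (c : R) (tau : 'I_n -> V),
    [/\ local_equation W p F,
        0 < c /\ (forall v, 'D_v F p = c * sdot nu v),
        forall i, sdot (tau i) nu = 0,
        forall i j, sdot (tau i) (tau j) = (i == j)%:R &
        forall i j, 'D_(tau j) (fun q => 'D_(tau i) F q) p
                    = c * (l 0 i *+ (i == j))].

(* The unit normal is the one with <nu, e_(n+1)> <= 0, as for a graph with
   nu = (grad u, -1) / sqrt (1 + |grad u|^2).  It is chosen pointwise: along a
   wing this choice jumps at the points with vertical tangent space. *)
Definition translator (f : speed R n) W : Prop :=
  forall p, interior_point W p -> exists nu l,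
    [/\ principal_curvatures W p nu l, sdot nu (e_last R n) <= 0,
        speed_dom f l & f l = - sdot nu (e_last R n)].

(* The second fundamental form is semidefinite at each point. *)
Definition convex_hypersurface W : Prop :=
  forall p nu l, principal_curvatures W p nu l ->
    (forall i, 0 <= l 0 i) \/ (forall i, l 0 i <= 0).

Definition length_le (g : R -> V) (L : R) : Prop :=
  forall s : seq R, sorted <=%R s -> all (fun t => 0 <= t <= 1) s ->
    \sum_(0 <= i < (size s).-1) snorm (g s`_i.+1 - g s`_i) <= L.

(* The intrinsic distance of p and q in W is the infimum of these L. *)
Definition joined_within W p q (L : R) : Prop :=
  exists g : R -> V, [/\ {within `[0, 1], continuous g}, g 0 = p /\ g 1 = q,
    forall t, 0 <= t <= 1 -> W (g t) & length_le g L].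

(* Completeness for the intrinsic distance, which induces on a hypersurface the
   topology of the ambient space. *)
Definition complete_hypersurface W : Prop :=
  forall x : nat -> V, (forall i, W (x i)) ->
    (forall e : R, 0 < e -> exists N, forall i j,
       (N <= i)%N -> (N <= j)%N -> joined_within W (x i) (x j) e) ->
    exists2 p, W p & x @ \oo --> p.

Definition rotationally_symmetric W : Prop :=
  forall Q : 'M[R]_n, Q *m Q^T = 1%:M -> forall p, W p -> W (p.1 *m Q, p.2).

Definition wing_like (f : speed R n) (rho : R) W : Prop :=
  [/\ [/\ hypersurface W, connected W, complete_hypersurface W &
          rotationally_symmetric W],
      compact (boundary W),
      inf [set snorm p | p in W] = rho,
      translator f W &
      ~ convex_hypersurface W].

Definition has_sphere_boundary_component W : Prop :=
  exists (r h : R) p, [/\ 0 < r, boundary W p &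
    connected_component (boundary W) p = [set q | enorm q.1 = r /\ q.2 = h]].

(* The graph of u over the complement of the ball of radius rho in R^n. *)
Definition exterior_graph (rho : R) (u : 'rV[R]_n -> R) : set V :=
  [set p | rho <= enorm p.1 /\ p.2 = u p.1].

Definition exterior_smooth (rho : R) (u : 'rV[R]_n -> R) : Prop :=
  smooth_on [set x | rho < enorm x] u.

Definition one_branch (rho : R) W (u : 'rV[R]_n -> R) : Prop :=
  exterior_smooth rho u /\
  forall r, rho < r ->
    W `\` sball r = exterior_graph rho u `\` sball r.

Definition two_branches (rho : R) W (u1 u2 : 'rV[R]_n -> R) : Prop :=
  [/\ exterior_smooth rho u1, exterior_smooth rho u2,
      forall x, rho < enorm x -> u1 x != u2 x &
      forall r, rho < r ->
        W `\` sball r =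
        (exterior_graph rho u1 `|` exterior_graph rho u2) `\` sball r].

Local Notation ends := (at_infty R n).

(* u = g + O(|x|^-1) at infinity *)
Definition asymptotic_to (u g : 'rV[R]_n -> R) : Prop :=
  (fun x => u x - g x) =O_ends (fun x => (enorm x)^-1).

(* The same, for the derivatives of all orders of the remainder. *)
Definition smoothly_asymptotic_to (u g : 'rV[R]_n -> R) : Prop :=
  forall vs : seq 'rV[R]_n,
    iter_deriv vs (fun x => u x - g x) =O_ends (fun x => (enorm x)^-1).

End Hypersurfaces.

(* Main.v *)
(* Write the wing as z = u(r) with r = |x|, v = u' and q = v / r. The translator
   equation becomes v' = (1 + v^2) F(q) for a rational function F, that is
   q' = (F(q) - q) / r + r q^2 F(q), for which suitable intervals of q are
   invariant; this makes the solutions global. Where the tangent space is vertical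
   the same equation is solved for r as a function of z, with slope p = dr/dz:
   F(1/s) = - 1 / (s G(s)) with G smooth and positive near 0, so the curve passes
   smoothly through the neck r = R and continues as an upper and a lower branch.
   For f = S_k^(1/k) with k odd there is no lower branch: the curve starts at r = R
   with a finite slope and its edge is the boundary sphere.

   At infinity q tends to the zero alpha of F. The quantity y = r^2 F(q) solves
   r y' = r^2 (g - p y) with p bounded below by a positive constant, hence y, with
   all its derivatives, behaves like a function of r^-1; integrating v = r q gives
   the expansion of u. When F is odd (k even, f = S_k^(1/k)) the lower branch is
   treated as the reflection of an upper one. For S_k / S_(k-1) with k > 1 one has
   F(q) >= (a / b) |q| for q <= 0, where a and b are the binomial coefficients of
   n - 1 over k and over k - 1, so that |v| = O(r^(- a / b)) on the lower branch. *)
Require Import Defs.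
From mathcomp Require Import all_boot all_order all_algebra.
From mathcomp Require Import all_classical all_reals all_analysis.
From mathcomp Require Import ring lra.
Set Implicit Arguments.
Unset Strict Implicit.
Unset Printing Implicit Defensive.
Import Order.TTheory GRing.Theory Num.Theory.
Import numFieldNormedType.Exports.
Local Open Scope classical_set_scope.
Local Open Scope ring_scope.

(** The existence theorem behind everything is a global one for scalar equations that are Lipschitz
    in the unknown. Each equation is made globally Lipschitz by clamping its unknown to a segment;
    signs at the ends of the segment then show that the solution stays inside, where clamping
    changes nothing. The neck is a second order problem for r(z), but an autonomous one, so it
    splits into two scalar equations.

    A lower branch needs a number gm with (1 + (r gm)^2) F(gm) <= gm for all r > 0 and F smooth on q
    <= gm. For f = S_k^(1/k) with k odd, F is positive on q < 0, which rules out every negative gm,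
    and for k >= 3 the pole of F at 0 rules out the others. For k even gm is the mirror image of the
    upper barrier, and for S_k / S_(k-1) with k > 1 it is 0. For S_1 / S_0 the field is affine and
    gm can be its positive zero; the ranges of q on the two branches then overlap, and their order
    comes from a comparison of solutions instead of a sign.

    Boundary points are defined negatively, as points where no regular local equation exists, so the
    edge sphere calls for a topological argument. *)

(** * Rules for directional derivatives *)

Section DerivativeRules.
Variables (R : realType) (V : normedModType R).
Implicit Types (f g : V -> R) (x v : V) (d e : R).

Lemma is_derive_near f g x v d : (\forall y \near x, f y = g y) ->
  is_derive x v f d -> is_derive x v g d.
Proof.
move=> fg [fd <-].
have cv : h^-1 *: ((f \o shift x) (h *: v) - f x) @[h --> 0^'] --> 'D_v f x.
  exact: fd.
have cvx : (h *: v + x) @[h --> 0^'] --> x.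
  have : (h *: v + x) @[h --> (0 : R)] --> (0 : R) *: v + x.
    by apply: cvgD; [apply: cvgZr_tmp; exact: cvg_id|exact: cvg_cst].
  by rewrite scale0r add0r => /cvg_within_filter; apply.
have fgx : f x = g x by exact: nbhs_singleton fg.
have cvg : h^-1 *: ((g \o shift x) (h *: v) - g x) @[h --> 0^'] --> 'D_v f x.
  apply: cvg_trans cv; apply: near_eq_cvg.
  have := cvx _ fg; rewrite nbhs_filterE /fmap /= => H.
  apply: filterS H => h /= E.
  by rewrite E fgx.
split; first by apply/cvg_ex; exists ('D_v f x).
exact: cvg_lim cvg.
Qed.

(** [smooth_on] speaks of directional derivatives only; this equivalence reduces rules on a normed
    space to rules in one real variable. *)
Lemma is_derive_line f x v d :
  is_derive x v f d <-> is_derive (0 : R) 1 (fun t : R => f (t *: v + x)) d.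
Proof.
have E : (fun h : R => h^-1 *: ((f \o shift x) (h *: v) - f x)) =
  (fun h : R => h^-1 *: (((fun t : R => f (t *: v + x)) \o shift 0) (h *: 1) -
      f ((0 : R) *: v + x))).
  apply/funext => h /=; rewrite scale0r add0r addr0.
  by rewrite /GRing.scale /= mulr1.
split=> -[fd fe]; split.
- by rewrite /derivable -E.
- by rewrite /derive -E.
- by rewrite /derivable E.
- by rewrite /derive E.
Qed.

Lemma is_derive_comp (G : R -> R) f x v d e :
  is_derive (f x) 1 G d -> is_derive x v f e ->
  is_derive x v (fun y => G (f y)) (d * e).
Proof.
move=> Gd /is_derive_line fe; apply/is_derive_line.
apply: (is_derive1_comp (f := G) (g := fun t : R => f (t *: v + x))) => //=.
by rewrite scale0r add0r.
Qed.

Lemma is_derive_add f g x v d e : is_derive x v f d -> is_derive x v g e ->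
  is_derive x v (fun y => f y + g y) (d + e).
Proof. exact: (@is_deriveD _ _ _ f g). Qed.

Lemma is_derive_sub f g x v d e : is_derive x v f d -> is_derive x v g e ->
  is_derive x v (fun y => f y - g y) (d - e).
Proof. exact: (@is_deriveB _ _ _ f g). Qed.

Lemma is_derive_opp f x v d : is_derive x v f d ->
  is_derive x v (fun y => - f y) (- d).
Proof. exact: (@is_deriveN _ _ _ f). Qed.

Lemma is_derive_mul f g x v d e : is_derive x v f d -> is_derive x v g e ->
  is_derive x v (fun y => f y * g y) (d * g x + f x * e).
Proof.
move=> fd ge; apply: is_derive_eq (is_deriveM fd ge) _.
by rewrite addrC; congr (_ + _); rewrite mulrC.
Qed.

Lemma is_derive_const (a : R) x v : is_derive x v (fun=> a) 0.
Proof. exact: is_derive_cst. Qed.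

Lemma is_derive_mull (a : R) f x v d : is_derive x v f d ->
  is_derive x v (fun y => a * f y) (a * d).
Proof.
move=> fd; apply: is_derive_eq (is_derive_mul (is_derive_const a x v) fd) _.
by rewrite mul0r add0r.
Qed.

Lemma is_derive_exp f n x v d : is_derive x v f d ->
  is_derive x v (fun y => f y ^+ n) (n%:R * f x ^+ n.-1 * d).
Proof.
move=> fd; have := is_deriveX n fd.
suff -> : f ^+ n = (fun y => f y ^+ n) by [].
by apply/funext => y; elim: n => [|n IH]; rewrite ?expr0 // !exprS -IH.
Qed.

Lemma is_derive_inv f x v d : f x != 0 -> is_derive x v f d ->
  is_derive x v (fun y => (f y)^-1) (- d / f x ^+ 2).
Proof.
move=> fx0 [fd fe]; split; first exact: derivableV.
by rewrite deriveV // fe /GRing.scale /= mulrC mulNr mulrN.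
Qed.

End DerivativeRules.

(** * Monotonicity and barriers on the real line *)

Section RealDerivative.
Variables (R : realType).
Implicit Types (f g : R -> R) (x d : R).

Lemma is_derive_ident x : is_derive x 1 (fun y : R => y) 1.
Proof. exact: is_derive_id. Qed.

Lemma is_derive_cont f x d : is_derive x 1 f d -> {for x, continuous f}.
Proof.
by case=> fd _; apply: differentiable_continuous; apply/derivable1_diffP.
Qed.

(* Pasting along a point where the two pieces have the same 1-jet. *)
Lemma is_derive_glue f g a d : f a = g a ->
  is_derive a 1 f d -> is_derive a 1 g d ->
  is_derive a 1 (fun y : R => if y < a then f y else g y) d.
Proof.
move=> fga /is_derive1_caratheodory [F [FE Fc Fa]].
move=> /is_derive1_caratheodory [G [GE Gc Ga]].
apply/is_derive1_caratheodory.
exists (fun y : R => if y < a then F y else G y); split.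
- by move=> y /=; rewrite ltxx -fga; case: ifP => _; rewrite ?FE // fga GE.
- apply/cvgrPdist_lt => e e0; rewrite /= ltxx Ga.
  have HF : \forall y \near a, `|d - F y| < e.
    by move/cvgrPdist_lt : Fc; rewrite Fa; apply.
  have HG : \forall y \near a, `|d - G y| < e.
    by move/cvgrPdist_lt : Gc; rewrite Ga; apply.
  by near=> y; case: ifP => _; near: y.
- by rewrite ltxx.
Unshelve. all: by end_near. Qed.

Lemma derive_ge0_le f f' a b : a <= b ->
  (forall x, a <= x <= b -> is_derive x 1 f (f' x)) ->
  (forall x, a <= x <= b -> 0 <= f' x) -> f a <= f b.
Proof.
move=> ab fd f0.
have [| |c cab E] := @MVT_segment R f f' a b ab.
- move=> x /[!in_itv] /= /andP[ax xb]; apply: fd.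
  by rewrite (ltW ax) (ltW xb).
- apply: derivable_within_continuous => x /[!in_itv] /= axb.
  by have [] := fd x axb.
rewrite -subr_ge0 E mulr_ge0 ?subr_ge0 //; apply: f0.
by move: cab; rewrite in_itv.
Qed.

Lemma derive_gt0_lt f f' a b : a < b ->
  (forall x, a <= x <= b -> is_derive x 1 f (f' x)) ->
  (forall x, a <= x <= b -> 0 < f' x) -> f a < f b.
Proof.
move=> ab fd f0.
have [| |c cab E] := @MVT_segment R f f' a b (ltW ab).
- move=> x /[!in_itv] /= /andP[ax xb]; apply: fd.
  by rewrite (ltW ax) (ltW xb).
- apply: derivable_within_continuous => x /[!in_itv] /= axb.
  by have [] := fd x axb.
rewrite -subr_gt0 E mulr_gt0 ?subr_gt0 //; apply: f0.
by move: cab; rewrite in_itv.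
Qed.

Lemma derive_le f f' g g' a b : a <= b ->
  (forall x, a <= x <= b -> is_derive x 1 f (f' x)) ->
  (forall x, a <= x <= b -> is_derive x 1 g (g' x)) ->
  (forall x, a <= x <= b -> f' x <= g' x) -> f b - f a <= g b - g a.
Proof.
move=> ab fd gd fg; rewrite -subr_ge0.
have := @derive_ge0_le (fun x => g x - f x) (fun x => g' x - f' x) a b ab.
move=> H; have : g a - f a <= g b - f b.
  apply: H => x xab; first by apply: is_derive_sub; [exact: gd|exact: fd].
  by rewrite subr_ge0 fg.
by move=> ?; lra.
Qed.

Lemma derive_norm_le f f' g g' a b : a <= b ->
  (forall x, a <= x <= b -> is_derive x 1 f (f' x)) ->
  (forall x, a <= x <= b -> is_derive x 1 g (g' x)) ->
  (forall x, a <= x <= b -> `|f' x| <= g' x) -> `|f b - f a| <= g b - g a.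
Proof.
move=> ab fd gd fg; rewrite ler_norml; apply/andP; split.
- have := @derive_le (fun x => - f x) (fun x => - f' x) g g' a b ab.
  have H x : a <= x <= b -> is_derive x 1 (fun x => - f x) (- f' x).
    by move=> xab; apply: is_derive_opp; exact: fd.
  move=> /(_ H gd) H2.
  suff : - f b - - f a <= g b - g a by move=> ?; lra.
  by apply: H2 => x /fg; rewrite ler_norml => /andP[? ?]; lra.
- by apply: (derive_le ab fd gd) => x /fg /(le_trans (ler_norm _)).
Qed.

(* Look at the last zero of f before t. *)
Lemma barrier f f' a :
  (forall x, a <= x -> is_derive x 1 f (f' x)) -> f a <= 0 ->
  (forall x, a <= x -> 0 < f x -> f' x <= 0) ->
  forall t, a <= t -> f t <= 0.
Proof.
move=> fd fa f0 t at_; rewrite leNgt; apply/negP => ft.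
pose S := [set x | a <= x <= t /\ f x <= 0].
have Sa : S a by split => //; rewrite lexx.
have Sub : has_ubound S by exists t => x [/andP[]].
have hS : has_sup S by split => //; exact: (ex_intro _ a Sa).
pose s := sup S.
have as_ : a <= s by exact: ub_le_sup.
have st : s <= t by apply: ge_sup; [exact: (ex_intro _ a Sa)|move=> x [/andP[]]].
have fpos x : s < x -> x <= t -> 0 < f x.
  move=> sx xt; rewrite ltNge; apply/negP => fx.
  have : x <= s by apply: ub_le_sup => //; split=> //; rewrite xt andbT; lra.
  by move=> ?; lra.
have cs := is_derive_cont (fd s as_).
have fs : f s <= 0.
  rewrite leNgt; apply/negP => fs.
  have := cs _ (lt_nbhsr fs); rewrite nbhs_filterE /fmap /= => H.
  have [e /= e0 He] := H.
  have [x Sx xs] := sup_adherent e0 hS.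
  have xles : x <= s by exact: ub_le_sup.
  have : 0 < f x by apply: He => /=; rewrite ger0_norm; rewrite -/s in xs; lra.
  by move: Sx => [_ ?] ?; lra.
have st' : s < t by rewrite lt_neqAle st andbT; apply/eqP => E; move: ft; rewrite -E; lra.
have := cs _ (lt_nbhsl (le_lt_trans fs ft)).
rewrite nbhs_filterE /fmap /= => -[e /= e0 He].
(* The sign of f' is known only where f > 0, which fails at s itself. So the descent starts at s +
   m, where f is positive but, by continuity at s, still below f t. *)
have [m [m0 mt me]] : exists m, [/\ 0 < m, m <= t - s & m < e].
  exists (Num.min (e / 2) (t - s)); split.
  - by rewrite lt_min subr_gt0 st' divr_gt0.
  - by rewrite ge_min lexx orbT.
  - by rewrite gt_min; apply/orP; left; lra.
have yt : s + m <= t by lra.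
have fy : f (s + m) < f t.
  by apply: He => /=; rewrite opprD addrA subrr sub0r normrN gtr0_norm.
have : f t - f (s + m) <= 0 - 0 :> R.
  apply: (@derive_le f f' (fun=> 0) (fun=> 0) (s + m) t yt).
  - by move=> x /andP[? ?]; apply: fd; lra.
  - by move=> x /andP[yx xt]; apply: f0; [lra|apply: fpos; lra].
by move=> ?; lra.
Qed.

End RealDerivative.

(** * Antiderivatives on the whole line *)

Section Antiderivative.
Variable R : realType.
Implicit Types (f : R -> R) (x : R).

(** The integral starts at -1 so that 0 is an interior point: the antiderivative and its mirror
    image can then be pasted at 0. *)
Lemma antiderivative_right f : continuous f ->
  exists F : R -> R, forall x, -1 < x -> is_derive x 1 F (f x).
Proof.
move=> fc.
exists (fun x => (\int[@lebesgue_measure R]_(t in `[(-1), x]) f t)%R) => x x1.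
have fi : (@lebesgue_measure R).-integrable `[-1, x + 1] (EFin \o f).
  apply: continuous_compact_integrable; first exact: segment_compact.
  exact: continuous_subspaceT.
have xu : x < x + 1 by rewrite ltrDl.
have [Fd FE] := continuous_FTC1_closed xu fi x1 (fc x).
by split; [exact: Fd|rewrite -FE derive1E].
Qed.

Lemma antiderivative f : continuous f ->
  exists F : R -> R, forall x, is_derive x 1 F (f x).
Proof.
move=> fc; have [A HA] := antiderivative_right fc.
have [B HB] : exists B : R -> R, forall x, -1 < x -> is_derive x 1 B (f (- x)).
  apply: (@antiderivative_right (fun x => f (- x))) => x.
  by apply: continuous_comp; [exact: oppr_continuous|exact: fc].
have HB' x : x < 1 -> is_derive x 1 (fun y => B 0 - B (- y)) (f x).
  move=> x1; have H : is_derive (- x) 1 B (f x).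
    by rewrite -{2}(opprK x); apply: HB; lra.
  have := is_derive_sub (is_derive_const (B 0) x 1)
    (is_derive_comp H (is_derive_opp (is_derive_ident x))).
  by move=> /is_derive_eq; apply; ring.
have HA' x : -1 < x -> is_derive x 1 (fun y => A y - A 0) (f x).
  move=> x1; have := is_derive_sub (HA x x1) (is_derive_const (A 0) x 1).
  by move=> /is_derive_eq; apply; ring.
exists (fun y : R => if y < 0 then B 0 - B (- y) else A y - A 0) => x.
have [x0|x0|->] := ltgtP x 0.
- apply: is_derive_near (HB' x _); last by lra.
  by near=> y; rewrite ifT //; near: y; exact: lt_nbhsl.
- apply: is_derive_near (HA' x _); last by lra.
  by near=> y; rewrite ifF //; apply/negbTE; rewrite -leNgt ltW //; near: y; exact: lt_nbhsr.
- apply: is_derive_glue; first by rewrite oppr0 !subrr.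
  + by apply: HB'; lra.
  + by apply: HA'; lra.
Unshelve. all: by end_near. Qed.

Lemma antiderivative_at f (a c : R) : continuous f ->
  exists2 F : R -> R, F a = c & forall x, is_derive x 1 F (f x).
Proof.
move=> /antiderivative [F HF]; exists (fun x => c + (F x - F a)).
  by rewrite subrr addr0.
move=> x; have := is_derive_add (is_derive_const c x 1)
  (is_derive_sub (HF x) (is_derive_const (F a) x 1)).
by move=> /is_derive_eq; apply; ring.
Qed.

End Antiderivative.

(** * Limits from nested intervals *)

Section NestedIntervals.
Variable R : realType.

Lemma between_exists (T : Type) (i0 : T) (lo hi : T -> R) :
  (forall i j, lo i <= hi j) -> exists l, forall i, lo i <= l <= hi i.
Proof.
move=> lh; exists (sup (range lo)) => i; apply/andP; split.
- apply: ub_le_sup; last by exists i.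
  by exists (hi i0) => _ [j _ <-]; exact: lh.
- apply: ge_sup; first by exists (lo i0); exists i0.
  by move=> _ [j _ <-].
Qed.

Lemma geometric_small (c e : R) : 0 < e -> exists n, c / 2 ^+ n < e.
Proof.
move=> e0; have [n Hn] : exists n : nat, c / e < n%:R.
  exists (Num.Def.archi_bound `|c / e|).
  exact: le_lt_trans (ler_norm _) (archi_boundP (normr_ge0 _)).
exists n; rewrite ltr_pdivrMr ?exprn_gt0 // mulrC -ltr_pdivrMr //.
apply: lt_trans Hn _; rewrite -natrX ltr_nat; exact: ltn_expl.
Qed.

(** The intervals of radius c / 2^n about [a n] are nested, because c / 2^n is twice c / 2^(n+1). *)
Lemma geometric_limit (a : nat -> R) (c : R) :
  (forall n, `|a n.+1 - a n| <= c / 2 ^+ n.+1) ->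
  exists l, forall n, `|a n - l| <= c / 2 ^+ n.
Proof.
move=> ac.
have half n : c / 2 ^+ n = c / 2 ^+ n.+1 + c / 2 ^+ n.+1.
  by rewrite exprS; field; rewrite expf_neq0.
have c0 n : 0 <= c / 2 ^+ n.
  have c1 : 0 <= c / 2 ^+ n.+1 by exact: le_trans (ac n).
  by rewrite half addr_ge0.
have lo n m : a n - c / 2 ^+ n <= a (n + m)%N - c / 2 ^+ (n + m)%N.
  elim: m => [|m IH]; first by rewrite addn0.
  apply: le_trans IH _; rewrite addnS (half (n + m)%N).
  by have := ac (n + m)%N; rewrite ler_norml => /andP[? ?]; lra.
have hi n m : a (n + m)%N + c / 2 ^+ (n + m)%N <= a n + c / 2 ^+ n.
  elim: m => [|m IH]; first by rewrite addn0.
  apply: le_trans IH; rewrite addnS (half (n + m)%N).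
  by have := ac (n + m)%N; rewrite ler_norml => /andP[? ?]; lra.
have [|l Hl] := between_exists 0%N (lo := fun n => a n - c / 2 ^+ n)
  (hi := fun n => a n + c / 2 ^+ n).
  move=> i j; have [ij|ji] := leqP i j.
  - have := lo i (j - i)%N; rewrite subnKC // => h; have := c0 j; lra.
  - have := hi j (i - j)%N; rewrite subnKC 1?ltnW // => h; have := c0 i; lra.
by exists l => n; have /andP[h1 h2] := Hl n; rewrite ler_norml; apply/andP; split; lra.
Qed.

End NestedIntervals.

(** * Global existence for scalar Lipschitz equations *)

Section Picard.
Variable R : realType.
Implicit Types (f u : R -> R).

Lemma derivable_continuous f (f' : R -> R) :
  (forall x : R, is_derive x 1 f (f' x)) -> continuous f.
Proof. by move=> fd x; exact: is_derive_cont (fd x). Qed.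

(** Integrating L against the weight exp(2 |Lam|) gains a factor 1/2. This is Bielecki's weight: it
    makes the Picard map a contraction on the whole line, with no smallness of the time interval. *)
Lemma expR_weight_bound (Lam L f f' : R -> R) (t0 c t : R) :
  (forall x : R, is_derive x 1 Lam (L x)) -> Lam t0 = 0 -> (forall x, 0 <= L x) ->
  (forall x : R, is_derive x 1 f (f' x)) -> 0 <= c ->
  (forall x, `|f' x| <= L x * (c * expR (2 * `|Lam x|))) ->
  `|f t - f t0| <= c / 2 * expR (2 * `|Lam t|).
Proof.
move=> LamD Lam0 L0 fd c0 fb.
have mono a b : a <= b -> Lam a <= Lam b.
  by move=> ab; apply: (derive_ge0_le ab (fun x _ => LamD x)) => x _.
(* Here s = 1 to the right of t0 and s = -1 to the left, so that s Lam = |Lam| on either side. *)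
have eD (s x : R) : is_derive x 1 (fun x => s * (c / 2) * expR (2 * s * Lam x))
    (s ^+ 2 * (L x * (c * expR (2 * s * Lam x)))).
  have D := is_derive_mull (2 * s) (LamD x).
  have := is_derive_mull (s * (c / 2)) (is_derive_comp (G := expR)
    (f := fun x => 2 * s * Lam x) (is_derive_expR (2 * s * Lam x)) D).
  by move=> /is_derive_eq; apply; field.
have [tt|tt] := leP t0 t.
- have := @derive_norm_le R f f' (fun x => 1 * (c / 2) * expR (2 * 1 * Lam x)) _ t0 t tt
    (fun x _ => fd x) (fun x _ => eD 1 x).
  have pos x : t0 <= x -> 0 <= Lam x by move=> h; rewrite -Lam0 mono.
  rewrite /= Lam0 mulr0 expR0 [`|Lam t|]ger0_norm ?pos // !mulr1 !mul1r => H.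
  apply: le_trans (H _) _.
    move=> x /andP[xt0 _]; apply: le_trans (fb x) _.
    by rewrite /= ger0_norm ?pos // expr1n mul1r ?mulr1.
  by lra.
- have := @derive_norm_le R f f' (fun x => -1 * (c / 2) * expR (2 * -1 * Lam x)) _ t t0 (ltW tt)
    (fun x _ => fd x) (fun x _ => eD (-1) x).
  have neg x : x <= t0 -> Lam x <= 0 by move=> h; rewrite -Lam0 mono.
  rewrite /= Lam0 mulr0 expR0 [`|Lam t|](ler0_norm (neg _ (ltW tt))) distrC.
  rewrite ?mulrN1 ?mulNr ?mulrN ?mul1r => H.
  apply: le_trans (H _) _.
    move=> x /andP[_ xt0]; apply: le_trans (fb x) _.
    by rewrite /= ler0_norm ?neg // sqrrN expr1n mul1r ?mulrN1 ?mulNr ?mulrN.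
  by lra.
Qed.

(** Successive iterates differ by at most W t / 2^n with W = exp(2 |Lam|). The bound of phi at x0 by
    the same L starts this induction. *)
Theorem picard (phi : R -> R -> R) (L : R -> R) (t0 x0 : R) :
  (forall u, continuous u -> continuous (fun t => phi t (u t))) ->
  continuous L -> (forall t, 0 <= L t) ->
  (forall t x y, `|phi t x - phi t y| <= L t * `|x - y|) ->
  (forall t, `|phi t x0| <= L t) ->
  exists u : R -> R, u t0 = x0 /\ forall t : R, is_derive t 1 u (phi t (u t)).
Proof.
move=> phic Lc L0 lip bnd.
have [Lam Lam0 LamD] := antiderivative_at t0 0 Lc.
pose W t := expR (2 * `|Lam t|).
have W1 t : 1 <= W t by rewrite -expR0 ler_expR mulr_ge0.
have Wc : continuous W.
  move=> t; apply: (@continuous_comp _ _ _ (fun t => 2 * `|Lam t|) expR); last exact: continuous_expR.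
  apply: (@continuousM _ _ (fun=> 2) (fun t => `|Lam t|)); first exact: cvg_cst.
  apply: (@continuous_comp _ _ _ Lam (@Num.norm _ R)); last exact: norm_continuous.
  exact: derivable_continuous LamD _.
(* [choice] wants a total map; on a discontinuous u, which never occurs among the iterates, the map
   is the identity. *)
have step u : exists v : R -> R, continuous u ->
    v t0 = x0 /\ forall t : R, is_derive t 1 v (phi t (u t)).
  have [uc|nuc] := pselect (continuous u); last by exists u.
  have [v v0 vD] := antiderivative_at t0 x0 (phic u uc).
  by exists v.
have [T HT] := choice step.
pose U n := iter n T (fun=> x0).
have Uc n : continuous (U n).
  elim: n => [|n IH]; first by move=> t; exact: cvg_cst.
  by have [_ /derivable_continuous] := HT _ IH.
have U0 n : U n t0 = x0.
  by case: n => [//|n]; have [] := HT _ (Uc n).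
have UD n (t : R) : is_derive t 1 (U n.+1) (phi t (U n t)).
  by have [_] := HT _ (Uc n); apply.
have Ub n t : `|U n.+1 t - U n t| <= W t / 2 ^+ n.+1.
  elim: n t => [|n IH] t.
    have := @expR_weight_bound Lam L (U 1%N) (fun t => phi t x0) t0 1 t LamD Lam0 L0
      (UD 0%N) ler01.
    rewrite U0 expr1 mulrC div1r => -> // x; rewrite mul1r.
    by apply: le_trans (bnd x) _; rewrite ler_peMr // -/(W x).
  have := @expR_weight_bound Lam L (fun t => U n.+2 t - U n.+1 t)
    (fun t => phi t (U n.+1 t) - phi t (U n t)) t0 (2 ^+ n.+1)^-1 t LamD Lam0 L0.
  move=> /(_ (fun x => is_derive_sub (UD n.+1 x) (UD n x))).
  rewrite !U0 subrr subr0 -invfM -exprSr mulrC -/(W t); apply.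
    by rewrite invr_ge0 exprn_ge0.
  move=> x; apply: le_trans (lip _ _ _) _; rewrite ler_wpM2l //.
  by rewrite mulrC; exact: IH.
have [u Hu] : exists u : R -> R, forall t n, `|U n t - u t| <= W t / 2 ^+ n.
  have /choice [u Hu] : forall t, exists l, forall n, `|U n t - l| <= W t / 2 ^+ n.
    by move=> t; apply: geometric_limit => n; exact: Ub.
  by exists u.
have uc : continuous u.
  move=> t; apply/cvgrPdist_lt => e e0.
  have e3 : 0 < e / 3 by lra.
  have [n Hn] := geometric_small (W t + 1) e3.
  have H1 : \forall s \near t, W s < W t + 1.
    have W1' : W t < W t + 1 by rewrite ltrDl.
    exact: (Wc t _ (lt_nbhsl W1')).
  have H2 : \forall s \near t, `|U n t - U n s| < e / 3.
    by have /cvgrPdist_lt := Uc n t; apply.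
  near=> s.
  have h1 : W s < W t + 1 by near: s.
  have h2 : `|U n t - U n s| < e / 3 by near: s.
  have h3 := Hu t n; have h4 := Hu s n.
  have h5 : W s / 2 ^+ n < e / 3.
    by apply: lt_trans Hn; rewrite ltr_pM2r // invr_gt0 exprn_gt0.
  have h6 : W t / 2 ^+ n < e / 3.
    by apply: le_lt_trans Hn; rewrite ler_pM2r ?invr_gt0 ?exprn_gt0 // lerDl.
  move: h2 h3 h4; rewrite ltr_norml !ler_norml => /andP[? ?] /andP[? ?] /andP[? ?].
  by rewrite ltr_norml; apply/andP; split; lra.
exists u; split.
  have h n : `|x0 - u t0| <= W t0 / 2 ^+ n by rewrite -(U0 n).
  apply/eqP; rewrite eq_sym -subr_eq0 -normr_le0 leNgt; apply/negP => p.
  by have [n Hn] := geometric_small (W t0) p; have := h n; lra.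
(* The iterates converge to u by construction and to v by the weighted bound, so the limit is a
   fixed point. *)
have [v v0 vD] := antiderivative_at t0 x0 (phic u uc).
suff E : u = v by move=> t; move: (vD t); rewrite -E.
apply/funext => t.
have h n : `|U n.+1 t - v t| <= W t / 2 ^+ n.+1.
  have := @expR_weight_bound Lam L (fun t => U n.+1 t - v t)
    (fun t => phi t (U n t) - phi t (u t)) t0 (2 ^+ n)^-1 t LamD Lam0 L0.
  move=> /(_ (fun x => is_derive_sub (UD n x) (vD x))).
  rewrite U0 v0 subrr subr0 -invfM -exprSr mulrC -/(W t); apply.
    by rewrite invr_ge0 exprn_ge0.
  move=> x; apply: le_trans (lip _ _ _) _; rewrite ler_wpM2l //.
  by rewrite mulrC; exact: Hu.
apply/eqP; rewrite -subr_eq0 -normr_le0 leNgt; apply/negP => p.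
have [n Hn] := geometric_small (2 * W t) p.
have hn1 := h n; have hn2 := Hu t n.+1.
rewrite -mulrA in Hn; set A := W t / 2 ^+ n.+1 in hn1 hn2 *.
set B := W t / 2 ^+ n in Hn *.
have AB : A <= B.
  by rewrite ler_pM2l ?(lt_le_trans ltr01) // lef_pV2 ?posrE ?exprn_gt0 // ler_eXn2l ?ltr1n.
move: hn1 hn2 => /ler_normlP [? ?] /ler_normlP [? ?].
have : `|u t - v t| <= 2 * B by apply/ler_normlP; split; lra.
by lra.
Unshelve. all: by end_near. Qed.

End Picard.

(** * Closure properties of smooth functions *)

Section SmoothCalculus.
Variables (R : realType) (V : normedModType R).
Implicit Types (f g : V -> R) (U : set V) (m : nat).

Lemma Cdiff_continuous m U f : Cdiff m U f -> forall x, U x -> {for x, continuous f}.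
Proof. by case: m => [|m] []. Qed.

Lemma continuous_near f g x : (\forall y \near x, f y = g y) ->
  {for x, continuous f} -> {for x, continuous g}.
Proof.
move=> fg fc; rewrite /prop_for /continuous_at -(nbhs_singleton fg).
by apply: cvg_trans fc; apply: near_eq_cvg; apply: filterS fg => y ->.
Qed.

Lemma Cdiff_ext m U f g : open U -> (forall x, U x -> f x = g x) ->
  Cdiff m U f -> Cdiff m U g.
Proof.
move=> Uo; elim: m f g => [|m IH] f g fg [fc fd]; split.
- move=> x Ux; apply: continuous_near (fc x Ux).
  by apply: filterS (open_nbhs_nbhs (conj Uo Ux)) => y /fg.
- by [].
- move=> x Ux; apply: continuous_near (fc x Ux).
  by apply: filterS (open_nbhs_nbhs (conj Uo Ux)) => y /fg.
- move=> v; have [fdv fC] := fd v.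
  have gD x : U x -> is_derive x v g ('D_v f x).
    move=> Ux; apply: (@is_derive_near _ _ f).
      by apply: filterS (open_nbhs_nbhs (conj Uo Ux)) => y /fg.
    by split => //; exact: fdv.
  split=> [x Ux|]; first by have [] := gD x Ux.
  by apply: IH fC => x Ux; have [_ ->] := gD x Ux.
Qed.

Lemma Cdiff_subset m U U' f : U' `<=` U -> Cdiff m U f -> Cdiff m U' f.
Proof.
move=> UU; elim: m f => [|m IH] f [fc fd].
  by split=> // x /UU; exact: fc.
split=> [x /UU|v]; first exact: fc.
have [fdv fC] := fd v; split; first by move=> x /UU; exact: fdv.
exact: IH.
Qed.

Lemma CdiffW m U f : Cdiff m.+1 U f -> Cdiff m U f.
Proof.
elim: m f => [|m IH] f [fc fd]; first by split.
split=> // v.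
by have [fdv fC] := fd v; split => //; exact: IH.
Qed.

Lemma CdiffS m U f : open U -> (forall x, U x -> {for x, continuous f}) ->
  (forall v, exists2 D : V -> R, forall x, U x -> is_derive x v f (D x) &
     Cdiff m U D) ->
  Cdiff m.+1 U f.
Proof.
move=> Uo fc fd; split=> // v; have [D fD DC] := fd v; split.
  by move=> x /fD[].
by apply: Cdiff_ext DC => // x /fD[_ ->].
Qed.

Lemma Cdiff_derive m U f v : Cdiff m.+1 U f ->
  (forall x, U x -> is_derive x v f ('D_v f x)) /\ Cdiff m U (fun x => 'D_v f x).
Proof. by case=> _ /(_ v) [fd fC]; split => // x Ux; split => //; exact: fd. Qed.

Lemma Cdiff_const m U (a : R) : Cdiff m U (fun=> a).
Proof.
elim: m a => [|m IH] a; first by split=> // x _; exact: cvg_cst.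
split=> [x _|v]; first exact: cvg_cst.
split=> [x _|]; first by have [] := is_derive_const a x v.
have -> : (fun x : V => 'D_v (fun=> a) x) = (fun=> 0).
  by apply/funext => x; have [_] := is_derive_const a x v.
exact: IH.
Qed.

Lemma Cdiff_add m U f g : open U -> Cdiff m U f -> Cdiff m U g ->
  Cdiff m U (fun x => f x + g x).
Proof.
move=> Uo; elim: m f g => [|m IH] f g fC gC.
  split=> // x Ux.
  by apply: continuousD; [exact: Cdiff_continuous fC _ Ux|exact: Cdiff_continuous gC _ Ux].
apply: CdiffS => // [x Ux|v].
  by apply: continuousD; [exact: Cdiff_continuous fC _ Ux|exact: Cdiff_continuous gC _ Ux].
have [fd fC'] := Cdiff_derive v fC; have [gd gC'] := Cdiff_derive v gC.
exists (fun x => 'D_v f x + 'D_v g x); last exact: IH.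
by move=> x Ux; apply: is_derive_add; [exact: fd|exact: gd].
Qed.

Lemma Cdiff_mul m U f g : open U -> Cdiff m U f -> Cdiff m U g ->
  Cdiff m U (fun x => f x * g x).
Proof.
move=> Uo; elim: m f g => [|m IH] f g fC gC.
  split=> // x Ux.
  by apply: continuousM; [exact: Cdiff_continuous fC _ Ux|exact: Cdiff_continuous gC _ Ux].
apply: CdiffS => // [x Ux|v].
  by apply: continuousM; [exact: Cdiff_continuous fC _ Ux|exact: Cdiff_continuous gC _ Ux].
have [fd fC'] := Cdiff_derive v fC; have [gd gC'] := Cdiff_derive v gC.
exists (fun x => 'D_v f x * g x + f x * 'D_v g x).
  by move=> x Ux; apply: is_derive_mul; [exact: fd|exact: gd].
by apply: Cdiff_add => //; apply: IH => //; exact: CdiffW.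
Qed.

Lemma Cdiff_mull m U f (a : R) : open U -> Cdiff m U f ->
  Cdiff m U (fun x => a * f x).
Proof. by move=> Uo; apply: Cdiff_mul => //; exact: Cdiff_const. Qed.

Lemma Cdiff_opp m U f : open U -> Cdiff m U f -> Cdiff m U (fun x => - f x).
Proof.
move=> Uo /(Cdiff_mull (-1) Uo); apply: Cdiff_ext => // x _.
by rewrite mulN1r.
Qed.

Lemma Cdiff_sub m U f g : open U -> Cdiff m U f -> Cdiff m U g ->
  Cdiff m U (fun x => f x - g x).
Proof. by move=> Uo fC /(Cdiff_opp Uo); exact: Cdiff_add. Qed.

Lemma Cdiff_exp m U f n : open U -> Cdiff m U f -> Cdiff m U (fun x => f x ^+ n).
Proof.
move=> Uo fC; elim: n => [|n IH].
  by apply: Cdiff_ext (Cdiff_const m U 1) => // x _; rewrite expr0.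
by apply: Cdiff_ext (Cdiff_mul Uo fC IH) => // x _; rewrite exprS.
Qed.

Lemma Cdiff_sum m U (I : Type) (s : seq I) (F : I -> V -> R) : open U ->
  (forall i, Cdiff m U (F i)) -> Cdiff m U (fun x => \sum_(i <- s) F i x).
Proof.
move=> Uo FC; elim: s => [|i s IH].
  by apply: Cdiff_ext (Cdiff_const m U 0) => // x _; rewrite big_nil.
by apply: Cdiff_ext (Cdiff_add Uo (FC i) IH) => // x _; rewrite big_cons.
Qed.

Lemma Cdiff_linear m U f : continuous f ->
  (forall x v, is_derive x v f (f v)) -> Cdiff m U f.
Proof.
move=> fc fd; case: m => [|m]; first by split=> // x _; exact: fc.
split=> [x _|v]; first exact: fc.
split=> [x _|]; first by have [] := fd x v.
have -> : (fun x : V => 'D_v f x) = (fun=> f v).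
  by apply/funext => x; have [_] := fd x v.
exact: Cdiff_const.
Qed.

End SmoothCalculus.

Section SmoothRealFunctions.
Variables (R : realType).
Implicit Types (O : set R) (f g G : R -> R).

Lemma is_derive_dir f (x d v : R) : is_derive x 1 f d -> is_derive x v f (v * d).
Proof.
move=> fd; apply/is_derive_line.
have D : is_derive (0 : R) 1 (fun t : R => t *: v + x) v.
  have := is_derive_add (is_derive_mul (is_derive_ident 0) (is_derive_const v (0 : R) 1))
    (is_derive_const x (0 : R) 1).
  by move=> /is_derive_eq; apply; ring.
rewrite mulrC; apply: is_derive_comp D.
by rewrite scale0r add0r.
Qed.

Lemma Cdiff_deriveS m O f f' : open O ->
  (forall x : R, O x -> is_derive x 1 f (f' x)) -> Cdiff m O f' -> Cdiff m.+1 O f.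
Proof.
move=> Oo fd fC; apply: CdiffS => // [x /fd /is_derive_cont //|v].
exists (fun x => v * f' x); last exact: Cdiff_mull.
by move=> x /fd; exact: is_derive_dir.
Qed.

Lemma Cdiff_ident m O : Cdiff m O (fun x : R => x).
Proof. by apply: Cdiff_linear => x; exact: cvg_id. Qed.

(** Regularity of solutions of a differential equation: when f' is a smooth expression in f, it is
    as regular as f, and each round gains one order. *)
Lemma smooth_bootstrap O f f' : open O ->
  (forall x : R, O x -> is_derive x 1 f (f' x)) ->
  (forall m, Cdiff m O f -> Cdiff m O f') -> smooth_on O f.
Proof.
move=> Oo fd fC; elim=> [|m IH].
  by split => // x /fd /is_derive_cont.
by apply: (Cdiff_deriveS Oo fd); exact: fC.
Qed.

Lemma smooth_derive O f f' : open O ->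
  (forall x : R, O x -> is_derive x 1 f (f' x)) -> smooth_on O f -> smooth_on O f'.
Proof.
move=> Oo fd fC m; have [_ ] := Cdiff_derive (1 : R) (fC m.+1).
by apply: Cdiff_ext => // x /fd[_ ->].
Qed.

Lemma smooth_inv O : open O -> (forall x, O x -> x != 0) ->
  smooth_on O (fun x : R => x^-1).
Proof.
move=> Oo O0; apply: (@smooth_bootstrap _ _ (fun x => - (x^-1 ^+ 2))) => //.
  move=> x /O0 x0; have := is_derive_inv x0 (is_derive_ident x).
  by move=> /is_derive_eq; apply; rewrite exprVn mulNr mul1r.
by move=> m C; apply: Cdiff_opp => //; exact: Cdiff_exp.
Qed.

Lemma smooth_sqrt O : open O -> (forall x, O x -> 0 < x) ->
  smooth_on O (@Num.sqrt R).
Proof.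
move=> Oo O0; elim=> [|m IH].
  by split => // x _; exact: sqrt_continuous.
have Op : open [set x : R | 0 < x] by exact: open_gt.
(* Written as sqrt x / (2 x), the derivative involves the square root itself, and the induction on
   the order closes. *)
apply: (@Cdiff_deriveS _ _ _ (fun x => 2^-1 * (Num.sqrt x * x^-1))) => //.
  move=> x /O0 x0; have := is_derive1_sqrt x0.
  move=> /is_derive_eq; apply.
  have s0 : Num.sqrt x != 0 by rewrite gt_eqF // sqrtr_gt0.
  by rewrite -{3}(sqr_sqrtr (ltW x0)); field; rewrite s0.
apply: Cdiff_mull => //; apply: Cdiff_mul => //.
by apply: smooth_inv => // x /O0; case: ltgtP.
Qed.

End SmoothRealFunctions.

Section SmoothComposition.
Variables (R : realType) (V : normedModType R).
Implicit Types (f : V -> R) (U : set V) (O : set R) (G : R -> R).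

Lemma Cdiff_comp m U O G f : open U -> open O -> (forall x, U x -> O (f x)) ->
  Cdiff m O G -> Cdiff m U f -> Cdiff m U (fun x => G (f x)).
Proof.
move=> Uo Oo UO; elim: m G f UO => [|m IH] G f UO GC fC.
  split=> // x Ux; apply: (@continuous_comp _ _ _ f G); first exact: Cdiff_continuous fC _ Ux.
  exact: (Cdiff_continuous GC (UO _ Ux)).
apply: CdiffS => // [x Ux|v].
  apply: (@continuous_comp _ _ _ f G); first exact: Cdiff_continuous fC _ Ux.
  exact: (Cdiff_continuous GC (UO _ Ux)).
have [fd fC'] := Cdiff_derive v fC; have [Gd GC'] := Cdiff_derive (1 : R) GC.
exists (fun x => 'D_1 G (f x) * 'D_v f x).
  by move=> x Ux; apply: is_derive_comp; [exact: Gd (UO _ Ux)|exact: fd].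
apply: Cdiff_mul => //.
exact: (IH (fun y => 'D_1 G y) f UO GC' (CdiffW fC)).
Qed.

Lemma Cdiff_inv m U f : open U -> (forall x, U x -> f x != 0) -> Cdiff m U f ->
  Cdiff m U (fun x => (f x)^-1).
Proof.
move=> Uo f0 fC; have No := @open_neq R 0.
apply: (@Cdiff_comp m U [set x : R | x != 0] (fun x => x^-1)) => //.
by apply: smooth_inv.
Qed.

Lemma Cdiff_div m U (f g : V -> R) : open U -> (forall x, U x -> g x != 0) -> Cdiff m U f ->
  Cdiff m U g -> Cdiff m U (fun x => f x / g x).
Proof. by move=> Uo g0 fC gC; apply: Cdiff_mul => //; exact: Cdiff_inv. Qed.

End SmoothComposition.

(** * Clamping, Lipschitz bounds and Gronwall inequalities *)

Section Clamp.
Variable R : realType.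
Implicit Types (a b x y : R) (f : R -> R).

(** The nonexpansive retraction of the line onto [a, b]: composed with it, a function that is
    Lipschitz on the segment is Lipschitz everywhere. *)
Definition clamp a b x : R := Num.max a (Num.min b x).

Lemma clamp_itv a b x : a <= b -> a <= clamp a b x <= b.
Proof. by move=> ab; rewrite /clamp le_max lexx /= ge_max ab ge_min lexx. Qed.

Lemma clamp_id a b x : a <= x <= b -> clamp a b x = x.
Proof. by move=> /andP[ax xb]; rewrite /clamp (min_idPr xb) (max_idPr ax). Qed.

Lemma clamp_ge a b x : a <= b -> b <= x -> clamp a b x = b.
Proof. by move=> ab bx; rewrite /clamp (min_idPl bx) (max_idPr ab). Qed.

Lemma clamp_le a b x : a <= b -> x <= a -> clamp a b x = a.
Proof. by move=> ab xa; rewrite /clamp (min_idPr (le_trans xa ab)) (max_idPl xa). Qed.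

Lemma clamp_lipschitz a b x y : a <= b -> `|clamp a b x - clamp a b y| <= `|x - y|.
Proof.
move=> ab; wlog xy : x y / x <= y => [H|].
  by have [|/ltW] := leP x y; [exact: H|rewrite distrC (distrC x); exact: H].
rewrite (distrC x) (distrC (clamp a b x)) (ger0_norm (_ : 0 <= y - x)) ?subr_ge0 //.
rewrite ler_norml; apply/andP; rewrite /clamp.
have [bx|xb] := leP b x; have [by_|yb] := leP b y; rewrite ?(max_idPr ab);
  have [ax|xa] := leP a x; have [ay|ya] := leP a y; split; lra.
Qed.

Lemma lipschitz_continuous f (K : R) :
  (forall x y, `|f x - f y| <= K * `|x - y|) -> continuous f.
Proof.
move=> fK x; apply/cvgrPdist_lt => e e0.
have K1 : 0 < `|K| + 1 by rewrite ltr_pwDr.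
have : \forall y \near x, `|x - y| < e / (`|K| + 1).
  have /cvgrPdist_lt := @cvg_id _ (nbhs x); apply; exact: divr_gt0.
apply: filterS => y; rewrite ltr_pdivlMr // => H.
apply: le_lt_trans (fK x y) _; apply: le_lt_trans H; rewrite mulrC ler_wpM2l //.
by apply: le_trans (ler_norm K) _; rewrite lerDl.
Qed.

Lemma clamp_continuous a b : a <= b -> continuous (clamp a b).
Proof.
by move=> ab; apply: (@lipschitz_continuous _ 1) => x y; rewrite mul1r clamp_lipschitz.
Qed.

Lemma bounded_segment a b f : (forall x, a <= x <= b -> {for x, continuous f}) ->
  exists2 M, 0 <= M & forall x, a <= x <= b -> `|f x| <= M.
Proof.
move=> fc; have [ab|ba] := leP a b; last first.
  by exists 0 => // x /andP[ax xb]; exfalso; lra.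
have [|c cab Hc] := @EVT_max R (fun x => `|f x|) a b ab.
  apply: continuous_in_subspaceT => x /[1!inE] /=; rewrite in_itv /= => xab.
  apply: (@continuous_comp _ _ _ f (@Num.norm _ R)); first exact: fc.
  exact: norm_continuous.
exists `|f c| => // x xab; apply: Hc; by rewrite in_itv.
Qed.

Lemma lipschitz_segment a b f f' :
  (forall x, a <= x <= b -> is_derive x 1 f (f' x)) ->
  (forall x, a <= x <= b -> {for x, continuous f'}) ->
  exists2 K, 0 <= K & forall x y, a <= x <= b -> a <= y <= b ->
    `|f x - f y| <= K * `|x - y|.
Proof.
move=> fd f'c; have [K K0 HK] := bounded_segment f'c; exists K => // x y.
wlog xy : x y / x <= y => [H xab yab|].
  by have [|/ltW] := leP x y => h; [exact: H|rewrite distrC (distrC x); exact: H].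
move=> /andP[ax xb] /andP[ay yb]; rewrite distrC (distrC x).
rewrite (ger0_norm (_ : 0 <= y - x)) ?subr_ge0 // mulrBr.
have KD (z : R) : is_derive z 1 (fun z => K * z) K.
  by have := is_derive_mull K (is_derive_ident z); rewrite mulr1.
apply: (@derive_norm_le R f f' (fun z => K * z) (fun=> K) x y xy) => z /andP[xz zy].
- by apply: fd; rewrite (le_trans ax xz) (le_trans zy yb).
- by apply: HK; rewrite (le_trans ax xz) (le_trans zy yb).
Qed.

Lemma smooth_lipschitz a b (O : set R) f : open O -> smooth_on O f ->
  (forall x, a <= x <= b -> O x) ->
  exists2 K, 0 <= K & forall x y, a <= x <= b -> a <= y <= b ->
    `|f x - f y| <= K * `|x - y|.
Proof.
move=> Oo fC OO; have [fd fC'] := Cdiff_derive (1 : R) (fC 1%N).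
apply: (@lipschitz_segment _ _ _ (fun x => 'D_1 f x)) => x /OO; first exact: fd.
exact: Cdiff_continuous fC' x.
Qed.

(** The product of f with the integrating factor exp(L x) is nondecreasing. *)
Lemma gronwall_pos a b (L : R) f f' : a <= b ->
  (forall x, a <= x <= b -> is_derive x 1 f (f' x)) ->
  (forall x, a <= x <= b -> - L * f x <= f' x) -> 0 < f a -> 0 < f b.
Proof.
move=> ab fd fL fa.
have D (x : R) : a <= x <= b -> is_derive x 1 (fun x => f x * expR (L * x))
    ((f' x + L * f x) * expR (L * x)).
  move=> /fd H; have H2 := is_derive_mull L (is_derive_ident x).
  have H3 := is_derive_comp (G := expR) (f := fun x => L * x) (is_derive_expR (L * x)) H2.
  by have := is_derive_mul H H3; move=> /is_derive_eq; apply; ring.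
have := derive_ge0_le ab D.
have H x : a <= x <= b -> 0 <= (f' x + L * f x) * expR (L * x).
  by move=> /fL fL'; rewrite mulr_ge0 ?expR_ge0 // -lerBlDr sub0r -mulNr.
move=> /(_ H) H1; rewrite -(pmulr_lgt0 _ (expR_gt0 (L * b))).
by apply: lt_le_trans H1; rewrite mulr_gt0 ?expR_gt0.
Qed.

(** If f vanished at some c, the square of f, which is nonnegative and satisfies a Gronwall
    inequality with constant 2 M, would still be positive at c. Squaring avoids any assumption on
    the sign of f between a and c. *)
Lemma linear_ode_pos a b (K f : R -> R) (M : R) : a <= b ->
  (forall x, a <= x <= b -> is_derive x 1 f (K x * f x)) ->
  (forall x, a <= x <= b -> `|K x| <= M) -> 0 < f a -> 0 < f b.
Proof.
move=> ab fd KM fa; rewrite ltNge; apply/negP => fb.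
have [||c /[!in_itv] /= /andP[ac cb] fc] := @IVT R f a b 0 ab.
- apply: derivable_within_continuous => x /[!in_itv] /= axb.
  by have [] := fd x axb.
- by rewrite ge_min le_max fb (ltW fa) orbT.
have : 0 < f c * f c.
  apply: (@gronwall_pos a c (2 * M) (fun x => f x * f x)
    (fun x => 2 * K x * (f x * f x)) ac); last exact: mulr_gt0.
  - move=> x /andP[ax xc]; have xab : a <= x <= b by rewrite ax (le_trans xc cb).
    have := is_derive_mul (fd x xab) (fd x xab).
    by move=> /is_derive_eq; apply; ring.
  - move=> x /andP[ax xc]; have xab : a <= x <= b by rewrite ax (le_trans xc cb).
    apply: ler_wpM2r; first by rewrite -expr2 sqr_ge0.
    by have := KM x xab; rewrite ler_norml => /andP[? ?]; lra.
by rewrite fc mul0r ltxx.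
Qed.

End Clamp.

(** * Global solutions of the graph equation *)

Section GraphODE.
Variable R : realType.
Implicit Types (F V : R -> R).

(* In terms of q = V / r the equation for V reads
   q' = (F q - q) / r + r q^2 F q, and [gam, bet] is invariant for q. *)
Lemma graph_ode F (O : set R) (gam bet r1 q0 : R) :
  open O -> smooth_on O F -> (forall q, gam <= q <= bet -> O q) ->
  0 < r1 -> gam < q0 < bet ->
  (forall r, r1 <= r -> gam <= (1 + (r * gam) ^+ 2) * F gam) ->
  (forall r, r1 <= r -> (1 + (r * bet) ^+ 2) * F bet <= bet) ->
  exists V (e : R), [/\ 0 < e, continuous V, V r1 = r1 * q0 &
    forall r : R, r1 - e < r -> [/\ 0 < r, gam < V r / r < bet &
      is_derive r 1 V ((1 + V r ^+ 2) * F (V r / r))]].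
Proof.
move=> Oo FC OI r10 /andP[gq qb] Hgam Hbet.
have gb : gam <= bet by rewrite ltW // (lt_trans gq qb).
have FC2 : smooth_on O (fun q => q ^+ 2 * F q).
  by move=> m; apply: Cdiff_mul => //; apply: Cdiff_exp => //; exact: Cdiff_ident.
have [K1 K10 HK1] := smooth_lipschitz Oo FC OI.
have [K2 K20 HK2] := smooth_lipschitz Oo FC2 OI.
(* Freezing r below r1 / 2 removes the pole at r = 0, so that the equation lives on the whole line.
   Together with the clamp of q this changes nothing where r >= r1 / 2 and q lies in [gam, bet]. *)
pose rt (r : R) := Num.max r (r1 / 2).
pose qt := clamp gam bet.
have rt0 r : 0 < rt r by rewrite lt_max; apply/orP; right; lra.
have rtc : continuous rt.
  apply: (@lipschitz_continuous _ _ 1) => x y; rewrite mul1r /rt.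
  rewrite ler_norml; apply/andP.
  have := ler_norm (x - y); have := ler_norm (y - x); rewrite (distrC y).
  by have [?|?] := leP x (r1 / 2); have [?|?] := leP y (r1 / 2); split; lra.
have rtVc : continuous (fun r => (rt r)^-1).
  by move=> r; apply: continuousV; [rewrite gt_eqF|exact: rtc].
have qtI x : gam <= qt x <= bet by exact: clamp_itv.
have qtL x y : `|qt x - qt y| <= `|x - y| by exact: clamp_lipschitz.
pose f1 x := F (qt x) - qt x; pose f2 x := qt x ^+ 2 * F (qt x).
have f1L x y : `|f1 x - f1 y| <= (K1 + 1) * `|x - y|.
  have -> : f1 x - f1 y = (F (qt x) - F (qt y)) - (qt x - qt y) by rewrite /f1; ring.
  apply: le_trans (ler_normB _ _) _; rewrite mulrDl mul1r lerD //.
  by apply: le_trans (HK1 _ _ (qtI x) (qtI y)) _; rewrite ler_wpM2l.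
have f2L x y : `|f2 x - f2 y| <= K2 * `|x - y|.
  by apply: le_trans (HK2 _ _ (qtI x) (qtI y)) _; rewrite ler_wpM2l.
have f1c := lipschitz_continuous f1L; have f2c := lipschitz_continuous f2L.
pose phi r x := f1 x * (rt r)^-1 + rt r * f2 x.
pose L r := (K1 + 1 + `|f1 q0|) * (rt r)^-1 + rt r * (K2 + `|f2 q0|).
have Lc : continuous L.
  move=> r; apply: (@continuousD _ _ _ (fun r => (K1 + 1 + `|f1 q0|) * (rt r)^-1)
    (fun r => rt r * (K2 + `|f2 q0|))); apply: continuousM;
    [exact: cvg_cst|exact: rtVc|exact: rtc|exact: cvg_cst].
have phiL r x y : `|phi r x - phi r y| <= L r * `|x - y|.
  have -> : phi r x - phi r y = (f1 x - f1 y) * (rt r)^-1 + rt r * (f2 x - f2 y).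
    by rewrite /phi; ring.
  apply: le_trans (ler_normD _ _) _; rewrite !normrM normfV (gtr0_norm (rt0 r)) mulrDl.
  apply: lerD; last first.
    rewrite -mulrA ler_pM2l //; apply: le_trans (f2L x y) _.
    by rewrite ler_wpM2r // lerDl.
  rewrite mulrAC ler_pM2r ?invr_gt0 //; apply: le_trans (f1L x y) _.
  by rewrite ler_wpM2r // lerDl.
have phiB r : `|phi r q0| <= L r.
  apply: le_trans (ler_normD _ _) _.
  rewrite [`|f1 q0 * _|]normrM [`|rt r * _|]normrM normfV (gtr0_norm (rt0 r)).
  apply: lerD; last by rewrite ler_pM2l // lerDr.
  by rewrite ler_pM2r ?invr_gt0 // lerDr addr_ge0.
have L0 r : 0 <= L r by exact: le_trans (phiB r).
have phic u : continuous u -> continuous (fun r => phi r (u r)).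
  move=> uc r; apply: (@continuousD _ _ _ (fun r => f1 (u r) * (rt r)^-1)
    (fun r => rt r * f2 (u r))); apply: continuousM; first 1 last.
  - exact: rtVc.
  - exact: rtc.
  - by apply: (@continuous_comp _ _ _ u f2); [exact: uc|exact: f2c].
  - by apply: (@continuous_comp _ _ _ u f1); [exact: uc|exact: f1c].
have [q [qr1 qD]] := picard r1 phic Lc L0 phiL phiB.
have rtE r : r1 / 2 <= r -> rt r = r by move=> h; exact/max_idPl.
have Lle r : r1 <= r -> L r <= (K1 + 1 + `|f1 q0|) * r1^-1 + r * (K2 + `|f2 q0|).
  move=> h; rewrite /L rtE; last by lra.
  rewrite lerD2r ler_wpM2l ?addr_ge0 // lef_pV2 ?posrE //; lra.
have Lle' x r : r1 <= x -> x <= r -> L x <= (K1 + 1 + `|f1 q0|) * r1^-1 + r * (K2 + `|f2 q0|).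
  by move=> h h2; apply: le_trans (Lle x h) _; rewrite lerD2l ler_wpM2r ?addr_ge0.
have phib r : r1 <= r -> phi r bet <= 0.
  move=> h; rewrite /phi /f1 /f2 /qt clamp_ge // rtE; last by lra.
  have r0 : 0 < r by lra.
  have -> : (F bet - bet) / r + r * (bet ^+ 2 * F bet) =
    ((1 + (r * bet) ^+ 2) * F bet - bet) / r by field; lra.
  by rewrite pmulr_lle0 ?invr_gt0 // subr_le0 Hbet.
have phig r : r1 <= r -> 0 <= phi r gam.
  move=> h; rewrite /phi /f1 /f2 /qt clamp_le // rtE; last by lra.
  have r0 : 0 < r by lra.
  have -> : (F gam - gam) / r + r * (gam ^+ 2 * F gam) =
    ((1 + (r * gam) ^+ 2) * F gam - gam) / r by field; lra.
  by rewrite divr_ge0 ?(ltW r0) // subr_ge0 Hgam.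
have qDb (x : R) : is_derive x 1 (fun x => q x - bet) (phi x (q x)).
  by have := is_derive_sub (qD x) (is_derive_const bet x 1); rewrite subr0.
have qDb' (x : R) : is_derive x 1 (fun x => bet - q x) (- phi x (q x)).
  by have := is_derive_sub (is_derive_const bet x 1) (qD x); rewrite sub0r.
have qDg (x : R) : is_derive x 1 (fun x => gam - q x) (- phi x (q x)).
  by have := is_derive_sub (is_derive_const gam x 1) (qD x); rewrite sub0r.
have qDg' (x : R) : is_derive x 1 (fun x => q x - gam) (phi x (q x)).
  by have := is_derive_sub (qD x) (is_derive_const gam x 1); rewrite subr0.
(* Once q exceeds bet, the clamped field has its value at bet, which is nonpositive by the barrier
   condition. *)
have qle r : r1 <= r -> q r <= bet.
  move=> h; rewrite -subr_le0.
  apply: (barrier (fun x _ => qDb x) _ _ h); first by rewrite qr1; lra.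
  move=> x xr; rewrite subr_gt0 => /ltW bq; have := phib x xr.
  by rewrite /phi /f1 /f2 /qt !clamp_ge.
have qge r : r1 <= r -> gam <= q r.
  move=> h; rewrite -subr_le0.
  apply: (barrier (fun x _ => qDg x) _ _ h); first by rewrite qr1; lra.
  move=> x xr; rewrite subr_gt0 => /ltW bq; have := phig x xr.
  by rewrite /phi /f1 /f2 /qt !clamp_le // oppr_le0.
(* Strictness: bet - q satisfies a Gronwall inequality with the Lipschitz constant of the field, so
   it cannot reach 0 from a positive value. *)
have qlt r : r1 <= r -> q r < bet.
  move=> h; rewrite -subr_gt0.
  apply: (gronwall_pos h (fun x _ => qDb' x)
    (L := (K1 + 1 + `|f1 q0|) * r1^-1 + r * (K2 + `|f2 q0|))).
    move=> x /andP[x1 xr]; have e0 : 0 <= bet - q x by rewrite subr_ge0 qle.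
    have := phiL x (q x) bet; rewrite distrC (distrC (q x)) (ger0_norm e0).
    have := ler_norm (phi x bet - phi x (q x)); have := phib x x1.
    rewrite distrC => h1 h2 h3.
    have h4 := ler_wpM2r e0 (Lle' x r x1 xr).
    rewrite mulNr lerNl opprK.
    have := ler_norm (phi x (q x) - phi x bet); lra.
  by rewrite qr1; lra.
have qgt r : r1 <= r -> gam < q r.
  move=> h; rewrite -subr_gt0.
  apply: (gronwall_pos h (fun x _ => qDg' x)
    (L := (K1 + 1 + `|f1 q0|) * r1^-1 + r * (K2 + `|f2 q0|))).
    move=> x /andP[x1 xr]; have e0 : 0 <= q x - gam by rewrite subr_ge0 qge.
    have := phiL x (q x) gam; rewrite (ger0_norm e0).
    have := phig x x1.
    move=> h2 h3.
    have h4 := ler_wpM2r e0 (Lle' x r x1 xr).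
    have := ler_norm (phi x gam - phi x (q x)); rewrite distrC mulNr; lra.
  by rewrite qr1; lra.
have qc : continuous q by exact: derivable_continuous qD.
have [e [e0 er He]] : exists e, [/\ 0 < e, e <= r1 / 2 &
    forall r, r1 - e < r -> r <= r1 -> gam < q r < bet].
  have N1 : \forall r \near r1, q r < bet.
    have h : q r1 < bet by rewrite qr1.
    exact: (qc r1 _ (lt_nbhsl h)).
  have N2 : \forall r \near r1, gam < q r.
    have h : gam < q r1 by rewrite qr1.
    exact: (qc r1 _ (lt_nbhsr h)).
  have [d /= d0 Hd] := filterI N1 N2.
  exists (Num.min d (r1 / 2)); split.
  - by rewrite lt_min d0 /=; lra.
  - by rewrite ge_min lexx orbT.
  - move=> r; rewrite ltrBlDr => h1 h2; have [|h3 h4] := Hd r.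
    + rewrite /= ger0_norm ?subr_ge0 // ltrBlDl; apply: lt_le_trans h1 _.
      by rewrite lerD2l ge_min lexx.
    + by rewrite h3 h4.
exists (fun r => r * q r), e; split=> //.
- by move=> r; apply: continuousM; [exact: cvg_id|exact: qc].
- by rewrite qr1.
move=> r re; have r0 : 0 < r by lra.
have qI : gam < q r < bet.
  by have [h|/ltW h] := leP r r1; [exact: He|rewrite qgt // qlt].
have rq : r * q r / r = q r by field; lra.
rewrite rq; split=> //.
have := is_derive_mul (is_derive_ident r) (qD r) => /is_derive_eq; apply.
rewrite /phi /f1 /f2 /qt clamp_id; last by case/andP: qI => ? ?; rewrite !ltW.
rewrite rtE; last by lra.
by field; lra.
Qed.

End GraphODE.

(** * The profile near its vertical tangent *)

Section Neck.
Variable R : realType.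

Definition ball0 (e : R) : set R := [set z | - e < z < e].

Lemma open_ball0 e : open (ball0 e).
Proof.
have -> : ball0 e = [set z | - e < z] `&` [set z | z < e].
  by apply/seteqP; split => z; [move=> /andP[]|move=> -[? ?]; apply/andP].
by apply: openI; [exact: open_gt|exact: open_lt].
Qed.

Lemma ball0_subset (e e' : R) : e <= e' -> ball0 e `<=` ball0 e'.
Proof. by move=> ee z /andP[? ?]; apply/andP; split; lra. Qed.

Lemma continuous_ball0 (f : R -> R) (e : R) : continuous f -> 0 < e ->
  exists2 d, 0 < d & forall z, ball0 d z -> `|f z - f 0| < e.
Proof.
move=> fc e0; have /cvgrPdist_lt /(_ e e0) [d /= d0 Hd] := fc 0.
exists d => // z /andP[z1 z2]; rewrite distrC; apply: Hd => /=.
by rewrite sub0r normrN ltr_norml z1 z2.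
Qed.

(* The neck is described by the slope p = dr/dz of r as a function of z: first r
   is found as a function of p, then p as a function of z. *)
Lemma neck_ode (G : R -> R) (s0 rho : R) : 0 < s0 -> 0 < rho ->
  smooth_on (ball0 s0) G -> (forall s, ball0 s0 s -> 0 < G s) ->
  exists (g p : R -> R) (e : R),
    [/\ 0 < e, g 0 = rho, p 0 = 0, smooth_on (ball0 e) g &
    forall z, ball0 e z -> [/\ 0 < g z, ball0 s0 (p z * g z),
      is_derive z 1 g (p z) &
      is_derive z 1 p ((1 + p z ^+ 2) / (g z * G (p z * g z)))]].
Proof.
move=> s00 rho0 GC G0.
have Go := @open_ball0 s0.
(* Dividing dr/dz = p by dp/dz = (1 + p^2) / (r G(p r)) gives dr/dp = Kf(p r) / (1 + p^2), a scalar
   equation that is regular at p = 0. *)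
pose Kf s := s * G s.
have KC : smooth_on (ball0 s0) Kf.
  by move=> m; apply: Cdiff_mul => //; exact: Cdiff_ident.
(* With |p| <= del and r <= 2 rho the product p r stays within s0 / 2, inside the domain of G. *)
pose del := s0 / (4 * rho).
have del0 : 0 < del by rewrite divr_gt0 // mulr_gt0.
have delE : del * (2 * rho) = s0 / 2 by rewrite /del; field; lra.
have sub s : - (s0 / 2) <= s <= s0 / 2 -> ball0 s0 s.
  by move=> /andP[? ?]; apply/andP; split; lra.
have [K K0 HK] := smooth_lipschitz Go KC sub.
pose pc := clamp (- del) del; pose rc := clamp (rho / 2) (2 * rho).
have dd : - del <= del by lra.
have rr : rho / 2 <= 2 * rho by lra.
have prI p r : - (s0 / 2) <= pc p * rc r <= s0 / 2.
  have /andP[p1 p2] : - del <= pc p <= del by exact: clamp_itv.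
  have /andP[r1 r2] : rho / 2 <= rc r <= 2 * rho by exact: clamp_itv.
  rewrite -ler_norml normrM -delE ler_pM // ?ler_norml ?p1 ?p2 //.
  by apply/andP; split=> //; lra.
pose phi p r := Kf (pc p * rc r) / (1 + p ^+ 2).
have q1 (p : R) : 1 <= 1 + p ^+ 2 by rewrite lerDl sqr_ge0.
have q10 (p : R) : 0 < 1 + p ^+ 2 by exact: lt_le_trans (q1 p).
have q1V (p : R) : (1 + p ^+ 2)^-1 <= 1 by rewrite invf_le1.
have pdel p : `|pc p| <= del by rewrite ler_norml; exact: clamp_itv.
have I0 : - (s0 / 2) <= 0 <= s0 / 2 by apply/andP; split; lra.
pose L (p : R) : R := K * del + K * (s0 / 2).
have phiL p x y : `|phi p x - phi p y| <= L p * `|x - y|.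
  rewrite /phi -mulrBl normrM (gtr0_norm (_ : 0 < (1 + p ^+ 2)^-1)) ?invr_gt0 //.
  have H : `|Kf (pc p * rc x) - Kf (pc p * rc y)| <= L p * `|x - y|.
    apply: le_trans (HK _ _ (prI p x) (prI p y)) _.
    rewrite -mulrBr normrM /L mulrDl -mulrA.
    rewrite (le_trans (_ : _ <= K * (del * `|x - y|))) //.
      by rewrite ler_wpM2l // ler_pM // clamp_lipschitz.
    by rewrite lerDl !mulr_ge0 //; lra.
  by apply: le_trans H; rewrite ler_piMr.
have phiB p : `|phi p rho| <= L p.
  rewrite /phi normrM (gtr0_norm (_ : 0 < (1 + p ^+ 2)^-1)) ?invr_gt0 //.
  apply: (@le_trans _ _ `|Kf (pc p * rc rho)|); first by rewrite ler_piMr.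
  have := HK _ _ (prI p rho) I0; rewrite /Kf mul0r !subr0 => H.
  apply: le_trans H _; rewrite /L.
  apply: (@le_trans _ _ (K * (s0 / 2))).
    by rewrite ler_wpM2l // ler_norml prI.
  by rewrite lerDr mulr_ge0 // ltW.
have L0 p : 0 <= L p by exact: le_trans (phiB p).
have Kcc : continuous (fun s => Kf (clamp (- (s0 / 2)) (s0 / 2) s)).
  apply: (@lipschitz_continuous _ _ K) => x y.
  have h : - (s0 / 2) <= s0 / 2 by lra.
  apply: le_trans (HK _ _ (clamp_itv x h) (clamp_itv y h)) _.
  by rewrite ler_wpM2l // clamp_lipschitz.
have phic u : continuous u -> continuous (fun p => phi p (u p)).
  move=> uc p; apply: (@continuousM _ _ (fun p => Kf (pc p * rc (u p)))
      (fun p => (1 + p ^+ 2)^-1)); last first.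
    apply: (@continuousV _ _ (fun p : R => 1 + p ^+ 2)); first by rewrite gt_eqF.
    apply: (@Cdiff_continuous _ _ 0 setT) => //.
    apply: Cdiff_add; [exact: openT|exact: Cdiff_const|].
    by apply: Cdiff_exp; [exact: openT|exact: Cdiff_ident].
  have -> : (fun p => Kf (pc p * rc (u p))) =
      (fun p => Kf (clamp (- (s0 / 2)) (s0 / 2) (pc p * rc (u p)))).
    by apply/funext => x; rewrite clamp_id.
  apply: (@continuous_comp _ _ _ (fun p => pc p * rc (u p))
    (fun s => Kf (clamp (- (s0 / 2)) (s0 / 2) s))); last exact: Kcc.
  apply: (@continuousM _ _ pc (fun p => rc (u p))); first exact: clamp_continuous.
  by apply: (@continuous_comp _ _ _ u rc); [exact: uc|exact: clamp_continuous].
have Lc : continuous L by move=> x; exact: cvg_cst.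
have [rf [rf0 rfD]] := picard 0 phic Lc L0 phiL phiB.
have rfc := derivable_continuous rfD.
have [d1 d10 Hd1] := continuous_ball0 rfc (divr_gt0 rho0 (ltr0Sn R 1)).
have [d [d0 dd1 ddel]] : exists d, [/\ 0 < d, d <= d1 & d <= del].
  by exists (Num.min d1 del); split; rewrite ?lt_min ?d10 ?ge_min ?lexx ?orbT.
have rfI p : ball0 d p -> rho / 2 < rf p < 2 * rho.
  move=> /(ball0_subset dd1) /Hd1; rewrite rf0 ltr_norml => /andP[? ?].
  by apply/andP; split; lra.
have prB p : ball0 d p -> ball0 s0 (p * rf p).
  move=> pd; have /andP[r1 r2] := rfI p pd; move: pd => /andP[p1 p2].
  apply: sub; rewrite -ler_norml normrM -delE ler_pM // ler_norml; clear - p1 p2 r1 r2 dd1 ddel rho0; apply/andP; split; lra.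
have rfD' p : ball0 d p -> is_derive p 1 rf (p * rf p * G (p * rf p) / (1 + p ^+ 2)).
  move=> pd; have := rfD p; rewrite /phi /pc /rc clamp_id ?clamp_id //.
    by have /andP[? ?] := rfI p pd; apply/andP; split; lra.
  by move: pd => /andP[? ?]; apply/andP; split; lra.
have dO := @open_ball0 d.
have prC m : Cdiff m (ball0 d) rf -> Cdiff m (ball0 d) (fun p => G (p * rf p)).
  move=> C; apply: (Cdiff_comp dO Go prB (GC m)).
  by apply: Cdiff_mul => //; exact: Cdiff_ident.
have qC m : Cdiff m (ball0 d) (fun p : R => 1 + p ^+ 2).
  by apply: Cdiff_add => //; [exact: Cdiff_const|apply: Cdiff_exp => //; exact: Cdiff_ident].
have rfC : smooth_on (ball0 d) rf.
  apply: (smooth_bootstrap dO rfD') => m C.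
  apply: Cdiff_div => //; first by move=> x _; rewrite gt_eqF.
  apply: Cdiff_mul => //; last exact: prC.
  by apply: Cdiff_mul => //; exact: Cdiff_ident.
(* The slope equation dp/dz = chi(p), autonomous once r is replaced by its expression in p. *)
pose chi p := (1 + p ^+ 2) / (rf p * G (p * rf p)).
have den0 p : ball0 d p -> 0 < rf p * G (p * rf p).
  by move=> pd; rewrite mulr_gt0 ?G0 //; [have /andP[? _] := rfI p pd; lra|exact: prB].
have chiC : smooth_on (ball0 d) chi.
  move=> m; apply: Cdiff_div => //; first by move=> x /den0; rewrite lt0r => /andP[].
  by apply: Cdiff_mul => //; exact: prC.
have subd p : - (d / 2) <= p <= d / 2 -> ball0 d p.
  by move=> /andP[? ?]; apply/andP; split; lra.
have [K2 K20 HK2] := smooth_lipschitz dO chiC subd.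
have dd2 : - (d / 2) <= d / 2 by lra.
pose pc2 := clamp (- (d / 2)) (d / 2).
pose phi2 (z p : R) := chi (pc2 p).
pose L2 (z : R) : R := K2 + `|chi (pc2 0)|.
have phi2L z x y : `|phi2 z x - phi2 z y| <= L2 z * `|x - y|.
  apply: le_trans (HK2 _ _ (clamp_itv x dd2) (clamp_itv y dd2)) _.
  apply: (@le_trans _ _ (K2 * `|x - y|)); first by rewrite ler_wpM2l // clamp_lipschitz.
  by rewrite ler_wpM2r // lerDl.
have phi2B z : `|phi2 z 0| <= L2 z by rewrite lerDr.
have L20 z : 0 <= L2 z by exact: le_trans (phi2B z).
have L2c : continuous L2 by move=> x; exact: cvg_cst.
have phi2c u : continuous u -> continuous (fun z => phi2 z (u z)).
  move=> uc z; apply: (@continuous_comp _ _ _ u (fun p => chi (pc2 p))); first exact: uc.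
  apply: (@lipschitz_continuous _ _ (K2 + `|chi (pc2 0)|)) => x y; exact: (phi2L z).
have [p [p0 pD]] := picard 0 phi2c L2c L20 phi2L phi2B.
have pcn := derivable_continuous pD.
have d20 : 0 < d / 2 by lra.
have [e e0 He] := continuous_ball0 pcn d20.
have pI z : ball0 e z -> - (d / 2) <= p z <= d / 2.
  by move=> /He; rewrite p0 subr0 ltr_norml => /andP[p1 p2]; clear - p1 p2; apply/andP; split; lra.
have pD' z : ball0 e z -> is_derive z 1 p (chi (p z)).
  by move=> ze; have := pD z; rewrite /phi2 /pc2 clamp_id //; exact: pI.
have eO := @open_ball0 e.
have pO z : ball0 e z -> ball0 d (p z) by move=> /pI /subd.
have pC : smooth_on (ball0 e) p.
  apply: (smooth_bootstrap eO pD') => m C.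
  exact: (Cdiff_comp eO dO pO (chiC m) C).
exists (fun z => rf (p z)), p, e; split=> //.
- by rewrite p0.
- by move=> m; exact: (Cdiff_comp eO dO pO (rfC m) (pC m)).
move=> z ze; have pd := pO z ze; split.
- by have /andP[? _] := rfI _ pd; lra.
- exact: prB.
- have := is_derive_comp (rfD' _ pd) (pD' z ze); move=> /is_derive_eq; apply.
  have /andP[r1 _] := rfI _ pd; have g0 := G0 _ (prB _ pd); have := q10 (p z).
  by rewrite /chi => ?; field; rewrite !gt_eqF //; lra.
- exact: pD'.
Qed.

End Neck.

(** * From the neck to a global branch *)

Section Branch.
Variable R : realType.

Lemma continuous_maxr (a : R) : continuous (fun r : R => Num.max a r).
Proof.
apply: (@lipschitz_continuous _ _ 1) => x y; rewrite mul1r ler_norml; apply/andP.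
have := ler_norm (x - y); have := ler_norm (y - x); rewrite (distrC y).
by have [?|?] := leP a x; have [?|?] := leP a y; split; lra.
Qed.

(** Inverts the neck z -> r. As h' may vanish at 0, where the tangent of the inverse is vertical,
    the inverse is differentiated only to the right of h 0. *)
Lemma increasing_inverse (h h' : R -> R) (e : R) : 0 < e ->
  (forall z : R, 0 <= z < e -> is_derive z 1 h (h' z)) ->
  (forall z : R, 0 < z < e -> 0 < h' z) -> 0 <= h' 0 ->
  [/\ forall x y : R, 0 <= x < e -> 0 <= y < e -> (h x < h y) = (x < y) &
  exists u : R -> R, (forall z : R, 0 <= z < e -> u (h z) = z) /\
    forall r : R, h 0 < r -> r < h (e / 2) -> [/\ 0 < u r < e / 2, h (u r) = r &
      is_derive r 1 u (h' (u r))^-1]].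
Proof.
move=> e0 hd h'0 h'00.
have inc x y : 0 <= x -> y < e -> x < y -> h x < h y.
  (* The derivative may vanish at x = 0, so a weak inequality is used up to the midpoint and a
     strict one beyond it. *)
  move=> x0 ye xy; pose m := (x + y) / 2.
  have [xm my] : x < m /\ m < y by rewrite /m; split; lra.
  apply: (@le_lt_trans _ _ (h m)).
    apply: (@derive_ge0_le R h h' x m (ltW xm)) => z /andP[? ?].
      by apply: hd; apply/andP; split; lra.
    have [z0|z0] := eqVneq z 0; first by rewrite z0.
    by apply/ltW/h'0; rewrite lt0r z0 /=; apply/andP; split; lra.
  apply: (@derive_gt0_lt R h h' m y my) => z /andP[? ?].
    by apply: hd; apply/andP; split; lra.
  by apply: h'0; apply/andP; split; lra.
have mono x y : 0 <= x < e -> 0 <= y < e -> (h x < h y) = (x < y).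
  move=> /andP[x0 xe] /andP[y0 ye]; apply/idP/idP; last exact: inc.
  rewrite !ltNge; apply: contra; rewrite le_eqVlt => /predU1P[->//|yx].
  exact/ltW/inc.
split=> //.
pose u r := xget 0 [set z | 0 <= z < e /\ h z = r].
have uh z : 0 <= z < e -> u (h z) = z.
  move=> ze; apply: xget_unique => // y [ye hy].
  by have [yz|yz|//] := ltgtP y z; move: yz; rewrite -mono // hy ltxx.
exists u; split=> // r r1 r2.
have e2 : 0 <= e / 2 by lra.
have [||z /[!in_itv] /= /andP[z0 ze] hz] := @IVT R h 0 (e / 2) r e2.
- apply: derivable_within_continuous => x /[!in_itv] /= /andP[? ?].
  by have [|] := hd x => //; apply/andP; split; lra.
- by rewrite ge_min le_max (ltW r1) (ltW r2) orbT.
have z0' : 0 < z.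
  by rewrite lt_neqAle z0 andbT; apply/eqP => E; move: r1; rewrite -hz -E ltxx.
have ze' : z < e / 2.
  by rewrite lt_neqAle ze andbT; apply/eqP => E; move: r2; rewrite -hz -E ltxx.
have uz : u r = z by rewrite -hz uh //; apply/andP; split; lra.
have N : \forall x \near z, 0 <= x < e.
  have ze2 : z < e by lra.
  near=> x; apply/andP; split; first by apply/ltW; near: x; exact: lt_nbhsr.
  by near: x; exact: lt_nbhsl.
rewrite uz; split; rewrite ?z0' //.
have N1 : {near z, cancel h u} by apply: filterS N => x; exact: uh.
have N2 : {near z, continuous h} by apply: filterS N => x /hd /is_derive_cont.
have zI : 0 <= z < e by rewrite z0; lra.
have hz0 : h' z != 0 by rewrite gt_eqF // h'0 // z0'; lra.
by have := is_derive_inverse N1 N2 (hd z zI) hz0; rewrite hz.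
Unshelve. all: by end_near. Qed.

(* Near the neck v is 1/p for the slope p of the neck; further out it is given by
   graph_ode. *)
Lemma branch (F G g p : R -> R) (O : set R) (s0 rho gam e : R) :
  open O -> smooth_on O F -> (forall q : R, gam <= q -> O q) ->
  0 < s0 -> gam * s0 <= 1 ->
  (forall r : R, 0 < r -> gam <= (1 + (r * gam) ^+ 2) * F gam) ->
  (forall s : R, 0 < s < s0 -> 0 < G s) ->
  (forall s : R, 0 < s < s0 -> F s^-1 = - (s * G s)^-1) ->
  0 < rho -> 0 < e -> g 0 = rho -> p 0 = 0 ->
  (forall z : R, 0 <= z < e -> [/\ 0 < g z, p z * g z < s0, 0 < z -> 0 < p z,
      is_derive z 1 g (p z) &
      is_derive z 1 p ((1 + p z ^+ 2) / (g z * G (p z * g z)))]) ->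
  exists (u v : R -> R) (d r1 bet : R),
  [/\ u rho = 0, continuous (fun r => u (Num.max rho r)),
    forall r : R, rho < r -> [/\ gam < v r / r, is_derive r 1 u (v r) &
      is_derive r 1 v ((1 + v r ^+ 2) * F (v r / r))],
    [/\ 0 < d, d <= e, forall z : R, 0 <= z < d -> u (g z) = z /\ rho <= g z & rho < r1] &
    [/\ forall r : R, rho <= r < r1 -> exists2 z, 0 <= z < d & g z = r,
      forall r : R, rho < r < r1 -> 0 < v r &
      forall r : R, r1 <= r -> v r / r < bet]].
Proof.
move=> Oo FC OI s00 gs Hgam G0 FG rho0 e0 g0 p0 np.
have gD z : 0 <= z < e -> is_derive z 1 g (p z) by case/np.
have ppos z : 0 < z < e -> 0 < p z.
  move=> /andP[z0 ze]; have zI : 0 <= z < e by rewrite ltW.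
  by have [_ _ /(_ z0)] := np z zI.
have p00 : 0 <= p 0 by rewrite p0.
have [mono [w [wg wr]]] := increasing_inverse e0 gD ppos p00.
have I0 : (0 : R) <= 0 < e by rewrite lexx e0.
(* The height at which the neck is pasted to the graph; being below e / 2, it leaves room for the
   inverse of g on both sides of r1. *)
pose z1 := e / 4.
have z1I : 0 < z1 < e by apply/andP; split; rewrite /z1; lra.
have z1I' : 0 <= z1 < e by case/andP: z1I => ? ?; rewrite ltW.
have e2I : 0 <= e / 2 < e by apply/andP; split; lra.
pose r1 := g z1.
have rr1 : rho < r1 by rewrite -g0 mono //; case/andP: z1I.
have r1e : r1 < g (e / 2) by rewrite mono // /z1; lra.
have p1 : 0 < p z1 by exact: ppos.
have r10 : 0 < r1 by lra.
pose q0 := (p z1 * r1)^-1.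
have q00 : 0 < q0 by rewrite invr_gt0 mulr_gt0.
have ps z : 0 < z < e -> 0 < p z * g z < s0.
  move=> zI; have /andP[z0 ze] := zI; have zI' : 0 <= z < e by rewrite ltW.
  have [h1 h2 _ _ _] := np z zI'.
  by rewrite h2 mulr_gt0 // ppos.
have gampg z : 0 < z < e -> gam < (p z * g z)^-1.
  move=> /ps /andP[h1 h2]; rewrite -(ltr_pM2r h1) mulVf ?gt_eqF //.
  have [g00|g00] := leP gam 0; first by apply: le_lt_trans ltr01; rewrite mulr_le0_ge0 // ltW.
  by apply: lt_le_trans gs; rewrite ltr_pM2l.
have gq0 : gam < q0 by exact: gampg.
have qI : gam < q0 < 2 * q0 by rewrite gq0; lra.
have OI' q : gam <= q <= 2 * q0 -> O q by move=> /andP[h _]; exact: OI.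
have Hgam' r : r1 <= r -> gam <= (1 + (r * gam) ^+ 2) * F gam.
  by move=> h; apply: Hgam; lra.
(* The number 2 q0 is 1 / s for s half of p r at the pasting point, hence in ]0, s0[, where F(1 / s)
   < 0: this makes it an upper barrier. *)
have Hbet r : r1 <= r -> (1 + (r * (2 * q0)) ^+ 2) * F (2 * q0) <= 2 * q0.
  move=> h; apply: (@le_trans _ _ 0); last by lra.
  rewrite pmulr_rle0; last by rewrite ltr_pwDl // sqr_ge0.
  have -> : 2 * q0 = ((p z1 * r1) / 2)^-1 by rewrite /q0; field; lra.
  have /andP[h1 h2] := ps _ z1I.
  have sI : 0 < p z1 * r1 / 2 < s0.
    by rewrite -/r1 in h1 h2; apply/andP; split; lra.
  rewrite FG // oppr_le0 invr_ge0 mulr_ge0 //; first by case/andP: sI => /ltW.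
  by apply/ltW/G0.
have [V [dl [dl0 Vc Vr1 HV]]] := graph_ode Oo FC OI' r10 qI Hgam' Hbet.
have Vp : V r1 = (p z1)^-1 by rewrite Vr1 /q0; field; rewrite !gt_eqF.
have [A Ar1 AD] := antiderivative_at r1 z1 Vc.
have wI r : rho < r -> r < g (e / 2) -> [/\ 0 < w r < e / 2, g (w r) = r &
    is_derive r 1 w (p (w r))^-1].
  by move=> h1 h2; apply: wr; rewrite ?g0.
have e2e : e / 2 < e by rewrite ltr_pdivrMr // ltr_pMr // ltr1n.
have w1 : w r1 = z1 by exact: wg.
pose v0 r := (p (w r))^-1.
have v0D r : rho < r -> r < g (e / 2) ->
    is_derive r 1 v0 ((1 + v0 r ^+ 2) * F (v0 r / r)).
  move=> h1 h2; have [/andP[w0 we] gw wD] := wI r h1 h2.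
  have wI' : 0 < w r < e by rewrite w0; lra.
  have pw := ppos _ wI'.
  have wI2 : 0 <= w r < e by rewrite (ltW w0); lra.
  have [_ _ _ _ pD] := np (w r) wI2.
  have D1 := is_derive_comp (G := p) (f := w) pD wD.
  have := is_derive_inv (f := fun r => p (w r)) (lt0r_neq0 pw) D1.
  move=> /is_derive_eq; apply.
  have := ps _ wI'; rewrite gw => sI; have := G0 _ sI => Gp.
  have -> : v0 r / r = (p (w r) * r)^-1 by rewrite /v0 invfM.
  rewrite FG // /v0; have r0 : 0 < r by lra.
  by field; rewrite !gt_eqF.
pose v (r : R) := if r < r1 then v0 r else V r.
pose u (r : R) := if r < r1 then w r else A r.
have uD r : rho < r -> is_derive r 1 u (v r).
  move=> h; rewrite /v; case: (ltgtP r r1) => [h1|h1|h1].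
  - have [_ _ wD] := wI r h (lt_trans h1 r1e).
    apply: is_derive_near wD; near=> y; rewrite /u ifT //; near: y; exact: lt_nbhsl.
  - apply: is_derive_near (AD r); near=> y; rewrite /u ifF //; apply/negbTE.
    by rewrite -leNgt ltW //; near: y; exact: lt_nbhsr.
  - rewrite h1; apply: (@is_derive_glue _ w A).
      by rewrite w1 Ar1.
    have [_ _] := wI r1 rr1 r1e; rewrite w1 Vp; exact.
(* At r1 the two slopes agree and solve the same equation, so their derivatives agree as well and
   the pieces can be glued. *)
have vD r : rho < r -> is_derive r 1 v ((1 + v r ^+ 2) * F (v r / r)).
  move=> h; case: (ltgtP r r1) => [h1|h1|h1].
  - have -> : v r = v0 r by rewrite /v h1.
    have D := v0D r h (lt_trans h1 r1e).
    apply: is_derive_near D; near=> y; rewrite /v ifT //; near: y; exact: lt_nbhsl.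
  - have -> : v r = V r by rewrite /v ltNge (ltW h1).
    have [|_ _ D] := HV r; first by lra.
    apply: is_derive_near D; near=> y; rewrite /v ifF //; apply/negbTE.
    by rewrite -leNgt ltW //; near: y; exact: lt_nbhsr.
  - rewrite h1; have v1 : v r1 = V r1 by rewrite /v ltxx.
    have v01 : v0 r1 = V r1 by rewrite /v0 w1 Vp.
    rewrite v1; apply: (@is_derive_glue _ v0 V) => //.
      by rewrite -v01; exact: v0D.
    by have [|_ _ D] := HV r1; [lra|exact: D].
have w0 : w rho = 0 by rewrite -g0 wg.
have urho : u rho = 0 by rewrite /u rr1.
exists u, v, z1, r1, (2 * q0); split.
- by [].
- move=> r; have [h|h|h] := ltgtP r rho.
  + apply: (@continuous_near _ _ (fun=> u rho)); last exact: cvg_cst.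
    near=> y; rewrite (max_idPl _) // ltW //; near: y; exact: lt_nbhsl.
  + apply: (@continuous_near _ _ u); last exact: is_derive_cont (uD r h).
    near=> y; rewrite (max_idPr _) // ltW //; near: y; exact: lt_nbhsr.
  + rewrite h; apply/cvgrPdist_lt => eps eps0.
    (* Continuity at the neck comes from monotonicity of g alone: u is below z2 on ]rho, g z2[. Its
       derivative 1 / p is unbounded there. *)
    pose z2 := Num.min (eps / 2) z1.
    have /andP[z10 z1e] := z1I.
    have z20 : 0 < z2 by rewrite lt_min z10 divr_gt0.
    have z2z1 : z2 <= z1 by rewrite ge_min lexx orbT.
    have z2e : z2 < eps by rewrite gt_min; apply/orP; left; lra.
    have z2I : 0 <= z2 < e by rewrite (ltW z20) (le_lt_trans z2z1 z1e).
    have g2 : rho < g z2 by rewrite -g0 mono.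
    near=> y; rewrite maxxx urho.
    have y2 : y < g z2 by near: y; exact: lt_nbhsl.
    have [yr|ry] := leP y rho; first by rewrite urho subrr normr0.
    have g2r : g z2 <= r1 by rewrite leNgt mono // -leNgt.
    have y1 : y < r1 by exact: lt_le_trans g2r.
    have [/andP[wy0 wye] gwy _] := wI y ry (lt_trans y1 r1e).
    rewrite /u y1 sub0r normrN gtr0_norm //; apply: lt_trans z2e.
    by rewrite -mono ?gwy // (ltW wy0) (lt_trans wye e2e).
- move=> r h; split; [|exact: uD|exact: vD].
  rewrite /v; case: (ltP r r1) => h1.
  + have [/andP[wy0 wye] gwy _] := wI r h (lt_trans h1 r1e).
    have wI' : 0 < w r < e by rewrite wy0 (lt_trans wye e2e).
    by have := gampg _ wI'; rewrite gwy invfM.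
  + by have [|_ /andP[? ?] _] := HV r; first lra.
- have /andP[z10 z1e] := z1I; split=> //; first exact: ltW.
  move=> z /andP[z0 zz]; have zI : 0 <= z < e by rewrite z0 (lt_trans zz).
  have -> : u (g z) = w (g z) by rewrite /u mono // zz.
  by split; [exact: wg|rewrite -g0 leNgt mono // -leNgt].
- split=> r.
  + move=> /andP[h1 h2]; have [h|h] := eqVneq r rho.
      by exists 0; rewrite ?g0 // lexx; case/andP: z1I.
    have hr : rho < r by rewrite lt_neqAle eq_sym h.
    have [/andP[wy0 wye] gwy _] := wI r hr (lt_trans h2 r1e).
    exists (w r) => //; rewrite (ltW wy0) /=.
    have wI' : 0 <= w r < e by rewrite ltW //= (lt_trans wye e2e).
    by rewrite -mono // gwy.
  + move=> /andP[h1 h2]; rewrite /v h2 invr_gt0; apply: ppos.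
    have [/andP[wy0 wye] _ _] := wI r h1 (lt_trans h2 r1e).
    by rewrite wy0 (lt_trans wye e2e).
  + move=> h; rewrite /v [r < r1]ltNge h /=.
    by have [|_ /andP[? ?] _] := HV r; first lra.
Unshelve. all: by end_near. Qed.

End Branch.

(** * Symbols at infinity *)

Section Symbols.
Variable R : realType.
Implicit Types (f g p : R -> R).

Definition ubounded f := exists A C : R, forall r, A < r -> `|f r| <= C.

Definition uderive f f' := exists A : R, forall r : R, A < r -> is_derive r 1 f (f' r).

(* Symbols of order 0; f |-> r f' is the Euler operator. *)
Fixpoint symb (m : nat) f : Prop :=
  ubounded f /\
  (if m is m'.+1 then exists2 f', uderive f f' & symb m' (fun r => r * f' r) else True).

Definition ueq f g := exists A : R, forall r, A < r -> f r = g r.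

Lemma ubounded_ext f g : ueq f g -> ubounded f -> ubounded g.
Proof.
move=> [A fg] [B [C fC]]; exists (Num.max A B), C => r; rewrite gt_max => /andP[? ?].
by rewrite -fg // fC.
Qed.

Lemma uderive_ext f g f' : ueq f g -> uderive f f' -> uderive g f'.
Proof.
move=> [A fg] [B fB]; exists (Num.max A B) => r; rewrite gt_max => /andP[rA rB].
apply: is_derive_near (fB r rB); near=> x; apply: fg; near: x; exact: lt_nbhsr.
Unshelve. all: by end_near. Qed.

Lemma symb_ext m f g : ueq f g -> symb m f -> symb m g.
Proof.
move=> fg; case: m => [|m] [fb fd]; split=> //; try exact: ubounded_ext fb.
by have [f' D S] := fd; exists f' => //; exact: uderive_ext D.
Qed.

Lemma symb_bounded m f : symb m f -> ubounded f.
Proof. by case: m => [|m] []. Qed.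

Lemma symbW m f : symb m.+1 f -> symb m f.
Proof.
elim: m f => [|m IH] f [fb [f' D S]]; split=> //.
by exists f' => //; exact: IH.
Qed.

Lemma symb_const m (c : R) : symb m (fun=> c).
Proof.
elim: m c => [|m IH] c; split=> //; try by exists 0, `|c|.
exists (fun=> 0); first by exists 0 => r _; exact: is_derive_const.
by apply: (symb_ext (f := fun=> 0)) => //; exists 0 => r _; rewrite mulr0.
Qed.

Lemma ubounded_add f g : ubounded f -> ubounded g -> ubounded (fun r => f r + g r).
Proof.
move=> [A [C fC]] [B [D gD]]; exists (Num.max A B), (C + D) => r.
rewrite gt_max => /andP[rA rB]; apply: le_trans (ler_normD _ _) _.
by rewrite lerD ?fC ?gD.
Qed.

Lemma ubounded_mul f g : ubounded f -> ubounded g -> ubounded (fun r => f r * g r).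
Proof.
move=> [A [C fC]] [B [D gD]]; exists (Num.max A B), (C * D) => r.
by rewrite gt_max => /andP[rA rB]; rewrite normrM ler_pM ?fC ?gD.
Qed.

Lemma symb_add m f g : symb m f -> symb m g -> symb m (fun r => f r + g r).
Proof.
elim: m f g => [|m IH] f g [fb fd] [gb gd]; split=> //; try exact: ubounded_add.
have [f' [A fD] fS] := fd; have [g' [B gD] gS] := gd.
exists (fun r => f' r + g' r).
  exists (Num.max A B) => r; rewrite gt_max => /andP[rA rB].
  by apply: is_derive_add; [exact: fD|exact: gD].
by apply: symb_ext (IH _ _ fS gS); exists 0 => r _; rewrite mulrDr.
Qed.

Lemma symb_mul m f g : symb m f -> symb m g -> symb m (fun r => f r * g r).
Proof.
elim: m f g => [|m IH] f g.
  by move=> [fb _] [gb _]; split=> //; exact: ubounded_mul.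
move=> fS gS; have fS' := symbW fS; have gS' := symbW gS.
have [fb [f' [A fD] fS1]] := fS; have [gb [g' [B gD] gS1]] := gS.
split; first exact: ubounded_mul.
exists (fun r => f' r * g r + f r * g' r).
  exists (Num.max A B) => r; rewrite gt_max => /andP[rA rB].
  by apply: is_derive_mul; [exact: fD|exact: gD].
apply: symb_ext (symb_add (IH _ _ fS1 gS') (IH _ _ fS' gS1)).
by exists 0 => r _; ring.
Qed.

Lemma symb_mull m f (c : R) : symb m f -> symb m (fun r => c * f r).
Proof. by apply: symb_mul; exact: symb_const. Qed.

Lemma symb_opp m f : symb m f -> symb m (fun r => - f r).
Proof.
by move=> /(symb_mull (-1)); apply: symb_ext; exists 0 => r _; rewrite mulN1r.
Qed.

Lemma symb_sub m f g : symb m f -> symb m g -> symb m (fun r => f r - g r).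
Proof. by move=> fS /symb_opp; exact: symb_add. Qed.

Lemma symb_exp m n f : symb m f -> symb m (fun r => f r ^+ n).
Proof.
move=> fS; elim: n => [|n IH].
  by apply: symb_ext (symb_const m 1); exists 0 => r _; rewrite expr0.
by apply: symb_ext (symb_mul fS IH); exists 0 => r _; rewrite exprS.
Qed.

Lemma symb_inv m : symb m (fun r => r^-1).
Proof.
elim: m => [|m IH]; split=> //; try by exists 1, 1 => r r1;
  rewrite normfV gtr0_norm ?invf_le1 ?ltW // (lt_trans ltr01 r1).
exists (fun r => - (r^-1 ^+ 2)).
  exists 0 => r r0; have := is_derive_inv (lt0r_neq0 r0) (is_derive_ident r).
  by move=> /is_derive_eq; apply; rewrite exprVn mulNr mul1r.
apply: symb_ext (symb_opp IH); exists 0 => r r0; field; exact: lt0r_neq0.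
Qed.

Lemma symb_comp m (O : set R) (G : R -> R) f (a b : R) : open O -> smooth_on O G ->
  (forall x : R, a <= x <= b -> O x) -> (exists A, forall r, A < r -> a <= f r <= b) ->
  symb m f -> symb m (fun r => G (f r)).
Proof.
move=> Oo GC OI [A fI]; elim: m G GC => [|m IH] G GC fS.
all: have [M M0 HM] : exists2 M, 0 <= M & forall x, a <= x <= b -> `|G x| <= M.
1, 3: apply: bounded_segment => x /OI; exact: Cdiff_continuous (GC 0%N) x.
all: have Gb : ubounded (fun r => G (f r)) by exists A, M => r rA; apply: HM; exact: fI.
  by split.
have fS' := symbW fS; have [_ [f' [B fD] fS1]] := fS; split=> //.
have GD x : O x -> is_derive x 1 G ('D_1 G x).
  by have [GD _] := Cdiff_derive (1 : R) (GC 1%N); exact: GD.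
exists (fun r => 'D_1 G (f r) * f' r).
  exists (Num.max A B) => r; rewrite gt_max => /andP[rA rB].
  by apply: is_derive_comp; [apply: GD; apply: OI; exact: fI|exact: fD].
have G1 := smooth_derive Oo GD GC.
apply: symb_ext (symb_mul (IH _ G1 fS') fS1).
by exists 0 => r _; ring.
Qed.

(** Above both its value at A + 1 and C / p0 the function f cannot increase, since there g <= p
    f. *)
Lemma lin_bound f p g (p0 A C : R) : 0 < p0 -> 0 < A ->
  (forall r : R, A < r -> is_derive r 1 f (r * (g r - p r * f r))) ->
  (forall r, A < r -> p0 <= p r) -> (forall r, A < r -> `|g r| <= C) ->
  exists M, forall r, A + 1 <= r -> f r <= M.
Proof.
move=> p00 A0 fD pb gb.
have C0 : 0 <= C by apply: le_trans (gb (A + 1) _); rewrite ?ltrDl.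
pose M := Num.max (f (A + 1)) (C / p0); exists M => r rA.
have M0 : 0 <= M by rewrite le_max divr_ge0 ?orbT // ltW.
rewrite -subr_le0.
apply: (@barrier R (fun r => f r - M) (fun r => r * (g r - p r * f r)) (A + 1)) => //.
- move=> x xA; have := is_derive_sub (fD x _) (is_derive_const M x 1).
  by rewrite subr0; apply; lra.
- by rewrite subr_le0 le_max lexx.
- move=> x xA; rewrite subr_gt0 => Mf; have Ax : A < x by lra.
  rewrite pmulr_rle0; last by lra.
  rewrite subr_le0; apply: le_trans (ler_norm _) _; apply: le_trans (gb x Ax) _.
  apply: (@le_trans _ _ (p0 * M)).
    by rewrite mulrC -ler_pdivrMr // le_max lexx orbT.
  by rewrite ler_pM ?pb // ltW.
Qed.

(* If f1 = r f' then f1 solves an equation of the same kind. *)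
Lemma lin_symb m f p g (p0 : R) : 0 < p0 ->
  uderive f (fun r => r * (g r - p r * f r)) ->
  (exists A, forall r, A < r -> p0 <= p r) -> symb m p -> symb m g -> symb m f.
Proof.
elim: m f p g p0 => [|m IH] f p g p0 p00 fD pb pS gS.
  split=> //; have [A fA] := fD; have [B pB] := pb.
  have [E [C gC]] := symb_bounded gS.
  pose A' := Num.max 1 (Num.max A (Num.max B E)).
  have HA r : A' < r -> [/\ A < r, B < r & E < r].
    by rewrite !gt_max => /andP[_ /andP[? /andP[? ?]]].
  have A'0 : 0 < A' by rewrite lt_max ltr01.
  have pB' r : A' < r -> p0 <= p r by move=> /HA[_ ? _]; exact: pB.
  have fA' (r : R) : A' < r -> is_derive r 1 f (r * (g r - p r * f r)).
    by move=> /HA[? _ _]; exact: fA.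
  have gC' r : A' < r -> `|g r| <= C by move=> /HA[_ _ ?]; exact: gC.
  have [M1 HM1] := lin_bound p00 A'0 fA' pB' gC'.
  have fAN (r : R) : A' < r -> is_derive r 1 (fun r => - f r) (r * (- g r - p r * - f r)).
    by move=> /fA' /is_derive_opp /is_derive_eq; apply; ring.
  have gCN r : A' < r -> `|- g r| <= C by rewrite normrN; exact: gC'.
  have [M2 HM2] := lin_bound (f := fun r => - f r) (g := fun r => - g r) p00 A'0 fAN pB' gCN.
  exists (A' + 1), (Num.max M1 M2) => r /ltW h; rewrite ler_norml lerNl !le_max.
  by rewrite HM1 // HM2 // orbT.
have fS : symb m f := IH f p g p0 p00 fD pb (symbW pS) (symbW gS).
split; first exact: symb_bounded fS.
exists (fun r => r * (g r - p r * f r)) => //.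
have [_ [p' pD pS1]] := pS; have [_ [g' gD gS1]] := gS.
(* Differentiating f1 = r f' = r^2 (g - p f) gives f1' = r (g1 - p1 f1) with p1 = p - 2 / r^2 and g1
   = r g' - r p' f. Halving p0 absorbs the term 2 / r^2 for large r. *)
apply: (IH _ (fun r => p r - 2 * r^-1 ^+ 2) (fun r => r * g' r - r * p' r * f r) (p0 / 2)).
- by rewrite divr_gt0.
- have [A fA] := fD; have [B pB] := pD; have [E gE] := gD.
  exists (Num.max 0 (Num.max A (Num.max B E))) => r.
  rewrite !gt_max => /andP[r0 /andP[rA /andP[rB rE]]].
  have D0 := is_derive_ident r.
  have D1 := is_derive_sub (gE r rE) (is_derive_mul (pB r rB) (fA r rA)).
  have := is_derive_mul D0 (is_derive_mul D0 D1).
  move=> /is_derive_eq; apply; field; exact: lt0r_neq0.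
- have [A pA] := pb; pose B := 4 / p0.
  exists (Num.max 1 (Num.max A B)) => r; rewrite !gt_max => /andP[r1 /andP[rA rB]].
  have r0 : 0 < r by lra.
  have h : 2 * r^-1 ^+ 2 <= p0 / 2.
    rewrite exprVn ler_pdivrMr ?exprn_gt0 //.
    rewrite ltr_pdivrMr // in rB.
    apply: (@le_trans _ _ (p0 / 2 * r)); first by lra.
    rewrite ler_pM2l ?divr_gt0 // expr2 ler_peMl //; lra.
  by have := pA r rA; lra.
- apply: symb_sub; first exact: symbW.
  by apply: symb_mull; apply: symb_exp; exact: symb_inv.
- by apply: symb_sub => //; exact: symb_mul.
Qed.

(** Every derivative is only required to be O(1 / r), with no gain at higher orders: this is the
    decay that [smoothly_asymptotic_to] asks for. *)
Fixpoint decl (m : nat) f : Prop :=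
  ubounded (fun r => r * f r) /\
  (if m is m'.+1 then exists2 f', uderive f f' & decl m' f' else True).

Lemma decl_ext m f g : ueq f g -> decl m f -> decl m g.
Proof.
move=> fg; have fg' : ueq (fun r => r * f r) (fun r => r * g r).
  by have [A H] := fg; exists A => r rA; rewrite H.
case: m => [|m] [fb fd]; split=> //; try exact: ubounded_ext fb.
by have [f' D S] := fd; exists f' => //; exact: uderive_ext D.
Qed.

Lemma decl_opp m f : decl m f -> decl m (fun r => - f r).
Proof.
elim: m f => [|m IH] f [[A [C fC]] fd]; split=> //;
  try by exists A, C => r rA; rewrite mulrN normrN fC.
have [f' [B fD] fS] := fd; exists (fun r => - f' r); last exact: IH.
by exists B => r rB; apply: is_derive_opp; exact: fD.
Qed.

Lemma symb_decl m f : symb m f -> decl m (fun r => f r / r).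
Proof.
elim: m f => [|m IH] f fS.
  split=> //; apply: ubounded_ext (symb_bounded fS).
  by exists 0 => r r0; field; exact: lt0r_neq0.
have fS' := symbW fS; have [fb [f' [A fD] fS1]] := fS; split.
  by apply: ubounded_ext fb; exists 0 => r r0; field; exact: lt0r_neq0.
exists (fun r => (r * f' r - f r) * r^-1 / r).
  exists (Num.max 0 A) => r; rewrite gt_max => /andP[r0 rA].
  have := is_derive_mul (fD r rA) (is_derive_inv (lt0r_neq0 r0) (is_derive_ident r)).
  by move=> /is_derive_eq; apply; field; exact: lt0r_neq0.
by apply: IH; apply: symb_mul; [exact: symb_sub|exact: symb_inv].
Qed.

Lemma decl_of_symb m f f' : uderive f f' -> ubounded (fun r => r * f r) ->
  symb m (fun r => r * f' r) -> decl m.+1 f.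
Proof.
move=> fD fb fS; split=> //; exists f' => //.
by apply: decl_ext (symb_decl fS); exists 0 => r r0; field; exact: lt0r_neq0.
Qed.

Lemma declS m f f' : uderive f f' -> ubounded (fun r => r * f r) ->
  decl m f' -> decl m.+1 f.
Proof. by move=> fD fb fS; split=> //; exists f'. Qed.

(** As |f'| <= C / r^2, the intervals of radius C / r about f r are nested; their common point is
    the limit, reached at rate C / r. *)
Lemma limit_of_derivative f f' : uderive f f' ->
  ubounded (fun r => r ^+ 2 * f' r) -> exists c, ubounded (fun r => r * (f r - c)).
Proof.
move=> [A fD] [B [C fC]]; pose a := Num.max 1 (Num.max A B) + 1.
have Ha r : a <= r -> [/\ 0 < r, A < r & B < r].
  move=> h; have : Num.max 1 (Num.max A B) < r by rewrite /a in h; lra.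
  by rewrite !gt_max => /andP[r1 /andP[rA rB]]; split=> //; lra.
have iD (r : R) : 0 < r -> is_derive r 1 (fun x => - C * x^-1) (C / r ^+ 2).
  move=> r0; have := is_derive_mull (- C) (is_derive_inv (lt0r_neq0 r0) (is_derive_ident r)).
  by move=> /is_derive_eq; apply; field; exact: lt0r_neq0.
have mono x y : a <= x -> x <= y -> `|f y - f x| <= C / x - C / y.
  move=> ax xy; have -> : C / x - C / y = - C * y^-1 - - C * x^-1 by ring.
  apply: (@derive_norm_le R f f' (fun x => - C * x^-1) (fun x => C / x ^+ 2) x y xy).
  - by move=> z /andP[xz _]; apply: fD; have [] := Ha z (le_trans ax xz).
  - by move=> z /andP[xz _]; apply: iD; have [] := Ha z (le_trans ax xz).
  - move=> z /andP[xz _]; have [z0 _ zB] := Ha z (le_trans ax xz).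
    rewrite ler_pdivlMr ?exprn_gt0 // mulrC -(ger0_norm (sqr_ge0 z)) -normrM.
    exact: fC.
pose x_ (i : R) := Num.max a i.
have xa i : a <= x_ i by rewrite le_max lexx.
have [|c Hc] := between_exists 0 (lo := fun i => f (x_ i) - C / x_ i)
  (hi := fun i => f (x_ i) + C / x_ i).
  move=> i j; have [ij|/ltW ji] := leP (x_ i) (x_ j).
  - have [y0 _ yB] := Ha _ (xa j).
    have := mono _ _ (xa i) ij; rewrite ler_norml => /andP[h1 h2].
    have C0 : 0 <= C by apply: le_trans (fC _ yB).
    have : 0 <= C / x_ j by rewrite divr_ge0 // ltW.
    by lra.
  - have [y0 _ yB] := Ha _ (xa i).
    have := mono _ _ (xa j) ji; rewrite ler_norml => /andP[h1 h2].
    have C0 : 0 <= C by apply: le_trans (fC _ yB).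
    have : 0 <= C / x_ i by rewrite divr_ge0 // ltW.
    by lra.
exists c, a, C => r /ltW ar; have [r0 _ _] := Ha r ar.
have := Hc r; rewrite /x_ (max_idPr ar) => /andP[h1 h2].
rewrite normrM gtr0_norm // mulrC -ler_pdivlMr // ler_norml; apply/andP; split; lra.
Qed.

End Symbols.

(** * Asymptotic expansion of a branch *)

Section Asymptotics.
Variable R : realType.

(* With q = V / r and y = r^2 F q the equation reads
   r y' = r^2 (g - p y) with p bounded below, so y is a symbol, and then so is q;
   the limit of y is 1 / alpha. *)
Lemma asym_expansion (F u V : R -> R) (O : set R) (gam bet alp lam r0 : R) :
  open O -> smooth_on O F -> (forall q : R, gam <= q <= bet -> O q) -> 0 < gam ->
  gam <= alp <= bet -> F alp = 0 -> 0 < lam ->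
  (forall q : R, gam <= q <= bet -> 'D_1 F q <= - lam) ->
  (forall r : R, r0 < r -> gam <= V r / r <= bet /\
     is_derive r 1 V ((1 + V r ^+ 2) * F (V r / r))) ->
  uderive u V ->
  exists C, forall m, decl m
    (fun r => u r - (alp / 2 * r ^+ 2 + (alp * 'D_1 F alp)^-1 * ln r + C)).
Proof.
move=> Oo FC OI gam0 alpI Falp lam0 Flam HV uV.
pose F1 q := 'D_1 F q.
have F1C : smooth_on O F1.
  apply: (smooth_derive Oo _ FC) => x Ox.
  by have [FD _] := Cdiff_derive (1 : R) (FC 1%N); exact: FD.
have FD (q : R) : gam <= q <= bet -> is_derive q 1 F (F1 q).
  by have [FD _] := Cdiff_derive (1 : R) (FC 1%N) => /OI; exact: FD.
have alp0 : 0 < alp by case/andP: alpI => ? _; lra.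
have F1a : F1 alp < 0 by have := Flam _ alpI; rewrite /F1 => ?; lra.
have F1a0 : F1 alp != 0 by rewrite ltr0_neq0.
pose q r := V r / r; pose y r := r ^+ 2 * F (q r).
pose a0 := Num.max 1 r0.
have Ha r : a0 < r -> [/\ 1 < r, 0 < r & r0 < r].
  by rewrite gt_max => /andP[h1 h2]; split=> //; lra.
have qI r : r0 < r -> gam <= q r <= bet by move=> /HV [].
have qIe : exists A, forall r, A < r -> gam <= q r <= bet by exists r0.
have q0 r : a0 < r -> 0 < q r by move=> /Ha[_ _ /qI /andP[? _]]; lra.
have VD : uderive V (fun r => (1 + V r ^+ 2) * F (q r)) by exists r0 => r /HV[].
have VE r : a0 < r -> V r = r * q r.
  by move=> /Ha[_ h _]; rewrite /q; field; exact: lt0r_neq0.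
have qD : uderive q (fun r => ((1 + V r ^+ 2) * F (q r) - q r) / r).
  exists a0 => r ra; have [r1 rp rr] := Ha r ra; have [_ D] := HV r rr.
  have := is_derive_mul D (is_derive_inv (lt0r_neq0 rp) (is_derive_ident r)).
  move=> /is_derive_eq; apply; rewrite -/(q r) {2}(VE r ra); field; exact: lt0r_neq0.
have qE r : a0 < r -> r * (((1 + V r ^+ 2) * F (q r) - q r) / r) =
    (r^-1 ^+ 2 + q r ^+ 2) * y r - q r.
  move=> ra; have [_ rp _] := Ha r ra; rewrite (VE r ra) /y; field; exact: lt0r_neq0.
(* These come from differentiating y = r^2 F(q) with r q' = (r^-2 + q^2) y - q. Up to O(r^-2), p is
   - q^2 F'(q), which is at least gam^2 lam; half of this bound survives for large r. *)
pose p r := - (2 + F1 (q r)) * r^-1 ^+ 2 - q r ^+ 2 * F1 (q r).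
pose g r := - (F1 (q r) * q r).
have yD : uderive y (fun r => r * (g r - p r * y r)).
  have [A qA] := qD; exists (Num.max a0 A) => r; rewrite gt_max => /andP[ra rA].
  have [r1 rp rr] := Ha r ra.
  have D1 := is_derive_comp (FD _ (qI r rr)) (qA r rA).
  have := is_derive_mul (is_derive_exp 2 (is_derive_ident r)) D1.
  move=> /is_derive_eq; apply; rewrite (VE r ra) /p /g /y /=; field; exact: lt0r_neq0.
have S0q : symb 0 q.
  split=> //; exists r0, bet => r /qI /andP[? ?]; rewrite ler_norml; apply/andP; split; lra.
have rS m : symb m (fun r : R => r^-1 ^+ 2) by apply: symb_exp; exact: symb_inv.
have F1S m : symb m q -> symb m (fun r => F1 (q r)).
  exact: (symb_comp Oo F1C OI qIe).
have gl : 0 < gam ^+ 2 * lam / 2 by rewrite !mulr_gt0 // ?invr_gt0 // exprn_gt0.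
have h0 (s t : R) : 0 < s -> s <= t -> s ^+ 2 <= t ^+ 2.
  by move=> s0 st; rewrite lerXn2r ?nnegrE // ltW // (lt_le_trans s0).
have p0 : exists A, forall r, A < r -> gam ^+ 2 * lam / 2 <= p r.
  have [B [C HC]] := symb_bounded (symb_add (symb_const 0 (2 : R)) (F1S 0%N S0q)).
  pose E := C / (gam ^+ 2 * lam / 2).
  exists (Num.max a0 (Num.max B E)) => r; rewrite gt_max => /andP[ra]; rewrite gt_max => /andP[rB rE].
  have [r1 rp rr] := Ha r ra; have /andP[q1 q2] := qI r rr.
  have F1q : F1 (q r) <= - lam by apply: Flam; exact: qI.
  have h1 : gam ^+ 2 * lam <= q r ^+ 2 * - F1 (q r).
    by apply: ler_pM (exprn_ge0 2 (ltW gam0)) (ltW lam0) (h0 _ _ gam0 q1) _; rewrite lerNr.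
  have h2 : (2 + F1 (q r)) * r^-1 ^+ 2 <= gam ^+ 2 * lam / 2.
    rewrite exprVn ler_pdivrMr ?exprn_gt0 //; apply: le_trans (ler_norm _) _.
    apply: le_trans (HC r rB) _; rewrite ltr_pdivrMr // in rE.
    apply: le_trans (ltW rE) _; by rewrite mulrC ler_pM2l // expr2 ler_peMl // ltW.
  by rewrite mulrN in h1; rewrite /p mulNr; lra.
have pS m : symb m q -> symb m p.
  move=> qS; apply: symb_sub; apply: symb_mul => //.
  - by apply: symb_opp; apply: symb_add; [exact: symb_const|exact: F1S].
  - exact: symb_exp.
  - exact: F1S.
have gS m : symb m q -> symb m g.
  by move=> qS; apply: symb_opp; apply: symb_mul => //; exact: F1S.
have yS' m : symb m q -> symb m y.
  by move=> qS; exact: (lin_symb gl yD p0 (pS m qS) (gS m qS)).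
(* Bootstrap: if q is a symbol to order m then so is y, by the linear equation; hence r q', a
   polynomial in 1 / r, q and y, is one too, which gives order m + 1 for q. *)
have qS m : symb m q.
  elim: m => [//|m IH]; split; first exact: symb_bounded IH.
  eexists; first exact: qD.
  apply: (symb_ext (f := fun r => (r^-1 ^+ 2 + q r ^+ 2) * y r - q r)).
    by exists a0 => r ra; rewrite qE.
  apply: symb_sub => //; apply: symb_mul; last exact: yS'.
  by apply: symb_add => //; exact: symb_exp.
have yS m : symb m y by exact: yS'.
have qVS m : symb m (fun r => (q r)^-1).
  have pO := @open_gt R 0.
  apply: (@symb_comp R m [set x : R | 0 < x] (fun x : R => x^-1) q gam bet pO) => //.
  - by apply: smooth_inv => // x; exact: lt0r_neq0.
  - by move=> x /= /andP[? _]; lra.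
(* Measures the rate of q y -> 1. It solves a linear equation of the same type, d' = r (B - p2 d)
   with B bounded, and is therefore bounded. *)
pose d r := r ^+ 2 * (q r * y r - 1).
have dS : symb 0 d.
  pose B r := y r * ((r^-1 ^+ 2 + q r ^+ 2) * y r - q r) + q r * (2 + F1 (q r)) * y r.
  pose p2 r := - (q r ^+ 2 * F1 (q r)) - 2 * r^-1 ^+ 2.
  have BS : symb 0 B.
    apply: symb_add; first apply: symb_mul => //.
      apply: symb_sub => //; apply: symb_mul => //.
      by apply: symb_add => //; exact: symb_exp.
    apply: symb_mul => //; apply: symb_mul => //.
    by apply: symb_add; [exact: symb_const|exact: F1S].
  have p2S : symb 0 p2.
    apply: symb_sub; last exact: symb_mull.
    by apply: symb_opp; apply: symb_mul; [exact: symb_exp|exact: F1S].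
  have p20 : exists A, forall r, A < r -> gam ^+ 2 * lam / 2 <= p2 r.
    pose E := 2 / (gam ^+ 2 * lam / 2).
    exists (Num.max a0 E) => r; rewrite gt_max => /andP[ra rE].
    have [r1 rp rr] := Ha r ra; have /andP[q1 q2] := qI r rr.
    have F1q : F1 (q r) <= - lam by apply: Flam; exact: qI.
    have h1 : gam ^+ 2 * lam <= q r ^+ 2 * - F1 (q r).
      by apply: ler_pM (exprn_ge0 2 (ltW gam0)) (ltW lam0) (h0 _ _ gam0 q1) _; rewrite lerNr.
    have h2 : 2 * r^-1 ^+ 2 <= gam ^+ 2 * lam / 2.
      rewrite exprVn ler_pdivrMr ?exprn_gt0 //; rewrite ltr_pdivrMr // in rE.
      apply: le_trans (ltW rE) _; by rewrite mulrC ler_pM2l // expr2 ler_peMl // ltW.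
    by rewrite mulrN in h1; rewrite /p2; lra.
  apply: (lin_symb gl _ p20 p2S BS).
  have [A qA] := qD; have [A' yA] := yD.
  exists (Num.max a0 (Num.max A A')) => r; rewrite gt_max => /andP[ra]; rewrite gt_max => /andP[rA rA'].
  have [r1 rp rr] := Ha r ra.
  have D1 := is_derive_sub (is_derive_mul (qA r rA) (yA r rA')) (is_derive_const 1 r 1).
  have := is_derive_mul (is_derive_exp 2 (is_derive_ident r)) D1.
  move=> /is_derive_eq; apply.
  have -> : ((1 + V r ^+ 2) * F (q r) - q r) / r =
      ((r^-1 ^+ 2 + q r ^+ 2) * y r - q r) / r.
    by rewrite -(qE r ra); field; exact: lt0r_neq0.
  by rewrite /B /p2 /p /g /d /=; field; exact: lt0r_neq0.
(* F' <= - lam makes F expand distances to its zero; with F(q) = y / r^2 this yields q - alp =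
   O(r^-2). *)
have qa r : a0 < r -> lam * `|q r - alp| <= `|F (q r)|.
  move=> ra; have [r1 rp rr] := Ha r ra; have qr := qI r rr.
  have key (x z : R) : gam <= x -> x <= z -> z <= bet -> lam * (z - x) <= F x - F z.
    move=> gx xz zb.
    have LD (t : R) : is_derive t 1 (fun t => lam * t) lam.
      by have := is_derive_mull lam (is_derive_ident t); rewrite mulr1.
    have := @derive_le R (fun t => lam * t) (fun=> lam) (fun t => - F t) (fun t => - F1 t)
      x z xz (fun t _ => LD t).
    move=> H; suff : lam * z - lam * x <= - F z - - F x by move=> ?; lra.
    apply: H => t /andP[xt tz].
      by apply: is_derive_opp; apply: FD; rewrite (le_trans gx xt) (le_trans tz zb).
    rewrite lerNr; apply: Flam; by rewrite (le_trans gx xt) (le_trans tz zb).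
  case/andP: alpI => a1 a2; case/andP: qr => q1 q2.
  have [h|/ltW h] := leP (q r) alp.
    rewrite distrC ger0_norm ?subr_ge0 //; apply: le_trans (key _ _ q1 h a2) _.
    by rewrite Falp subr0 ler_norm.
  rewrite ger0_norm ?subr_ge0 //; apply: le_trans (key _ _ a1 h q2) _.
  by rewrite Falp sub0r -normrN ler_norm.
have qaS : symb 0 (fun r => r ^+ 2 * (q r - alp)).
  have [A [C HC]] := symb_bounded (yS 0%N).
  split=> //; exists (Num.max a0 A), (C / lam) => r; rewrite gt_max => /andP[ra rA].
  have [r1 rp rr] := Ha r ra; rewrite ler_pdivlMr // normrM -mulrA.
  apply: le_trans (HC r rA); rewrite /y [leRHS]normrM ler_wpM2l // mulrC; exact: qa.
(* The second order Taylor remainder of F at alp, of size (q - alp)^2 = O(r^-4). *)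
pose T r := F (q r) - F1 alp * (q r - alp).
have TS : symb 0 (fun r => r ^+ 4 * T r).
  have [K K0 HK] := smooth_lipschitz Oo F1C OI.
  have [A [C HC]] := symb_bounded qaS.
  have TK r : a0 < r -> `|T r| <= K * (q r - alp) ^+ 2.
    move=> ra; have [r1 rp rr] := Ha r ra; have qr := qI r rr.
    have key (x z : R) : gam <= x -> x <= z -> z <= bet -> x = alp \/ z = alp ->
        `|F z - F1 alp * z - (F x - F1 alp * x)| <= K * (z - x) ^+ 2.
      move=> gx xz zb xza.
      have FD' (t : R) : x <= t <= z ->
          is_derive t 1 (fun t => F t - F1 alp * t) (F1 t - F1 alp).
        move=> /andP[xt tz].
        have tI : gam <= t <= bet by rewrite (le_trans gx xt) (le_trans tz zb).
        by have := is_derive_sub (FD t tI) (is_derive_mull (F1 alp) (is_derive_ident t)); rewrite mulr1.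
      have LD (t : R) : is_derive t 1 (fun t => K * (z - x) * t) (K * (z - x)).
        by have := is_derive_mull (K * (z - x)) (is_derive_ident t); rewrite mulr1.
      have := derive_norm_le xz FD' (fun t _ => LD t).
      have -> : K * (z - x) * z - K * (z - x) * x = K * (z - x) ^+ 2 by ring.
      apply=> t /andP[xt tz].
      have tI : gam <= t <= bet by rewrite (le_trans gx xt) (le_trans tz zb).
      apply: le_trans (HK _ _ tI alpI) _; rewrite ler_wpM2l // ler_norml.
      by clear - xt tz xza; case: xza => <-; apply/andP; split; lra.
    case/andP: alpI => a1 a2; case/andP: qr => q1 q2.
    have [h|/ltW h] := leP (q r) alp.
      have := key _ _ q1 h a2 (or_intror erefl); rewrite Falp -normrN.
      have -> : (alp - q r) ^+ 2 = (q r - alp) ^+ 2 by ring.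
      by apply: le_trans; rewrite /T le_eqVlt; apply/orP; left; apply/eqP; congr `|_|; ring.
    have := key _ _ a1 h q2 (or_introl erefl); rewrite Falp.
    by apply: le_trans; rewrite /T le_eqVlt; apply/orP; left; apply/eqP; congr `|_|; ring.
  split=> //; exists (Num.max a0 A), (K * C ^+ 2) => r; rewrite gt_max => /andP[ra rA].
  rewrite normrM (ger0_norm (exprn_even_ge0 _ _)) //.
  apply: (@le_trans _ _ (r ^+ 4 * (K * (q r - alp) ^+ 2))).
    by rewrite ler_wpM2l ?exprn_even_ge0 // TK.
  have -> : r ^+ 4 * (K * (q r - alp) ^+ 2) = K * (r ^+ 2 * (q r - alp)) ^+ 2 by ring.
  have C0 : 0 <= C by apply: le_trans (HC r rA).
  by rewrite ler_wpM2l // -(real_normK (num_real _)) lerXn2r ?nnegrE // HC.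
have yaS : symb 0 (fun r => r ^+ 2 * (y r - alp^-1)).
  apply: (symb_ext (f := fun r => d r * (q r)^-1 -
      r ^+ 2 * (q r - alp) * ((q r)^-1 * alp^-1))).
    exists a0 => r ra; have qp := q0 r ra; rewrite /d; field.
    by rewrite !lt0r_neq0.
  apply: symb_sub; first exact: symb_mul.
  by apply: symb_mul => //; apply: symb_mul => //; exact: symb_const.
(* From F'(alp) (q - alp) = y / r^2 - T and y = 1 / alp + O(r^-2) one gets V = r q = alp r + D / r +
   O(r^-3): D is the coefficient of the logarithm. *)
pose D := (alp * F1 alp)^-1.
pose h' r := V r - alp * r - D / r.
have h'S : symb 0 (fun r => r ^+ 2 * h' r).
  apply: (symb_ext (f := fun r => (F1 alp)^-1 * (r^-1 *
      (r ^+ 2 * (y r - alp^-1) - r ^+ 4 * T r)))).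
    exists a0 => r ra; have [r1 rp rr] := Ha r ra.
    rewrite /h' /D /T /y (VE r ra); field.
    by rewrite F1a0 !lt0r_neq0.
  by apply: symb_mull; apply: symb_mul; [exact: symb_inv|exact: symb_sub].
(* The derivative of h'. Its boundedness after multiplication by r uses the cancellation of alp; the
   higher derivatives are controlled by its being a symbol. *)
pose k r := (1 + V r ^+ 2) * F (q r) - alp + D / r ^+ 2.
have kS m : symb m k.
  apply: (symb_ext (f := fun r => (r^-1 ^+ 2 + q r ^+ 2) * y r - alp + D * r^-1 ^+ 2)).
    exists a0 => r ra; have [r1 rp rr] := Ha r ra.
    by rewrite /k /y (VE r ra); field; exact: lt0r_neq0.
  apply: symb_add; last exact: symb_mull.
  apply: symb_sub; last exact: symb_const.
  by apply: symb_mul => //; apply: symb_add => //; exact: symb_exp.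
have kb : ubounded (fun r => r * k r).
  apply: (@symb_bounded _ 0); apply: (symb_ext (f := fun r => r^-1 * (y r +
     (q r ^+ 2 * (r ^+ 2 * (y r - alp^-1)) + alp^-1 * ((q r + alp) * (r ^+ 2 * (q r - alp))))
      + D))).
    exists a0 => r ra; have [r1 rp rr] := Ha r ra.
    by rewrite /k /y (VE r ra); field; rewrite !lt0r_neq0.
  apply: symb_mul; first exact: symb_inv.
  apply: symb_add; last exact: symb_const.
  apply: symb_add => //; apply: symb_add.
    by apply: symb_mul => //; exact: symb_exp.
  apply: symb_mull; apply: symb_mul => //.
  by apply: symb_add => //; exact: symb_const.
have h'D : uderive h' k.
  have [A VA] := VD; exists (Num.max a0 A) => r; rewrite gt_max => /andP[ra rA].
  have [r1 rp rr] := Ha r ra.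
  have D1 := is_derive_mull D (is_derive_inv (lt0r_neq0 rp) (is_derive_ident r)).
  have := is_derive_sub (is_derive_sub (VA r rA) (is_derive_mull alp (is_derive_ident r))) D1.
  by move=> /is_derive_eq; apply; rewrite /k; field; exact: lt0r_neq0.
have kdecl m : decl m k.
  have [_ [k' kD kS']] := kS m.+1.
  by case: m kS' => [|m] kS'; [split|exact: decl_of_symb kD kb (symbW kS')].
pose w r := u r - (alp / 2 * r ^+ 2 + D * ln r).
have wD : uderive w h'.
  have [A uA] := uV; exists (Num.max a0 A) => r; rewrite gt_max => /andP[ra rA].
  have [r1 rp rr] := Ha r ra.
  have D1 := is_derive_mull D (is_derive1_ln rp).
  have D2 := is_derive_mull (alp / 2) (is_derive_exp 2 (is_derive_ident r)).
  have := is_derive_sub (uA r rA) (is_derive_add D2 D1).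
  by move=> /is_derive_eq; apply; rewrite /h' /=; field; exact: lt0r_neq0.
have [C HC] := limit_of_derivative wD (symb_bounded h'S).
exists C => m.
apply: (decl_ext (f := fun r => w r - C)).
  by exists 0 => r _; rewrite /w /D; ring.
have wCD : uderive (fun r => w r - C) h'.
  have [A wA] := wD; exists A => r /wA D1.
  by have := is_derive_sub D1 (is_derive_const C r 1); rewrite subr0.
case: m => [|m]; first by split.
apply: (declS wCD HC).
have h'b : ubounded (fun r => r * h' r).
  have S1 := symb_mul (symb_inv _ 0) h'S.
  apply: ubounded_ext (symb_bounded S1); exists 0 => r r0'; field; exact: lt0r_neq0.
case: m => [|m]; first by split.
exact: (declS h'D h'b).
Qed.

End Asymptotics.

(** * Euclidean norm and radial functions at infinity *)

Section EuclideanCalculus.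
Variables (R : realType) (n : nat).
Implicit Types (x v w : 'rV[R]_n) (i : 'I_n).
Local Notation rV := 'rV[R]_n.
Local Notation ends := (at_infty R n).

Lemma dotC x v : dot x v = dot v x.
Proof. by apply: eq_bigr => i _; rewrite mulrC. Qed.

Lemma dotDr x v w : dot x (v + w) = dot x v + dot x w.
Proof. by rewrite -big_split; apply: eq_bigr => i _; rewrite mxE mulrDr. Qed.

Lemma dotZr x v (a : R) : dot x (a *: v) = a * dot x v.
Proof. by rewrite mulr_sumr; apply: eq_bigr => i _; rewrite mxE mulrCA. Qed.

Lemma dotZl x v (a : R) : dot (a *: x) v = a * dot x v.
Proof. by rewrite dotC dotZr dotC. Qed.

Lemma dot0r x : dot x 0 = 0.
Proof. by rewrite /dot big1 // => i _; rewrite mxE mulr0. Qed.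

Lemma dot_ge0 x : 0 <= dot x x.
Proof. by apply: sumr_ge0 => i _; rewrite -expr2 sqr_ge0. Qed.

Lemma enorm_ge0 x : 0 <= enorm x.
Proof. exact: sqrtr_ge0. Qed.

Lemma sqr_enorm x : enorm x ^+ 2 = dot x x.
Proof. by rewrite sqr_sqrtr ?dot_ge0. Qed.

Lemma enorm_eq (r : R) x : 0 <= r -> dot x x = r ^+ 2 -> enorm x = r.
Proof. by move=> r0; rewrite /enorm => ->; rewrite sqrtr_sqr ger0_norm. Qed.

Lemma enormZ (a : R) x : enorm (a *: x) = `|a| * enorm x.
Proof.
apply: enorm_eq; first by rewrite mulr_ge0 ?enorm_ge0.
by rewrite dotZl dotZr exprMn sqr_enorm real_normK ?num_real // mulrA.
Qed.

Lemma coord_le_enorm x i : `|x 0 i| <= enorm x.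
Proof.
rewrite -sqrtr_sqr ler_wsqrtr // /dot (bigD1 i) //= -expr2 lerDl.
by apply: sumr_ge0 => j _; rewrite -expr2 sqr_ge0.
Qed.

Lemma mxnorm_le_enorm x : `|x| <= enorm x.
Proof.
rewrite /Num.norm /= mx_normrE; apply/bigmax_leP; split; first exact: enorm_ge0.
by move=> [i j] _ /=; rewrite ord1; exact: coord_le_enorm.
Qed.

Lemma is_derive_coord x v i : is_derive x v (fun y : rV => y 0 i) (v 0 i).
Proof.
apply/is_derive_line.
have -> : (fun t : R => (t *: v + x) 0 i) = (fun t => t * v 0 i + x 0 i).
  by apply/funext => t; rewrite !mxE.
have := is_derive_add (is_derive_mul (is_derive_ident 0) (is_derive_const (v 0 i) (0 : R) 1))
    (is_derive_const (x 0 i) (0 : R) 1).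
by move=> /is_derive_eq; apply; ring.
Qed.

Lemma is_derive_sum (V : normedModType R) (I : Type) (s : seq I) (f : I -> V -> R)
    (x v : V) (d : I -> R) :
  (forall j : I, is_derive x v (f j) (d j)) ->
  is_derive x v (fun y => \sum_(j <- s) f j y) (\sum_(j <- s) d j).
Proof.
move=> fd; elim: s => [|j s IH].
  rewrite big_nil; have := is_derive_const (0 : R) x v.
  apply: is_derive_near; apply: nearW => y; by rewrite big_nil.
rewrite big_cons; have := is_derive_add (fd j) IH.
by apply: is_derive_near; apply: nearW => y; rewrite big_cons.
Qed.

Lemma is_derive_sqnorm x v : is_derive x v (fun y : rV => dot y y) (2 * dot x v).
Proof.
have H i : is_derive x v (fun y : rV => y 0 i * y 0 i) (2 * (x 0 i * v 0 i)).
  have := is_derive_mul (is_derive_coord x v i) (is_derive_coord x v i).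
  by move=> /is_derive_eq; apply; ring.
have := @is_derive_sum _ _ (index_enum 'I_n) _ _ _ _ H.
by move=> /is_derive_eq; apply; rewrite /dot mulr_sumr.
Qed.

Lemma is_derive_enorm x v : 0 < enorm x ->
  is_derive x v (@enorm R n) (dot x v / enorm x).
Proof.
move=> x0; have d0 : 0 < dot x x by rewrite -sqr_enorm exprn_gt0.
have := is_derive_comp (G := Num.sqrt) (f := fun y : rV => dot y y)
  (is_derive1_sqrt d0) (is_derive_sqnorm x v).
move=> /is_derive_eq; apply; rewrite -/(enorm x); field; exact: lt0r_neq0.
Qed.

Lemma Cdiff_coord m (U : set rV) i : Cdiff m U (fun y : rV => y 0 i).
Proof.
apply: Cdiff_linear => [x|x v]; first exact: coord_continuous.
exact: is_derive_coord.
Qed.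

Lemma Cdiff_sqnorm m (U : set rV) : open U -> Cdiff m U (fun y : rV => dot y y).
Proof. by move=> Uo; apply: Cdiff_sum => // i; apply: Cdiff_mul => //; exact: Cdiff_coord. Qed.

Lemma enorm_continuous : continuous (@enorm R n).
Proof.
move=> x; apply: (@continuous_comp _ _ _ (fun y : rV => dot y y) (@Num.sqrt R)).
  exact: Cdiff_continuous (Cdiff_sqnorm 0 openT) _ I.
exact: sqrt_continuous.
Qed.

Lemma open_enorm (O : set R) : open O -> open [set x : rV | O (enorm x)].
Proof. by move=> Oo; apply: open_comp => // x _; exact: enorm_continuous. Qed.

Lemma Cdiff_enorm m (U : set rV) : open U -> (forall x, U x -> 0 < enorm x) ->
  Cdiff m U (@enorm R n).
Proof.
move=> Uo U0; have Op := @open_gt R 0.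
apply: (@Cdiff_comp _ _ m U [set r : R | 0 < r] (@Num.sqrt R)
  (fun y : rV => dot y y) Uo Op).
- by move=> x /U0 x0 /=; rewrite -sqr_enorm exprn_gt0.
- exact: smooth_sqrt.
- exact: Cdiff_sqnorm.
Qed.

Lemma near_far (A : R) x : A < enorm x -> \forall y \near x, A < enorm y.
Proof. by move=> Ax; exact: (enorm_continuous (lt_nbhsr Ax)). Qed.

Implicit Types (f g h wt : rV -> R).

Definition far_le wt f := exists A C : R, forall x, A < enorm x -> `|f x| <= C * wt x.

(** All derivatives carry the same weight. The functions of weight 1 form an algebra that acts on
    those of weight [wt]. *)
Fixpoint bigO_smooth (m : nat) wt f : Prop :=
  far_le wt f /\
  (if m is m'.+1 then forall v, exists2 f' : rV -> R,
     exists A : R, forall x, A < enorm x -> is_derive x v f (f' x) &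
     bigO_smooth m' wt f' else True).

Definition far_eq f g := exists A : R, forall x, A < enorm x -> f x = g x.

Lemma bigO_smooth_ext m wt f g : far_eq f g -> bigO_smooth m wt f -> bigO_smooth m wt g.
Proof.
move=> [A fg]; case: m => [|m] [[B [C fb]] fd]; split=> //.
1, 2: exists (Num.max A B), C => x; rewrite gt_max => /andP[xA xB]; rewrite -fg //; exact: fb.
move=> v; have [f' [E fD] S] := fd v; exists f' => //.
exists (Num.max A E) => x; rewrite gt_max => /andP[xA xE].
apply: is_derive_near (fD x xE).
by apply: filterS (near_far xA) => y; exact: fg.
Qed.

Lemma bigO_smoothW m wt f : bigO_smooth m.+1 wt f -> bigO_smooth m wt f.
Proof.
elim: m f => [|m IH] f [fb fd]; split=> // v.
by have [f' D S] := fd v; exists f' => //; exact: IH.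
Qed.

Lemma bigO_smooth_le m wt f : bigO_smooth m wt f -> far_le wt f.
Proof. by case: m => [|m] []. Qed.

Lemma bigO_smooth_const m (c : R) : bigO_smooth m (fun=> 1) (fun=> c).
Proof.
elim: m c => [|m IH] c; split=> //; try by exists 0, `|c| => x _; rewrite mulr1.
move=> v; exists (fun=> 0) => //; exists 0 => x _; exact: is_derive_const.
Qed.

Lemma bigO_smooth_add m wt f g : bigO_smooth m wt f -> bigO_smooth m wt g ->
  bigO_smooth m wt (fun x => f x + g x).
Proof.
have le f1 g1 : far_le wt f1 -> far_le wt g1 -> far_le wt (fun x => f1 x + g1 x).
  move=> [A [C H]] [B [D K]]; exists (Num.max A B), (C + D) => x.
  rewrite gt_max => /andP[xA xB]; apply: le_trans (ler_normD _ _) _.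
  by rewrite mulrDl lerD ?H ?K.
elim: m f g => [|m IH] f g [fb fd] [gb gd]; split=> //; try exact: le.
move=> v; have [f' [A fD] fS] := fd v; have [g' [B gD] gS] := gd v.
exists (fun x => f' x + g' x); last exact: IH.
exists (Num.max A B) => x; rewrite gt_max => /andP[xA xB].
by apply: is_derive_add; [exact: fD|exact: gD].
Qed.

Lemma bigO_smooth_mul m wt f g : bigO_smooth m (fun=> 1) f -> bigO_smooth m wt g ->
  bigO_smooth m wt (fun x => f x * g x).
Proof.
have le f1 g1 : far_le (fun=> 1) f1 -> far_le wt g1 -> far_le wt (fun x => f1 x * g1 x).
  move=> [A [C H]] [B [D K]]; exists (Num.max A B), (C * D) => x.
  rewrite gt_max => /andP[xA xB]; rewrite normrM -mulrA ler_pM ?K //.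
  by have := H x xA; rewrite mulr1.
elim: m f g => [|m IH] f g.
  by move=> [fb _] [gb _]; split=> //; exact: le.
move=> fS gS; have fS' := bigO_smoothW fS; have gS' := bigO_smoothW gS.
have [fb fd] := fS; have [gb gd] := gS; split; first exact: le.
move=> v; have [f' [A fD] fS1] := fd v; have [g' [B gD] gS1] := gd v.
exists (fun x => f' x * g x + f x * g' x); last by apply: bigO_smooth_add; exact: IH.
exists (Num.max A B) => x; rewrite gt_max => /andP[xA xB].
by apply: is_derive_mul; [exact: fD|exact: gD].
Qed.

Lemma bigO_smooth_sum m (I : Type) (s : seq I) (F : I -> rV -> R) :
  (forall j : I, bigO_smooth m (fun=> 1) (F j)) ->
  bigO_smooth m (fun=> 1) (fun x => \sum_(j <- s) F j x).
Proof.
move=> FC; elim: s => [|j s IH].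
  apply: bigO_smooth_ext (bigO_smooth_const m 0); exists 0 => x _; by rewrite big_nil.
apply: bigO_smooth_ext (bigO_smooth_add (FC j) IH); exists 0 => x _; by rewrite big_cons.
Qed.

Lemma dot_over_enorm x v : dot x v / enorm x = \sum_i v 0 i * (x 0 i / enorm x).
Proof. by rewrite mulr_suml; apply: eq_bigr => i _; rewrite mulrAC mulrC. Qed.

(** The two families are treated together because the directional derivatives of 1 / |x| and x_i /
    |x| are polynomials in 1 / |x| and the x_j / |x|. *)
Lemma bigO_smooth_direction m :
  bigO_smooth m (fun=> 1) (fun x => (enorm x)^-1) /\
  forall i, bigO_smooth m (fun=> 1) (fun x => x 0 i / enorm x).
Proof.
elim: m => [|m [IH1 IH2]].
  split=> [|i]; split=> //; exists 1, 1 => x x1; have x0 : 0 < enorm x by lra.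
  - by rewrite mulr1 normfV ger0_norm ?enorm_ge0 // invf_le1 // ltW.
  - by rewrite mulr1 normrM normfV (gtr0_norm x0) ler_pdivrMr // mul1r coord_le_enorm.
have dirS v : bigO_smooth m (fun=> 1) (fun x => dot x v / enorm x).
  apply: (bigO_smooth_ext (f := fun x => \sum_i v 0 i * (x 0 i / enorm x))).
    by exists 0 => x _; rewrite dot_over_enorm.
  apply: bigO_smooth_sum => i; apply: bigO_smooth_mul => //; exact: bigO_smooth_const.
have invD v x : 0 < enorm x ->
    is_derive x v (fun x => (enorm x)^-1) (-1 * ((enorm x)^-1 * ((enorm x)^-1 * (dot x v / enorm x)))).
  move=> x0; have := is_derive_inv (lt0r_neq0 x0) (is_derive_enorm v x0).
  by move=> /is_derive_eq; apply; field; exact: lt0r_neq0.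
have invS v : bigO_smooth m (fun=> 1)
    (fun x => -1 * ((enorm x)^-1 * ((enorm x)^-1 * (dot x v / enorm x)))).
  apply: bigO_smooth_mul; first exact: bigO_smooth_const.
  by apply: bigO_smooth_mul => //; apply: bigO_smooth_mul.
split=> [|i]; split; try exact: bigO_smooth_le IH1; try exact: bigO_smooth_le (IH2 i).
  move=> v; eexists; last exact: invS v.
  by exists 0 => x; exact: invD.
move=> v; exists (fun x => v 0 i * (enorm x)^-1 +
    (-1) * ((x 0 i / enorm x) * ((enorm x)^-1 * (dot x v / enorm x)))).
  exists 0 => x x0; have := is_derive_mul (is_derive_coord x v i) (invD v x x0).
  by move=> /is_derive_eq; apply; field; exact: lt0r_neq0.
apply: bigO_smooth_add; apply: bigO_smooth_mul; try exact: bigO_smooth_const; try exact: IH1.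
by apply: bigO_smooth_mul => //; apply: bigO_smooth_mul.
Qed.

Lemma bigO_smooth_radial m (h : R -> R) : decl m h ->
  bigO_smooth m (fun x => (enorm x)^-1) (fun x => h (enorm x)).
Proof.
elim: m h => [|m IH] h [[A [C hC]] hd]; split=> //;
  try by exists (Num.max 0 A), C => x; rewrite gt_max => /andP[x0 xA];
    rewrite ler_pdivlMr // mulrC -{1}(gtr0_norm x0) -normrM hC.
move=> v; have [h' [B hD] hS] := hd.
exists (fun x => (dot x v / enorm x) * h' (enorm x)).
  exists (Num.max 0 B) => x; rewrite gt_max => /andP[x0 xB].
  have := is_derive_comp (hD _ xB) (is_derive_enorm v x0).
  by move=> /is_derive_eq; apply; rewrite mulrC.
apply: bigO_smooth_mul; last exact: IH.
apply: (bigO_smooth_ext (f := fun x => \sum_i v 0 i * (x 0 i / enorm x))).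
  by exists 0 => x _; rewrite dot_over_enorm.
apply: bigO_smooth_sum => i; apply: bigO_smooth_mul; first exact: bigO_smooth_const.
by have [_] := bigO_smooth_direction m; apply.
Qed.

Lemma far_le_iter_deriv wt f (vs : seq rV) : bigO_smooth (size vs) wt f ->
  far_le wt (iter_deriv vs f).
Proof.
(* [iter_deriv] is a right fold, so the last direction of the list is differentiated first. *)
elim/last_ind: vs f => [|vs v IH] f; first by case.
rewrite size_rcons /iter_deriv foldr_rcons => -[_ /(_ v) [f' [A fD] fS]].
apply: IH; apply: bigO_smooth_ext fS.
by exists A => x /fD [_ ->].
Qed.

Lemma far_le_eqO f : far_le (fun x => (enorm x)^-1) f ->
  f =O_ends (fun x => (enorm x)^-1).
Proof.
move=> [A [C fC]]; apply/eqO_exP; exists (`|C| + 1); first by rewrite ltr_pwDr.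
exists (A + 1) => // x /= xA; apply: le_trans (fC x _) _; first by lra.
rewrite normfV (ger0_norm (enorm_ge0 x)) ler_wpM2r ?invr_ge0 ?enorm_ge0 //.
by apply: le_trans (ler_norm C) _; rewrite lerDl.
Qed.

Lemma asymptotic_radial (u g : rV -> R) (h : R -> R) : decl 0 h ->
  far_eq (fun x => h (enorm x)) (fun x => u x - g x) -> asymptotic_to u g.
Proof.
move=> hd ug; apply: far_le_eqO.
exact: bigO_smooth_le (bigO_smooth_ext ug (bigO_smooth_radial hd)).
Qed.

Lemma smoothly_asymptotic_radial (u g : rV -> R) (h : R -> R) :
  (forall m, decl m h) -> far_eq (fun x => h (enorm x)) (fun x => u x - g x) ->
  smoothly_asymptotic_to u g.
Proof.
move=> hd ug vs; apply: far_le_eqO; apply: far_le_iter_deriv.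
exact: bigO_smooth_ext ug (bigO_smooth_radial (hd _)).
Qed.

End EuclideanCalculus.

(** * Principal curvatures of hypersurfaces of revolution *)

Section RadialCharts.
Variables (R : realType) (n : nat).
Local Notation rV := 'rV[R]_n.
Local Notation V := (espace R n).
Implicit Types (p q v w : V) (x e : rV).

Lemma is_derive_fst (f : rV -> R) p v (d : R) : is_derive p.1 v.1 f d ->
  is_derive p v (fun q : V => f q.1) d.
Proof. by move=> /is_derive_line fd; apply/is_derive_line. Qed.

Lemma fst_continuous : continuous (fun p : V => p.1).
Proof. by move=> p; exact: cvg_fst. Qed.

Lemma snd_continuous : continuous (fun p : V => p.2).
Proof. by move=> p; exact: cvg_snd. Qed.

Lemma Cdiff_fst m (U : set rV) (f : rV -> R) : open U -> Cdiff m U f ->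
  Cdiff m [set p : V | U p.1] (fun p : V => f p.1).
Proof.
move=> Uo; have Vo : open [set p : V | U p.1].
  by apply: open_comp => // p _; exact: fst_continuous.
elim: m f => [|m IH] f fC.
  split=> // p Up; apply: (@continuous_comp _ _ _ (fun p : V => p.1) f).
    exact: fst_continuous.
  exact: Cdiff_continuous fC _ Up.
apply: CdiffS => // [p Up|v].
  apply: (@continuous_comp _ _ _ (fun p : V => p.1) f); first exact: fst_continuous.
  exact: Cdiff_continuous fC _ Up.
have [fd fC'] := Cdiff_derive v.1 fC.
exists (fun p : V => 'D_v.1 f p.1); last exact: (IH (fun x => 'D_v.1 f x)).
by move=> p Up; apply: is_derive_fst; exact: (fd p.1 Up).
Qed.

Lemma is_derive_snd p v : is_derive p v (fun q : V => q.2 : R) v.2.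
Proof.
apply/is_derive_line => /=.
have := is_derive_add (is_derive_mul (is_derive_ident 0) (is_derive_const v.2 (0 : R) 1))
    (is_derive_const p.2 (0 : R) 1).
by move=> /is_derive_eq; apply; ring.
Qed.

Lemma Cdiff_snd m (U : set V) : Cdiff m U (fun p : V => p.2 : R).
Proof.
by apply: Cdiff_linear; [exact: snd_continuous|exact: is_derive_snd].
Qed.

(* The images of the canonical basis under the reflection that exchanges its first
   vector with e; if these two are equal then 0^-1 = 0 makes it the identity. *)
Lemma orthonormal_completion (i0 : 'I_n) e : dot e e = 1 ->
  exists E : 'I_n -> rV, E i0 = e /\
    forall i j, dot (E i) (E j) = (i == j)%:R.
Proof.
move=> e1; pose dl i : rV := delta_mx 0 i.
have dlr x i : dot (dl i) x = x 0 i.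
  rewrite /dot (bigD1 i) //= mxE !eqxx mul1r big1 ?addr0 // => j ji.
  by rewrite mxE (negbTE ji) andbF mul0r.
have dld i j : dot (dl i) (dl j) = (i == j)%:R.
  by rewrite dlr mxE eqxx eq_sym.
have [w wE] : exists w : rV, w = dl i0 - e by eexists.
pose E i := dl i - (2 * w 0 i / dot w w) *: w.
have dlN x y (z : rV) : dot z (x - y) = dot z x - dot z y.
  by rewrite dotDr -scaleN1r dotZr mulN1r.
have ww : dot w w = 2 * w 0 i0.
  rewrite {2}wE dlN (dotC _ (dl i0)) dlr (dotC w e) {2}wE dlN e1 (dotC e (dl i0)) dlr.
  by rewrite wE !mxE !eqxx /=; ring.
have [w0|w0] := eqVneq (dot w w) 0.
  exists dl; split=> //; apply/eqP; rewrite -subr_eq0 -wE; apply/eqP/rowP => i.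
  rewrite [RHS]mxE; apply/eqP; rewrite -normr_le0.
  by apply: le_trans (coord_le_enorm w i) _; rewrite /enorm w0 sqrtr0.
exists E; split.
  rewrite /E -ww divff // scale1r wE opprB addrC subrK //.
move=> i j; rewrite {2}/E dlN dotZr (dotC (E i)) (dotC (E i)) /E !dlN !dotZr dld.
rewrite (dotC w (dl i)) !dlr eq_sym. field; exact: w0.
Qed.

(** The curvatures of a hypersurface of revolution: [kap] along the profile curve, in the first slot
    as in [e_first], and [mu] in the n - 1 directions of rotation. *)
Definition curvature_vec (kap mu : R) : rV :=
  \row_(i < n) (if (i : nat) == 0%N then kap else mu).

Lemma near_fst_snd p (P Q : R -> Prop) :
  (\forall r \near enorm p.1, P r) -> (\forall z \near p.2, Q z) ->
  \forall q \near p, P (enorm (q : V).1) /\ Q q.2.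
Proof.
move=> nP nQ.
have c1 : {for p, continuous (fun q : V => enorm q.1)}.
  apply: (@continuous_comp _ _ _ (fun p : V => p.1) (@enorm R n)).
    exact: fst_continuous.
  exact: enorm_continuous.
have H1 := c1 _ nP; have H2 := snd_continuous nQ.
by apply: filterI.
Qed.

(* The local equation A(|x|) = B(x_(n+1)). *)
Lemma Cdiff_radial m (A B : R -> R) (OA OB : set R) (U : set V) :
  open OA -> open OB -> open U -> Cdiff m OA A -> Cdiff m OB B ->
  (forall q, U q -> [/\ 0 < enorm q.1, OA (enorm q.1) & OB q.2]) ->
  Cdiff m U (fun q => A (enorm q.1) - B q.2).
Proof.
move=> OAo OBo Uo AC BC HU; apply: Cdiff_sub => //.
- apply: (Cdiff_comp Uo OAo _ AC); first by move=> q /HU[].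
  pose U0 := [set x : rV | 0 < enorm x].
  have U0o : open U0 := open_enorm (@open_gt R 0).
  apply: (@Cdiff_subset _ _ _ [set p : V | U0 p.1]); first by move=> q /HU[].
  by apply: Cdiff_fst => //; exact: Cdiff_enorm.
- apply: (Cdiff_comp Uo OBo _ BC); first by move=> q /HU[].
  exact: Cdiff_snd.
Qed.

(** The gradient of A(|x|) - B(z) is (a x / |x|, - b), of length c, and the Hessian is diagonal in
    the profile direction and the directions of rotation. Two profile functions serve both charts: A
    = u, B = id along a graph, and A = id, B = g across the neck, where no graph over R^n is
    available. *)
Lemma radial_principal_curvatures (W : set V) p (A B A1 B1 : R -> R) (A2 B2 : R)
    (OA OB : set R) (U : set V) :
  (0 < n)%N -> open OA -> open OB -> open U -> smooth_on OA A -> smooth_on OB B ->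
  (forall q, U q -> [/\ 0 < enorm q.1, OA (enorm q.1) & OB q.2]) ->
  U p -> W p -> (forall q, U q -> (W q <-> A (enorm q.1) - B q.2 = 0)) ->
  (forall r : R, OA r -> is_derive r 1 A (A1 r)) ->
  (forall z : R, OB z -> is_derive z 1 B (B1 z)) ->
  is_derive (enorm p.1) 1 A1 A2 -> is_derive (p.2 : R) 1 B1 B2 ->
  let a := A1 (enorm p.1) in let b := B1 p.2 in
  forall c : R, 0 < c -> c ^+ 2 = a ^+ 2 + b ^+ 2 ->
  principal_curvatures W p ((a / (c * enorm p.1)) *: p.1, - b / c)
    (curvature_vec ((A2 * b ^+ 2 - B2 * a ^+ 2) / c ^+ 3) (a / (c * enorm p.1))).
Proof.
move=> n0 OAo OBo Uo AC BC HU Up Wp WU AD BD A2D B2D a b c c0 cE.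
set r := enorm p.1; set nu := (_, _).
have r0 : 0 < r by have [] := HU p Up.
have rr : dot p.1 p.1 = r ^+ 2 by rewrite sqr_enorm.
have nunu : sdot nu nu = 1.
  rewrite /sdot /nu /= dotZl dotZr rr.
  have -> : 1 = (a ^+ 2 + b ^+ 2) / c ^+ 2 by rewrite -cE divff // expf_neq0 // lt0r_neq0.
  by field; rewrite !lt0r_neq0.
pose F q := A (enorm q.1) - B (q : V).2.
have FD q v : U q -> is_derive q v F
    (A1 (enorm q.1) * (dot q.1 v.1 / enorm q.1) - B1 q.2 * v.2).
  move=> Uq; have [q0 qA qB] := HU q Uq.
  apply: is_derive_sub.
    apply: (is_derive_comp (G := A) (f := fun q : V => enorm q.1)); first exact: AD.
    by apply: is_derive_fst; exact: is_derive_enorm.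
  by apply: (is_derive_comp (G := B) (f := fun q : V => q.2)); [exact: BD|exact: is_derive_snd].
have DF q v : U q -> 'D_v F q = A1 (enorm q.1) * (dot q.1 v.1 / enorm q.1) - B1 q.2 * v.2.
  by move=> /(FD q v) [].
have dotD (x y v : rV) : is_derive x y (fun z : rV => dot z v) (dot y v).
  have H i : is_derive x y (fun z : rV => z 0 i * v 0 i) (y 0 i * v 0 i).
    have := is_derive_mul (is_derive_coord x y i) (is_derive_const (v 0 i) x y).
    by move=> /is_derive_eq; apply; ring.
  exact: (@is_derive_sum _ _ _ (index_enum 'I_n) _ _ _ _ H).
have HessF v w : 'D_w (fun q => 'D_v F q) p =
    A2 * (dot p.1 w.1 / r) * (dot p.1 v.1 / r) +
    a * (dot w.1 v.1 / r - dot p.1 v.1 * dot p.1 w.1 / r ^+ 3) - B2 * w.2 * v.2.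
  have D1 := is_derive_comp (G := A1) (f := fun q : V => enorm q.1) A2D
    (is_derive_fst (is_derive_enorm w.1 r0)).
  have D2 := is_derive_mul (dotD p.1 w.1 v.1)
    (is_derive_inv (lt0r_neq0 r0) (is_derive_enorm w.1 r0)).
  have D3 := is_derive_fst (p := p) (v := w) D2.
  have D4 := is_derive_comp (G := B1) (f := fun q : V => q.2) B2D (is_derive_snd p w).
  have D5 := is_derive_sub (is_derive_mul D1 D3)
    (is_derive_mul D4 (is_derive_const v.2 p w)).
  have [_ <-] : is_derive p w (fun q => 'D_v F q)
      (A2 * (dot p.1 w.1 / r) * (dot p.1 v.1 / r) +
    a * (dot w.1 v.1 / r - dot p.1 v.1 * dot p.1 w.1 / r ^+ 3) - B2 * w.2 * v.2) => //.
  apply: (is_derive_near _ (is_derive_eq D5 _)).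
    by apply: filterS (open_nbhs_nbhs (conj Uo Up)) => q /(DF q v) ->.
  by rewrite -/r /a; field; exact: lt0r_neq0.
have [e eE0] : exists e : rV, e = r^-1 *: p.1 by eexists.
have ee : dot e e = 1 by rewrite eE0 dotZl dotZr rr; field; exact: lt0r_neq0.
have pe x : dot p.1 x = r * dot e x by rewrite eE0 dotZl mulrA divff ?mul1r // lt0r_neq0.
have [E [E0 EO]] := orthonormal_completion (Ordinal n0) ee.
(* Index 0 gets the unit tangent (b e, a) / c of the profile curve, the others horizontal vectors
   orthogonal to the radial direction e. *)
pose tau (i : 'I_n) : V := if (i : nat) == 0%N then ((b / c) *: e, a / c) else (E i, 0).
have eE i : dot e (E i) = ((i : nat) == 0%N)%:R.
  by rewrite -E0 EO eq_sym.
have nuE : nu = ((a / c) *: e, - b / c).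
  by rewrite /nu eE0 scalerA; congr (_ *: _, _); field; rewrite !lt0r_neq0.
have cE1 : a ^+ 2 / c ^+ 2 + b ^+ 2 / c ^+ 2 = 1.
  by rewrite -mulrDl -cE divff // expf_neq0 // lt0r_neq0.
split=> //; split=> //; exists F, c, tau; split.
- by exists U; split=> // m; exact: Cdiff_radial (AC m) (BC m) HU.
- split=> // v; rewrite DF // nuE /sdot /= -/r pe dotZl -/a -/b. field.
  by rewrite !lt0r_neq0.
- move=> i; rewrite nuE /sdot /tau; case: ifP => i0 /=.
    by rewrite dotZl dotZr ee; ring.
  by rewrite dotC dotZl eE i0 mul0r mulr0 addr0.
- move=> i j; rewrite /sdot /tau; case: ifP => i0; case: ifP => j0 /=.
  + rewrite dotZl dotZr ee (_ : i == j) //; last by rewrite -val_eqE /= (eqP i0) (eqP j0).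
    by rewrite -[RHS]cE1; field; exact: lt0r_neq0.
  + rewrite dotZl eE j0 !mulr0 addr0 (_ : (i == j) = false) //.
    by rewrite -val_eqE /= (eqP i0) eq_sym j0.
  + rewrite dotC dotZl eE i0 !mul0r mulr0 addr0 (_ : (i == j) = false) //.
    by rewrite -val_eqE /= (eqP j0) i0.
  + by rewrite EO mul0r addr0.
- move=> i j; rewrite HessF !pe mxE /tau; case: ifP => j0; case: ifP => i0 /=.
  + rewrite !dotZr dotZl ee (_ : i == j) ?mulr1n; last by rewrite -val_eqE /= (eqP i0) (eqP j0).
    by field; rewrite !lt0r_neq0.
  + rewrite !dotZr dotZl !eE ee i0 (_ : (i == j) = false) ?mulr0n /=.
      by field; rewrite !lt0r_neq0.
    by rewrite -val_eqE /= (eqP j0) i0.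
  + rewrite !dotZr (dotC (E j)) !eE ee j0 (_ : (i == j) = false) ?mulr0n /=.
      by field; rewrite !lt0r_neq0.
    by rewrite -val_eqE /= (eqP i0) eq_sym j0.
  + rewrite !eE i0 j0 EO eq_sym; case: (i == j); rewrite ?mulr1n ?mulr0n /=.
      by field; rewrite !lt0r_neq0.
    by field; rewrite !lt0r_neq0.
Qed.

Lemma principal_curvatures_interior (W : set V) p nu l :
  principal_curvatures W p nu l -> interior_point W p.
Proof.
move=> [Wp [nu1 [F [c [tau [FW [c0 FD] _ _ _]]]]]]; split=> //; exists F; split=> //.
by exists nu; rewrite FD nu1 mulr1 lt0r_neq0.
Qed.

End RadialCharts.

(** * Connected components and intermediate values *)

Section Connectedness.
Variables (R : realType) (V : normedModType R).
Implicit Types (A : set V) (x y : V).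

Lemma segment_component A x y :
  (forall t : R, 0 <= t <= 1 -> A (x + t *: (y - x))) -> connected_component A x y.
Proof.
move=> HA; pose f (t : R) := x + t *: (y - x).
have fc : continuous f.
  by move=> t; apply: cvgD; [exact: cvg_cst|apply: cvgZr_tmp; exact: cvg_id].
have cC : connected (f @` `[0, 1]).
  apply: connected_continuous_connected; first exact: segment_connected.
  exact: continuous_subspaceT.
have x0 : (f @` `[0, 1]) x.
  by exists 0; [rewrite /= in_itv /= lexx ler01|rewrite /f scale0r addr0].
have y1 : (f @` `[0, 1]) y.
  by exists 1; [rewrite /= in_itv /= lexx ler01|rewrite /f scale1r addrC subrK].
apply: (connected_component_max x0 _ cC) => // _ [t /= /[!in_itv] /= t01 <-].
exact: HA.
Qed.

Lemma connected_of_component A : (forall x y, A x -> A y -> connected_component A x y) ->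
  connected A.
Proof.
move=> H; have [[x Ax]|n0] := pselect (exists x, A x).
  have -> : A = connected_component A x; last exact: component_connected.
  apply/seteqP; split; first by move=> y; exact: H.
  exact: connected_component_sub.
have -> : A = set0 by apply/seteqP; split => // x Ax; case: n0; exists x.
exact: connected0.
Qed.

Lemma component_IVT A (F : V -> R) x y : (forall z, A z -> {for z, continuous F}) ->
  connected_component A x y -> A x -> F x < 0 -> 0 < F y -> exists2 z, A z & F z = 0.
Proof.
move=> Fc Axy Ax Fx Fy.
have cC := @component_connected _ A x.
have FC : {within connected_component A x, continuous F}.
  apply: continuous_in_subspaceT => z /[!inE] /connected_component_sub; exact: Fc.
have /connected_intervalP I := connected_continuous_connected cC FC.
have Ix : (F @` connected_component A x) (F x).
  by exists x => //; exact: connected_component_refl.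
have Iy : (F @` connected_component A x) (F y) by exists y.
have F0 : F x <= 0 <= F y by rewrite (ltW Fx) (ltW Fy).
have [z Cz Fz] := I _ _ Ix Iy 0 F0.
by exists z => //; exact: connected_component_sub Cz.
Qed.

End Connectedness.

(** * Connectedness of the complement of a ball *)

Section ExteriorDomain.
Variables (R : realType) (n : nat).
Local Notation rV := 'rV[R]_n.
Implicit Types (x y : rV) (rho : R) (i j : 'I_n).

Definition exterior rho : set rV := [set x | rho <= enorm x].

(* Every point of the exterior is joined radially to one of the half-spaces
   x_i >= rho and x_i <= - rho. *)
Lemma connected_exterior rho : (1 < n)%N -> 0 < rho -> connected (exterior rho).
Proof.
move=> n1 rho0; pose A := exterior rho.
pose dl i : rV := delta_mx 0 i.
have half (i : 'I_n) (s : R) x y : `|s| = 1 -> rho <= s * x 0 i -> rho <= s * y 0 i ->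
    connected_component A x y.
  move=> s1 hx hy; apply: segment_component => t /andP[t0 t1].
  rewrite /A /exterior /=; apply: le_trans (coord_le_enorm _ i).
  rewrite -[leRHS]mul1r -s1 -normrM; apply: le_trans (ler_norm _).
  rewrite !mxE.
  have -> : s * (x 0 i + t * (y 0 i - x 0 i)) = (1 - t) * (s * x 0 i) + t * (s * y 0 i).
    by ring.
  have h1 : (1 - t) * rho <= (1 - t) * (s * x 0 i) by rewrite ler_wpM2l // subr_ge0.
  have h2 : t * rho <= t * (s * y 0 i) by rewrite ler_wpM2l.
  by lra.
have axis i j (s : R) : `|s| = 1 -> i != j ->
    connected_component A ((s * rho) *: dl i) (rho *: dl j).
  move=> s1 ij; have ss : s * s = 1.
    by rewrite -expr2 -(real_normK (num_real s)) s1 expr1n.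
  apply: (@connected_component_trans _ _ ((s * rho) *: dl i + rho *: dl j)).
    by apply: (half i s _ _ s1); rewrite !mxE !eqxx /= ?(negbTE ij) ?mulr0 ?addr0 ?mulr1 mulrA ss mul1r.
  apply: (half j 1 _ _); rewrite ?normr1 // !mxE !eqxx /= ?mul1r ?mulr1 //.
  by rewrite eq_sym (negbTE ij) mulr0 add0r.
pose i0 := Ordinal (ltnW n1); pose i1 := Ordinal n1.
have main x : A x -> connected_component A x (rho *: dl i0).
  move=> Ax; have [i xi] : exists i, x 0 i != 0.
    apply/existsP; apply: contraT; rewrite negb_exists => /forallP H.
    move: Ax; rewrite /A /exterior /= /enorm /dot big1 ?sqrtr0; first by rewrite leNgt rho0.
    by move=> i _; have := H i; rewrite negbK => /eqP ->; rewrite mulr0.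
  pose s := Num.sg (x 0 i).
  have s1 : `|s| = 1 by rewrite normr_sg xi.
  have sx : s * x 0 i = `|x 0 i| by rewrite -normrEsg.
  have x0 : 0 < `|x 0 i| by rewrite normr_gt0.
  pose T := 1 + rho / `|x 0 i|.
  have T1 : 1 <= T by rewrite lerDl divr_ge0 // ltW.
  apply: (@connected_component_trans _ _ (T *: x)).
    apply: segment_component => t /andP[t0 t1].
    have -> : x + t *: (T *: x - x) = (1 + t * (T - 1)) *: x.
      by apply/rowP => k; rewrite !mxE; ring.
    rewrite /A /exterior /= enormZ ger0_norm; last by rewrite addr_ge0 // mulr_ge0 // subr_ge0.
    apply: le_trans Ax _; rewrite ler_peMl ?enorm_ge0 // lerDl mulr_ge0 // subr_ge0 //.
  apply: (@connected_component_trans _ _ ((s * rho) *: dl i)).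
    apply: (half i s _ _ s1).
      by rewrite mxE mulrCA sx /T mulrDl mul1r divfK ?gt_eqF // lerDr normr_ge0.
    rewrite !mxE !eqxx /= mulr1 mulrA.
    by rewrite -expr2 -(real_normK (num_real s)) s1 expr1n mul1r.
  have [ii|ii] := eqVneq i i0; last exact: axis.
  apply: (@connected_component_trans _ _ (rho *: dl i1)); first by apply: axis; rewrite // ii.
  by have := axis i1 i0 1; rewrite mul1r normr1; apply.
apply: connected_of_component => x y /main hx /main hy.
by apply: connected_component_trans hx _; exact: connected_component_sym.
Qed.

End ExteriorDomain.

(** * Rotationally symmetric graphs and their edges *)

Section Graphs.
Variables (R : realType) (n : nat).

Lemma convex_between (a b c t : R) : 0 <= t <= 1 -> a < b -> a < c ->
  a < b + t * (c - b).
Proof.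
move=> /andP[t0 t1] ab ac; have [bc|/ltW cb] := leP b c.
  by have := mulr_ge0 t0 (_ : 0 <= c - b); rewrite subr_ge0 => /(_ bc); lra.
have := mulr_ge0 (_ : 0 <= 1 - t) (_ : 0 <= b - c); rewrite !subr_ge0 => /(_ t1 cb).
by rewrite mulrBl mul1r => ?; lra.
Qed.

Local Notation rV := 'rV[R]_n.
Local Notation V := (espace R n).
Implicit Types (p q : V) (x y : rV) (u : R -> R) (rho : R) (W : set V).

Local Notation graph rho u := (@exterior_graph R n rho (fun x => u (enorm x))).

Lemma enorm_fst_continuous : continuous (fun p : V => enorm p.1).
Proof.
move=> p; apply: (@continuous_comp _ _ _ (fun p : V => p.1) (@enorm R n)).
  exact: fst_continuous.
exact: enorm_continuous.
Qed.

Lemma continuous_pair (T : topologicalType) (f : T -> rV) (g : T -> R) (t : T) :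
  {for t, continuous f} -> {for t, continuous g} ->
  {for t, continuous (fun s => (f s, g s) : V)}.
Proof. by move=> fc gc; exact: (cvg_pair fc gc). Qed.

(** Extending u by its value at rho expresses continuity up to the edge as continuity on the line,
    and the graph becomes an intersection of closed preimages. *)
Lemma closed_graph rho u : continuous (fun r => u (Num.max rho r)) -> closed (graph rho u).
Proof.
move=> uc.
pose g (p : V) := p.2 - u (Num.max rho (enorm p.1)).
have gc : continuous g.
  move=> p; apply: (@continuousB _ _ _ (fun p : V => p.2 : R) (fun p : V => u (Num.max rho (enorm p.1)))).
    exact: snd_continuous.
  apply: (@continuous_comp _ _ _ (fun p : V => enorm p.1) (fun r => u (Num.max rho r))).
    exact: enorm_fst_continuous.
  exact: uc.
have -> : graph rho u = ((fun p : V => enorm p.1) @^-1` [set r | rho <= r]) `&`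
    (g @^-1` [set z | z = 0]).
  apply/seteqP; split=> p /= [h1 h2]; split=> //.
    by rewrite /g (max_idPr h1) h2 subrr.
  by move: h2 => /eqP; rewrite /g (max_idPr h1) subr_eq0 => /eqP.
apply: closedI.
  by move/continuous_closedP : enorm_fst_continuous; apply; exact: closed_ge.
by move/continuous_closedP : gc; apply; exact: closed_eq.
Qed.

Lemma connected_graph rho u : (1 < n)%N -> 0 < rho ->
  continuous (fun r => u (Num.max rho r)) -> connected (graph rho u).
Proof.
move=> n1 rho0 uc.
pose f x : V := (x, u (Num.max rho (enorm x))).
have -> : graph rho u = f @` (@exterior R n rho).
  apply/seteqP; split=> [[x z] /= [h1 h2]|_ [x /= h <-]].
    by exists x => //; rewrite /f (max_idPr h1) -h2.
  by rewrite /exterior_graph /f /= (max_idPr h).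
apply: connected_continuous_connected; first exact: connected_exterior.
apply: continuous_subspaceT => x; apply: continuous_pair; first exact: cvg_id.
apply: (@continuous_comp _ _ _ (@enorm R n) (fun r => u (Num.max rho r))).
  exact: enorm_continuous.
exact: uc.
Qed.

Lemma enorm_mul_orthogonal x (Q : 'M[R]_n) : Q *m Q^T = 1%:M -> enorm (x *m Q) = enorm x.
Proof.
move=> QQ; have dotE (y : rV) : dot y y = (y *m y^T) 0 0.
  by rewrite mxE; apply: eq_bigr => i _; rewrite mxE.
by rewrite /enorm !dotE trmx_mul mulmxA -(mulmxA x) QQ mulmx1.
Qed.

Lemma rotationally_symmetric_graph rho u : rotationally_symmetric (graph rho u).
Proof.
by move=> Q QQ p [h1 h2]; split=> /=; rewrite enorm_mul_orthogonal.
Qed.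

Lemma norm_le_snorm p : `|p| <= snorm p.
Proof.
have d0 : 0 <= dot p.1 p.1 by exact: dot_ge0.
rewrite prod_normE ge_max; apply/andP; split.
  apply: le_trans (mxnorm_le_enorm _) _.
  by rewrite ler_wsqrtr // /sdot lerDl -expr2 sqr_ge0.
by rewrite -sqrtr_sqr ler_wsqrtr // /sdot -expr2 lerDr.
Qed.

(** The partition 0, 1 bounds the chord by the length of a path, so a sequence that is Cauchy for
    the intrinsic distance is Cauchy in the ambient space. *)
Lemma complete_closed W : closed W -> complete_hypersurface W.
Proof.
move=> Wc x Wx xC.
have xC' e : 0 < e -> exists N, forall i j, (N <= i)%N -> (N <= j)%N -> `|x j - x i| <= e.
  move=> e0; have [N HN] := xC e e0; exists N => i j Ni Nj.
  have [g [_ [g0 g1] _ gl]] := HN i j Ni Nj.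
  have := gl [:: 0; 1]; rewrite /= !lexx !ler01 /= => /(_ isT isT).
  rewrite big_nat1 /= g0 g1 => h; exact: le_trans (norm_le_snorm _) h.
have c1 : cvg ((fun i => (x i).1) @ \oo).
  apply/cauchy_cvgP/cauchy_exP => e /= e0.
  have [|N HN] := xC' (e / 2); first by rewrite divr_gt0.
  exists (x N).1; exists N => // i /= Ni; rewrite -ball_normE /=.
  have := HN i N Ni (leqnn N); rewrite prod_normE ge_max => /andP[h _].
  by apply: le_lt_trans h _; lra.
have c2 : cvg ((fun i => (x i).2 : R) @ \oo).
  apply/cauchy_cvgP/cauchy_exP => e /= e0.
  have [|N HN] := xC' (e / 2); first by rewrite divr_gt0.
  exists (x N).2; exists N => // i /= Ni; rewrite -ball_normE /=.
  have := HN i N Ni (leqnn N); rewrite prod_normE ge_max => /andP[_ h].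
  by apply: le_lt_trans h _; lra.
pose l : V := (lim ((fun i => (x i).1) @ \oo), lim ((fun i => (x i).2 : R) @ \oo)).
have xl : x @ \oo --> l.
  have -> : x = (fun i => ((x i).1, (x i).2)) by apply/funext => i; case: (x i).
  exact: cvg_pair c1 c2.
exists l => //; apply: (closed_cvg W Wc _ _ xl).
by exists 0%N => // i _; exact: Wx.
Qed.

Lemma inf_snorm W rho : 0 < rho -> (forall p, W p -> rho <= enorm p.1) ->
  (exists2 p, W p & enorm p.1 = rho /\ p.2 = 0) -> inf [set snorm p | p in W] = rho.
Proof.
move=> rho0 Wr [p0 Wp0 [p01 p02]].
have sle p : enorm p.1 <= snorm p.
  by rewrite ler_wsqrtr // /sdot lerDl -expr2 sqr_ge0.
have s0 : snorm p0 = rho.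
  by rewrite /snorm /sdot p02 mul0r addr0 -p01.
apply/eqP; rewrite eq_le; apply/andP; split.
  rewrite -s0; apply: ge_inf; last by exists p0.
  by exists 0 => _ [p _ <-]; exact: sqrtr_ge0.
apply: lb_le_inf; first by exists (snorm p0); exists p0.
by move=> _ [p Wp <-]; apply: le_trans (sle p); exact: Wr.
Qed.

Definition sphere_at rho (h : R) : set V := [set q | enorm q.1 = rho /\ q.2 = h].

(** The radial projection transfers connectedness from the exterior domain to the sphere. *)
Lemma sphere_image rho (h : R) : 0 < rho ->
  sphere_at rho h = (fun x => ((rho / enorm x) *: x, h) : V) @` @exterior R n rho.
Proof.
move=> rho0; apply/seteqP; split=> [[x z] /= [h1 h2]|_ [x /= hx <-]].
  by exists x; rewrite /exterior /= ?h1 // divff ?gt_eqF // scale1r -h2.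
have x0 : 0 < enorm x by apply: lt_le_trans hx.
split=> //=; rewrite enormZ ger0_norm ?divr_ge0 ?ltW // divfK // gt_eqF //.
Qed.

Lemma connected_sphere rho (h : R) : (1 < n)%N -> 0 < rho -> connected (sphere_at rho h).
Proof.
move=> n1 rho0; rewrite sphere_image //.
apply: connected_continuous_connected; first exact: connected_exterior.
apply: continuous_in_subspaceT => x /[!inE] hx.
have x0 : 0 < enorm x by apply: lt_le_trans hx.
have c1 : {for x, continuous (fun y : rV => rho / enorm y)}.
  apply: (@continuousM _ _ (fun=> rho) (fun y => (enorm y)^-1)); first exact: (@cst_continuous _ _ rho x).
  by apply: continuousV; [rewrite gt_eqF|exact: enorm_continuous].
have c2 : {for x, continuous (fun y : rV => (rho / enorm y) *: y)}.
  exact: (@continuousZ _ _ _ (fun y : rV => rho / enorm y) id x c1 (@cvg_id _ _)).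
exact: (continuous_pair c2 (@cst_continuous _ _ h x)).
Qed.

Lemma compact_sphere rho (h : R) : compact (sphere_at rho h).
Proof.
have -> : sphere_at rho h = [set x : rV | enorm x = rho] `*` [set h].
  by apply/seteqP; split=> [[x z]|[x z]].
apply: compact_setX; last exact: compact_set1.
apply: bounded_closed_compact.
  exists rho; split; first exact: num_real.
  by move=> M rM x /= xr; apply: le_trans (mxnorm_le_enorm x) _; rewrite xr ltW.
by move/continuous_closedP : (@enorm_continuous R n) => /(_ _ (@closed_eq R rho)).
Qed.

(* Near an edge point the complement of W is connected, but a local equation of W
   changes sign there. *)
Lemma edge_not_interior rho u p : 0 < rho -> {for rho, continuous u} ->
  enorm p.1 = rho -> p.2 = u rho -> ~ interior_point (graph rho u) p.
Proof.
move=> rho0 uc p1 p2 [Wp [F [[U [Uo Up FC WU]] [v Dv]]]].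
have FD : is_derive p v F ('D_v F p).
  by have [FD _] := Cdiff_derive v (FC 1%N); exact: FD.
have Fc q : U q -> {for q, continuous F} by exact: Cdiff_continuous (FC 0%N) q.
have Fp : F p = 0 by apply/(WU p Up).
have /nbhs_ballP [e /= e0 He] := open_nbhs_nbhs (conj Uo Up).
have ucc : {for p.1, continuous (fun x => u (enorm x))}.
  apply: (@continuous_comp _ _ _ (@enorm R n) u); first exact: enorm_continuous.
  by rewrite p1.
have N0 : \forall x \near p.1, `|u rho - u (enorm x)| < e / 2.
  by have /cvgrPdist_lt := ucc; rewrite p1; apply; rewrite divr_gt0.
have /nbhs_ballP [d1 /= d10 Hd1] := N0.
pose d := Num.min d1 e.
have d0 : 0 < d by rewrite lt_min d10.
have dd1 : d <= d1 by rewrite ge_min lexx.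
have de : d <= e by rewrite ge_min lexx orbT.
(* In this cylinder the graph stays within e / 2 of the height of p, so the levels p.2 + 3 e / 4 and
   p.2 - 3 e / 4 are free of it. *)
pose B : set V := [set q | `|p.1 - q.1| < d /\ `|p.2 - q.2| < e].
have BU q : B q -> U q.
  move=> [h1 h2]; apply: He; rewrite -ball_normE /= prod_normE gt_max h2 andbT.
  exact: lt_le_trans h1 de.
have uB x : `|p.1 - x| < d -> `|u rho - u (enorm x)| < e / 2.
  by move=> h; apply: Hd1; rewrite -ball_normE /=; exact: lt_le_trans h dd1.
pose A : set V := B `\` graph rho u.
have FA q : A q -> F q <> 0 by move=> [Bq nW] Fq; apply: nW; apply/(WU q (BU q Bq)).
(* The point p.1 is moved towards the axis by at most d / 2: the result x1 lies in the hole |x| <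
   rho and the vertical line over it meets B. *)
pose ta := Num.min (d / (2 * rho)) (1 / 2).
have ta0 : 0 < ta by rewrite lt_min !divr_gt0 // mulr_gt0.
have ta1 : ta <= 1 / 2 by rewrite ge_min lexx orbT.
have taE : ta * (2 * rho) <= d by rewrite -ler_pdivlMr ?mulr_gt0 // ge_min lexx.
pose x1 := (1 - ta) *: p.1.
have x1r : enorm x1 < rho.
  rewrite enormZ ger0_norm ?p1; last by rewrite subr_ge0; lra.
  by have := mulr_gt0 ta0 rho0; lra.
have Bx1 z : `|p.2 - z| < e -> B (x1, z).
  move=> h; split=> //=.
  have -> : p.1 - x1 = ta *: p.1 by apply/rowP => k; rewrite !mxE; ring.
  rewrite normrZ gtr0_norm //; apply: (@le_lt_trans _ _ (ta * rho)).
    by rewrite ler_pM2l // -p1 mxnorm_le_enorm.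
  by lra.
have convN (W' : normedModType R) (x y z : W') (m t : R) : 0 <= t <= 1 -> `|x - y| < m ->
    `|x - z| < m -> `|x - (y + t *: (z - y))| < m.
  move=> t01 h1 h2; case/andP: (t01) => t0 t1.
  have -> : x - (y + t *: (z - y)) = (1 - t) *: (x - y) + t *: (x - z).
    rewrite scalerBl scale1r -addrA -scalerN -scalerDr opprB (addrA (y - x)) subrK.
    by rewrite opprD addrA -scalerN opprB.
  apply: le_lt_trans (ler_normD _ _) _; rewrite !normrZ !ger0_norm ?subr_ge0 //.
  have := @convex_between (- m) (- `|x - y|) (- `|x - z|) t t01.
  by rewrite !ltrN2 => /(_ h1 h2); lra.
have seg q q' : B q -> B q' -> (forall t, 0 <= t <= 1 -> rho <= enorm (q.1 + t *: (q'.1 - q.1)) ->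
    q.2 + t * (q'.2 - q.2) <> u (enorm (q.1 + t *: (q'.1 - q.1)))) -> connected_component A q q'.
  move=> [q1 q2] [q1' q2'] H; apply: segment_component => t t01; split.
    by split; [exact: convN|exact: (convN R)].
  by move=> [/= h1 h2]; exact: (H t t01 h1).
(* Three segments off the graph: vertically from q to a level l free of the graph, horizontally to
   the line over x1, then vertically inside the hole. *)
have path q l : A q -> `|p.2 - l| < e -> (forall x, `|p.1 - x| < d -> l <> u (enorm x)) ->
    (forall t, 0 <= t <= 1 -> rho <= enorm q.1 -> q.2 + t * (l - q.2) <> u (enorm q.1)) ->
    connected_component A q (x1, p.2).
  move=> [[q1 q2] nq] le lu ql.
  apply: (@connected_component_trans _ _ (q.1, l)).
    apply: seg => //= t t01; rewrite subrr scaler0 addr0; exact: ql.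
  apply: (@connected_component_trans _ _ (x1, l)).
    apply: seg => //=; first exact: Bx1.
    move=> t t01 _; rewrite subrr mulr0 addr0; apply: lu; apply: convN => //.
    by have [] := Bx1 l le.
  apply: seg => /=; try apply: Bx1 => //; first by rewrite subrr normr0.
  move=> t _; rewrite subrr scaler0 addr0 => h; exfalso.
  by move: (lt_le_trans x1r h); rewrite ltxx.
have up x : `|p.1 - x| < d -> u (enorm x) < p.2 + e * (3 / 4).
  by move=> /uB; rewrite -p2 ltr_norml => /andP[? ?]; lra.
have dn x : `|p.1 - x| < d -> p.2 - e * (3 / 4) < u (enorm x).
  by move=> /uB; rewrite -p2 ltr_norml => /andP[? ?]; lra.
have e34 : 0 < e * (3 / 4) by rewrite mulr_gt0.
have main q : A q -> connected_component A q (x1, p.2).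
  move=> Aq; have [[q1 q2] nq] := Aq.
  have [|qu] := ltP (u (enorm q.1)) q.2.
    move=> uq; apply: (path q (p.2 + e * (3 / 4))) => //.
    - by rewrite opprD addrA subrr sub0r normrN gtr0_norm //; lra.
    - by move=> x /up h E; rewrite -E ltxx in h.
    - move=> t t01 _ E; have := convex_between t01 uq (up _ q1).
      by rewrite E ltxx.
  apply: (path q (p.2 - e * (3 / 4))) => //.
  - by rewrite opprB addrC subrK gtr0_norm //; lra.
  - by move=> x /dn h E; rewrite -E ltxx in h.
  - move=> t t01 hr E.
    have qu' : q.2 < u (enorm q.1).
      by rewrite lt_neqAle qu andbT; apply/eqP => E'; apply: nq.
    have := @convex_between (- u (enorm q.1)) (- q.2) (- (p.2 - e * (3 / 4))) t t01.
    rewrite !ltrN2 => /(_ qu' (dn _ q1)); have -> : - q.2 + t * (- (p.2 - e * (3 / 4)) - - q.2) =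
      - (q.2 + t * (p.2 - e * (3 / 4) - q.2)) by ring.
    by rewrite E ltxx.
(* Along v the equation reads F(t v + p) = g(t) t with g continuous at 0 and g(0) nonzero, so F has
   opposite signs at t and - t for small t. *)
have /is_derive_line /is_derive1_caratheodory [g [gE gc g0]] := FD.
have [t [t0 B1 B2 g1]] : exists t : R, [/\ 0 < t, B (t *: v + p), B (- t *: v + p) &
    0 < g t * g (- t)].
  have lc : continuous (fun t : R => t *: v + p).
    by move=> t; apply: cvgD; [apply: cvgZr_tmp; exact: cvg_id|exact: cvg_cst].
  have NB : \forall q \near p, B q.
    apply/nbhs_ballP; exists d => // q; rewrite -ball_normE /= prod_normE gt_max.
    by move=> /andP[h1 h2]; split=> //; exact: lt_le_trans h2 de.
  have N1 : \forall t \near (0 : R), B (t *: v + p).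
    by apply: (lc 0); rewrite scale0r add0r.
  have N2 : \forall t \near (0 : R), `|g 0 - g t| < `|g 0|.
    by have /cvgrPdist_lt := gc; apply; rewrite g0 normr_gt0.
  have [r0 /= r00 Hr0] := filterI N1 N2.
  have rI (s : R) : `|s| < r0 -> B (s *: v + p) /\ `|g 0 - g s| < `|g 0|.
    by move=> h; apply: Hr0; rewrite /= sub0r normrN.
  exists (r0 / 2); have r2 : 0 < r0 / 2 by rewrite divr_gt0.
  have [|b1 c1] := rI (r0 / 2); first by rewrite gtr0_norm //; lra.
  have [|b2 c2] := rI (- (r0 / 2)); first by rewrite normrN gtr0_norm //; lra.
  split=> //.
  have g00 : g 0 != 0 by rewrite g0.
  move: c1 c2; have [gn|gp|//] := ltgtP (g 0) 0; last by move=> E; rewrite E eqxx in g00.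
    rewrite (ltr0_norm gn) !ltr_norml => /andP[h1 _] /andP[h2 _].
    by clear - gn h1 h2; rewrite nmulr_rgt0; lra.
  rewrite (gtr0_norm gp) !ltr_norml => /andP[_ h1] /andP[_ h2].
  by clear - gp h1 h2; rewrite mulr_gt0 //; lra.
have FE (s : R) : F (s *: v + p) = g s * s.
  by have := gE s; rewrite scale0r add0r Fp !subr0.
have prod_neg : F (t *: v + p) * F (- t *: v + p) < 0.
  rewrite !FE.
  have -> : g t * t * (g (- t) * - t) = - ((g t * g (- t)) * (t * t)) by ring.
  by rewrite oppr_lt0; apply: mulr_gt0 => //; exact: mulr_gt0.
have AF q : B q -> F q != 0 -> A q.
  move=> Bq Fq; split=> // Wq; move/eqP: Fq; apply; exact/(WU q (BU q Bq)).
have [F1 F2] : F (t *: v + p) != 0 /\ F (- t *: v + p) != 0.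
  by apply/andP; rewrite -negb_or -mulf_eq0 lt_eqF.
have A1 := AF _ B1 F1; have A2 := AF _ B2 F2.
have C12 : connected_component A (t *: v + p) (- t *: v + p).
  apply: connected_component_trans (main _ A1) _.
  exact: connected_component_sym (main _ A2).
have Fc' q : A q -> {for q, continuous F} by case=> /BU /Fc.
have [h|h|h] := ltgtP (F (t *: v + p)) 0; last by rewrite h eqxx in F1.
- have h2 : 0 < F (- t *: v + p) by move: prod_neg; rewrite nmulr_rlt0.
  have [z Az Fz] := component_IVT Fc' C12 A1 h h2; exact: (FA z Az).
- have h2 : F (- t *: v + p) < 0 by move: prod_neg; rewrite pmulr_rlt0.
  have [z Az Fz] := component_IVT Fc' (connected_component_sym C12) A2 h2 h.
  exact: (FA z Az).
Qed.

End Graphs.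

(** * Wings assembled from their profiles *)

Section Wings.
Variables (R : realType) (n : nat).
Local Notation rV := 'rV[R]_n.
Local Notation V := (espace R n).
Implicit Types (p q : V) (x : rV) (u v F : R -> R) (rho : R) (W : set V) (f : speed R n).

Local Notation graph rho u := (@exterior_graph R n rho (fun x => u (enorm x))).

(* The profile ODE of a translator: u is the height, v its slope. *)
Definition profile_on (rho : R) (F : R -> R) (O : set R) u v :=
  forall r : R, rho < r -> [/\ O (v r / r), is_derive r 1 u (v r) &
      is_derive r 1 v ((1 + v r ^+ 2) * F (v r / r))].

(* Along a graph of slope v at distance r the curvatures are c * (F q, q, ..., q)
   with q = v / r and c = (1 + v^2)^(-1/2). *)
Definition speed_ode f (F : R -> R) (Q : set R) :=
  forall q c : R, Q q -> 0 < c -> speed_dom f (curvature_vec n (c * F q) (c * q)) /\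
    f (curvature_vec n (c * F q) (c * q)) = c.

Lemma smooth_profile rho F O u v : 0 <= rho -> open O -> smooth_on O F ->
  profile_on rho F O u v ->
  smooth_on [set r : R | rho < r] v /\ smooth_on [set r : R | rho < r] u.
Proof.
move=> rho0 Oo FC H; have So : open [set r : R | rho < r] by exact: open_gt.
have r0 (r : R) : rho < r -> r != 0 by move=> h; rewrite gt_eqF // (le_lt_trans rho0).
have vC : smooth_on [set r : R | rho < r] v.
  apply: (@smooth_bootstrap _ _ _ (fun r => (1 + v r ^+ 2) * F (v r / r)) So).
    by move=> r /H [].
  move=> m C; apply: Cdiff_mul => //.
    by apply: Cdiff_add => //; [exact: Cdiff_const|exact: Cdiff_exp].
  apply: (Cdiff_comp (f := fun r => v r / r) So Oo _ (FC m)); first by move=> r /H [].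
  by apply: Cdiff_div => //; exact: Cdiff_ident.
split=> //.
apply: (@smooth_bootstrap _ _ _ v So) => [r /H []//|m _]; exact: vC.
Qed.

Lemma smooth_exterior rho u : 0 <= rho -> smooth_on [set r : R | rho < r] u ->
  exterior_smooth rho (fun x : rV => u (enorm x)).
Proof.
move=> rho0 uC m; have So : open [set r : R | rho < r] by exact: open_gt.
have Uo : open [set x : rV | rho < enorm x] := open_enorm So.
apply: (Cdiff_comp Uo So _ (uC m)) => //.
by apply: Cdiff_enorm => // x /= h; exact: le_lt_trans h.
Qed.

Lemma open_above (a : R -> R) (D : set R) : open D ->
  {in D, continuous a} ->
  open [set q : V | D (enorm q.1) /\ a (enorm q.1) < q.2].
Proof.
move=> Do ac; rewrite openE => q [/= Dq aq].
pose m := (a (enorm q.1) + q.2) / 2.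
have am : a (enorm q.1) < m by rewrite /m; lra.
have mq : m < q.2 by rewrite /m; lra.
have N1 : \forall r \near enorm q.1, D r /\ a r < m.
  apply: filterI; first exact: open_nbhs_nbhs.
  have h : enorm q.1 \in D by rewrite inE.
  exact: (ac _ h _ (lt_nbhsl am)).
have N2 : \forall z \near q.2, m < z by exact: lt_nbhsr.
have := near_fst_snd N1 N2; apply: filterS => q' [[h1 h2] h3]; split=> //.
exact: lt_trans h2 h3.
Qed.

Lemma open_below (a : R -> R) (D : set R) : open D -> {in D, continuous a} ->
  open [set q : V | D (enorm q.1) /\ q.2 < a (enorm q.1)].
Proof.
move=> Do ac; rewrite openE => q [/= Dq aq].
pose m := (a (enorm q.1) + q.2) / 2.
have am : m < a (enorm q.1) by rewrite /m; lra.
have mq : q.2 < m by rewrite /m; lra.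
have N1 : \forall r \near enorm q.1, D r /\ m < a r.
  apply: filterI; first exact: open_nbhs_nbhs.
  have h : enorm q.1 \in D by rewrite inE.
  exact: (ac _ h _ (lt_nbhsr am)).
have N2 : \forall z \near q.2, z < m by exact: lt_nbhsl.
have := near_fst_snd N1 N2; apply: filterS => q' [[h1 h2] h3]; split=> //.
exact: lt_trans h3 h2.
Qed.

(** The chart A = u, B = id, with c = 1 / sqrt(1 + v^2): the profile equation turns u'' / (1 +
    v^2)^(3/2) into c F(v / r). *)
Lemma graph_point rho F O u v W p (U : set V) : (0 < n)%N -> 0 <= rho ->
  open O -> smooth_on O F -> profile_on rho F O u v ->
  open U -> U p -> (forall q, U q -> rho < enorm q.1) -> W p ->
  (forall q, U q -> (W q <-> q.2 = u (enorm q.1))) ->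
  let r := enorm p.1 in
  exists nu (c : R), [/\ 0 < c, sdot nu (e_last R n) = - c &
    principal_curvatures W p nu (curvature_vec n (c * F (v r / r)) (c * (v r / r)))].
Proof.
move=> n0 rho0 Oo FC H Uo Up Urho Wp WU r.
have [vC uC] := smooth_profile rho0 Oo FC H.
pose s := Num.sqrt (1 + v r ^+ 2).
have s1 : 0 < 1 + v r ^+ 2 by rewrite ltr_pwDl // sqr_ge0.
have s0 : 0 < s by rewrite sqrtr_gt0.
have sE : s ^+ 2 = v r ^+ 2 + 1 ^+ 2 by rewrite sqr_sqrtr ?(ltW s1) // expr1n addrC.
have rr : rho < r := Urho p Up.
have r0 : 0 < r by exact: le_lt_trans rr.
have So : open [set r : R | rho < r] by exact: open_gt.
have [_ uD vD] := H r rr.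
have HU q : U q -> [/\ 0 < enorm q.1, [set r : R | rho < r] (enorm q.1) & [set: R] q.2].
  by move=> /Urho h; split=> //; exact: le_lt_trans h.
have WU' q : U q -> (W q <-> u (enorm q.1) - q.2 = 0).
  move=> /WU ->; split=> [->|/eqP]; first by rewrite subrr.
  by rewrite subr_eq0 => /eqP.
have idC : smooth_on [set: R] (fun z : R => z) by move=> m; exact: Cdiff_ident.
have := @radial_principal_curvatures R n W p u (fun z : R => z) v (fun=> 1)
   ((1 + v r ^+ 2) * F (v r / r)) 0 _ _ U n0 So openT Uo uC idC HU Up Wp WU'.
move=> /(_ (fun r h => let: And3 _ h' _ := H r h in h') (fun z _ => is_derive_ident z)
  vD (is_derive_const 1 (p.2 : R) 1) s s0 sE) pc.
exists ((v r / (s * r)) *: p.1, - 1 / s), s^-1; split; first by rewrite invr_gt0.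
  by rewrite /sdot /= dot0r add0r mulr1 mulN1r.
have e1 : ((1 + v r ^+ 2) * F (v r / r) * 1 ^+ 2 - 0 * v r ^+ 2) / s ^+ 3 = s^-1 * F (v r / r).
  rewrite -(sqr_sqrtr (ltW s1)) -/s expr1n; field; exact: lt0r_neq0.
have e2 : v r / (s * r) = s^-1 * (v r / r) by field; rewrite !lt0r_neq0.
by rewrite -e2 -e1.
Qed.

Lemma speed_ode_point f F (Q : set R) W p nu (q c : R) : speed_ode f F Q -> Q q ->
  0 < c -> sdot nu (e_last R n) = - c ->
  principal_curvatures W p nu (curvature_vec n (c * F q) (c * q)) ->
  exists nu l, [/\ principal_curvatures W p nu l, sdot nu (e_last R n) <= 0,
        speed_dom f l & f l = - sdot nu (e_last R n)].
Proof.
move=> fF Qq c0 nuc pc; have [fd fE] := fF q c Qq c0.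
by exists nu, (curvature_vec n (c * F q) (c * q)); rewrite nuc opprK oppr_le0 ltW.
Qed.

Lemma nonconvex_of_point W p nu (kap mu : R) : (1 < n)%N -> kap < 0 -> 0 < mu ->
  principal_curvatures W p nu (curvature_vec n kap mu) -> ~ convex_hypersurface W.
Proof.
move=> n1 k0 m0 pc H; have [h|h] := H _ _ _ pc.
  have := h (Ordinal (ltnW n1)); rewrite mxE /=; lra.
have := h (Ordinal n1); rewrite mxE /=; lra.
Qed.

Lemma sphere_point (rho : R) : (0 < n)%N -> 0 < rho -> exists x : rV, enorm x = rho.
Proof.
move=> n0 rho0; exists (rho *: delta_mx 0 (Ordinal n0)); rewrite enormZ gtr0_norm //.
rewrite (@enorm_eq _ _ 1) ?mulr1 // /dot (bigD1 (Ordinal n0)) //= mxE !eqxx big1 ?addr0 ?mulr1 ?expr1n //.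
by move=> i i0; rewrite mxE (negbTE i0) andbF mul0r.
Qed.

Lemma max_continuousP rho u : continuous (fun r => u (Num.max rho r)) ->
  {in [set r : R | rho < r], continuous u}.
Proof.
move=> uc r /[!inE] /= hr.
apply: (@continuous_near _ _ (fun r => u (Num.max rho r))); last exact: uc.
by apply: filterS (lt_nbhsr hr) => y hy; rewrite (max_idPr (ltW hy)).
Qed.

Definition double_graph rho u1 u2 : set V := graph rho u1 `|` graph rho u2.

Section TwoBranches.
Variables (f : speed R n) (F : R -> R) (Q O : set R) (rho : R).
Variables (u1 v1 u2 v2 g p : R -> R) (e d r1 k0 : R).
Hypotheses (n1 : (1 < n)%N) (rho0 : 0 < rho) (Oo : open O) (FC : smooth_on O F).
Hypothesis fF : speed_ode f F Q.
Hypotheses (u10 : u1 rho = 0) (u20 : u2 rho = 0).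
Hypothesis u1c : continuous (fun r => u1 (Num.max rho r)).
Hypothesis u2c : continuous (fun r => u2 (Num.max rho r)).
Hypotheses (H1 : profile_on rho F O u1 v1) (H2 : profile_on rho F O u2 v2).
Hypothesis Q1 : forall r, rho < r -> Q (v1 r / r).
Hypothesis Q2 : forall r, rho < r -> Q (v2 r / r).
Hypothesis v21 : forall r, rho < r -> v2 r < v1 r.
Hypotheses (d0 : 0 < d) (de : d <= e) (r1rho : rho < r1) (k00 : 0 < k0).
Hypotheses (gC : smooth_on (ball0 e) g) (p0 : p 0 = 0).
Hypothesis gD : forall z : R, ball0 e z -> is_derive z 1 g (p z).
Hypothesis pD : is_derive (0 : R) 1 p k0.
Hypothesis neck : forall r z, r < r1 -> ball0 d z ->
  (rho <= r /\ (z = u1 r \/ z = u2 r)) <-> r = g z.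
Hypothesis f_neck : speed_dom f (curvature_vec n (- k0) rho^-1) /\
  f (curvature_vec n (- k0) rho^-1) = 0.

Local Notation W := (double_graph rho u1 u2).

(** u1 - u2 vanishes at rho and has positive derivative beyond. The mean value theorem needs
    continuity only at rho itself, where the slopes may be infinite. *)
Lemma branches_ordered (r : R) : rho < r -> u2 r < u1 r.
Proof.
move=> hr; rewrite -subr_gt0.
pose w (z : R) := u1 (Num.max rho z) - u2 (Num.max rho z).
have wr : w r = u1 r - u2 r by rewrite /w (max_idPr (ltW hr)).
have wrho : w rho = 0 by rewrite /w maxxx u10 u20 subrr.
have wc : continuous w by move=> z; apply: continuousB; [exact: u1c|exact: u2c].
have D (z : R) : z \in `]rho, r[ -> is_derive z 1 w (v1 z - v2 z).
  rewrite in_itv /= => /andP[hx _].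
  have [_ D1 _] := H1 hx; have [_ D2 _] := H2 hx.
  apply: is_derive_near (is_derive_sub D1 D2).
  by apply: filterS (lt_nbhsr hx) => y hy; rewrite /w (max_idPr (ltW hy)).
have [c cI E] := MVT hr D (continuous_subspaceT wc).
rewrite -wr; have -> : w r = w r - w rho by rewrite wrho subr0.
rewrite E mulr_gt0 ?subr_gt0 //; apply: v21.
by move: cI; rewrite in_itv /= => /andP[].
Qed.

Let n0 : (0 < n)%N := ltnW n1.

(** Separates the branches: the open set above it meets only the graph of u1, the one below it only
    that of u2, which provides local equations for each. *)
Let mid (r : R) := (u1 r + u2 r) / 2.

Let midc : {in [set r : R | rho < r], continuous mid}.
Proof.
move=> r hr; apply: (@continuousM _ _ (fun r => u1 r + u2 r) (fun=> 2^-1)); last exact: cst_continuous.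
by apply: continuousD; [exact: (max_continuousP u1c)|exact: (max_continuousP u2c)].
Qed.

Lemma double_graph_point q : W q -> rho < enorm q.1 ->
  exists nu (c s : R), [/\ 0 < c, Q s, sdot nu (e_last R n) = - c &
    principal_curvatures W q nu (curvature_vec n (c * F s) (c * s))].
Proof.
move=> Wq hq; have Do : open [set r : R | rho < r] by exact: open_gt.
have uu := branches_ordered hq.
have [q1|q2] : q.2 = u1 (enorm q.1) \/ q.2 = u2 (enorm q.1) by case: (Wq) => -[]; tauto.
- have Uo := open_above Do midc.
  have [] := graph_point (W := W) (p := q) n0 (ltW rho0) Oo FC H1 Uo; rewrite /mid /=.
  + by split=> //; lra.
  + by move=> q' [].
  + by [].
  + move=> q' [h1 h2]; have uu' := branches_ordered h1; split.
      by move=> [[//]|[_ h3]]; exfalso; lra.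
    by move=> h3; left; split=> //; exact: ltW.
  move=> nu [c [c0 nuc pc]]; exists nu, c, (v1 (enorm q.1) / enorm q.1); split=> //.
  exact: Q1.
- have Uo := open_below Do midc.
  have [] := graph_point (W := W) (p := q) n0 (ltW rho0) Oo FC H2 Uo; rewrite /mid /=.
  + by split=> //; lra.
  + by move=> q' [].
  + by [].
  + move=> q' [h1 h2]; have uu' := branches_ordered h1; split.
      by move=> [[_ h3]|[//]]; exfalso; lra.
    by move=> h3; right; split=> //; exact: ltW.
  move=> nu [c [c0 nuc pc]]; exists nu, c, (v2 (enorm q.1) / enorm q.1); split=> //.
  exact: Q2.
Qed.

(** The chart A = id, B = g. As g has slope 0 at height 0 the normal is horizontal and the profile
    curvature is - g''(0) = - k0. *)
Lemma double_graph_neck q : W q -> enorm q.1 = rho ->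
  exists2 nu, sdot nu (e_last R n) = 0 &
    principal_curvatures W q nu (curvature_vec n (- k0) rho^-1).
Proof.
move=> Wq hq; have q20 : q.2 = 0 by case: (Wq) => -[_ ->]; rewrite hq.
have e0 : 0 < e by exact: lt_le_trans de.
pose U := [set q : V | (0 < enorm q.1 /\ enorm q.1 < r1) /\ ball0 d q.2].
have Uo : open U.
  rewrite openE => q' [[/= h1 h2] h3].
  have N1 : \forall r \near enorm q'.1, 0 < r /\ r < r1.
    by apply: filterI; [exact: lt_nbhsr|exact: lt_nbhsl].
  have N2 : \forall z \near q'.2, ball0 d z.
    exact: (open_nbhs_nbhs (conj (@open_ball0 R d) h3)).
  exact: near_fst_snd N1 N2.
have Uq : U q by split; rewrite /= ?hq ?q20 // /ball0 /= oppr_lt0 d0.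
have Op := @open_gt R 0; have eo := @open_ball0 R e.
have idC : smooth_on [set r : R | 0 < r] (fun z : R => z) by move=> m; exact: Cdiff_ident.
have HU q' : U q' -> [/\ 0 < enorm q'.1, [set r : R | 0 < r] (enorm q'.1) & ball0 e q'.2].
  by move=> [[h1 h2] h3]; split=> //; exact: ball0_subset h3.
have WU q' : U q' -> (W q' <-> enorm q'.1 - g q'.2 = 0).
  move=> [[_ h2] h3]; have N := neck h2 h3.
  have WE : W q' <-> (rho <= enorm q'.1 /\ (q'.2 = u1 (enorm q'.1) \/ q'.2 = u2 (enorm q'.1))).
    by rewrite /double_graph /exterior_graph /=; split=> [[]|] []; tauto.
  rewrite WE N; split=> [->|/eqP]; first by rewrite subrr.
  by rewrite subr_eq0 => /eqP.
have D1 : is_derive (enorm q.1) 1 (fun=> 1 : R) 0 by exact: is_derive_const.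
have D2 : is_derive (q.2 : R) 1 p k0 by rewrite q20.
have c1 : (1 : R) ^+ 2 = 1 ^+ 2 + p q.2 ^+ 2 by rewrite q20 p0 expr0n addr0.
have := @radial_principal_curvatures R n W q (fun z : R => z) g (fun=> 1) p 0 k0
  _ _ U n0 Op eo Uo idC gC HU Uq Wq WU (fun r _ => is_derive_ident r) gD D1 D2 1 ltr01 c1.
rewrite hq q20 p0.
have -> : (0 * 0 ^+ 2 - k0 * 1 ^+ 2) / 1 ^+ 3 = - k0 :> R by rewrite !expr1n; field.
have -> : 1 / (1 * rho) = rho^-1 by rewrite !mul1r.
move=> pc; eexists; last exact: pc.
by rewrite /sdot /= dot0r add0r oppr0 mul0r mulr1.
Qed.

Lemma double_graph_interior q : W q -> interior_point W q.
Proof.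
move=> Wq; have : rho <= enorm q.1 by case: (Wq) => -[].
rewrite le_eqVlt => /predU1P[/esym hq|hq].
  have [nu _ pc] := double_graph_neck Wq hq; exact: principal_curvatures_interior pc.
have [nu [c [s [_ _ _ pc]]]] := double_graph_point Wq hq.
exact: principal_curvatures_interior pc.
Qed.

Lemma double_graph_boundary : boundary W = set0.
Proof. by apply/seteqP; split=> // q [Wq]; case; exact: double_graph_interior. Qed.

Lemma double_graph_wing : wing_like f rho W.
Proof.
have [x0 x0E] := sphere_point n0 rho0.
have Wx0 : W (x0, 0) by left; rewrite /exterior_graph /= x0E u10.
have cl : closed W by apply: closedU; exact: closed_graph.
split.
- split.
  + by move=> q Wq; left; exact: double_graph_interior.
  + apply: connectedU; try exact: connected_graph.
    by exists (x0, 0); split; rewrite /exterior_graph /= x0E ?u10 ?u20.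
  + exact: complete_closed.
  + move=> M MM q [] h; [left|right]; exact: rotationally_symmetric_graph.
- rewrite double_graph_boundary; exact: compact0.
- apply: inf_snorm => //; first by move=> q [] [].
  by exists (x0, 0).
- move=> q [Wq _]; have : rho <= enorm q.1 by case: (Wq) => -[].
  rewrite le_eqVlt => /predU1P[/esym hq|hq].
    have [nu nu0 pc] := double_graph_neck Wq hq; have [fd fE] := f_neck.
    by exists nu, (curvature_vec n (- k0) rho^-1); rewrite nu0 oppr0 lexx.
  have [nu [c [s [c0 Qs nuc pc]]]] := double_graph_point Wq hq.
  exact: speed_ode_point fF Qs c0 nuc pc.
(* At the neck the curvatures - k0 and 1 / rho have opposite signs. *)
- have [nu _ pc] := double_graph_neck Wx0 x0E.
  by apply: nonconvex_of_point n1 _ _ pc; rewrite ?oppr_lt0 ?invr_gt0.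
Qed.

Lemma double_graph_branches :
  two_branches rho W (fun x : rV => u1 (enorm x)) (fun x : rV => u2 (enorm x)).
Proof.
have [_ u1C] := smooth_profile (ltW rho0) Oo FC H1.
have [_ u2C] := smooth_profile (ltW rho0) Oo FC H2.
split=> //; [exact: smooth_exterior (ltW rho0) _|exact: smooth_exterior (ltW rho0) _|].
by move=> x hx; rewrite gt_eqF // branches_ordered.
Qed.

End TwoBranches.

Section OneBranch.
Variables (f : speed R n) (F : R -> R) (Q O : set R) (rho a : R) (u v : R -> R).
Hypotheses (n1 : (1 < n)%N) (rho0 : 0 < rho) (a0 : 0 <= a) (arho : a < rho).
Hypotheses (Oo : open O) (FC : smooth_on O F) (fF : speed_ode f F Q).
Hypotheses (u0 : u rho = 0) (H : profile_on a F O u v).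
Hypothesis Qv : forall r, rho < r -> Q (v r / r).
Hypothesis concave : exists r, [/\ rho < r, 0 < v r & F (v r / r) < 0].

Local Notation W := (graph rho u).
Let n0 : (0 < n)%N := ltnW n1.

Let uc : continuous (fun r => u (Num.max rho r)).
Proof.
move=> r; apply: (@continuous_comp _ _ _ (fun r => Num.max rho r) u).
  exact: continuous_maxr.
have h : a < Num.max rho r by rewrite lt_max arho.
by have [_ D _] := H h; exact: is_derive_cont D.
Qed.

Lemma graph_inner_point q : W q -> rho < enorm q.1 ->
  exists nu (c : R), [/\ 0 < c, sdot nu (e_last R n) = - c &
    principal_curvatures W q nu (curvature_vec n (c * F (v (enorm q.1) / enorm q.1))
      (c * (v (enorm q.1) / enorm q.1)))].
Proof.
move=> Wq hq; have Uo : open [set q : V | rho < enorm q.1].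
  by move/continuousP : (@enorm_fst_continuous R n) => /(_ _ (@open_gt R rho)).
have H' : profile_on rho F O u v by move=> r hr; apply: H; exact: lt_trans hr.
apply: (graph_point (W := W) (p := q) n0 (ltW rho0) Oo FC H' Uo) => //.
by move=> q' /= hq'; rewrite /exterior_graph /=; split=> [[]//|h]; split=> //; exact: ltW.
Qed.

(** The profile solves its equation on r > a with a < rho, hence beyond the edge, so u(|x|) - z and
    |x| - rho are smooth near the edge and cut out the surface and its side. *)
Lemma graph_edge q : W q -> enorm q.1 = rho -> boundary_point W q.
Proof.
move=> Wq hq; have q2 : q.2 = 0 by case: (Wq) => _ ->; rewrite hq.
pose U := [set q : V | a < enorm q.1].
have Uo : open U.
  by move/continuousP : (@enorm_fst_continuous R n) => /(_ _ (@open_gt R a)).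
have [_ uC] := smooth_profile a0 Oo FC H.
have Do : open [set r : R | a < r] by exact: open_gt.
have idC : smooth_on [set: R] (fun z : R => z) by move=> m; exact: Cdiff_ident.
have cC : smooth_on [set: R] (fun z : R => rho) by move=> m; exact: Cdiff_const.
have idC' : smooth_on [set r : R | a < r] (fun z : R => z) by move=> m; exact: Cdiff_ident.
have HU q' : U q' -> [/\ 0 < enorm q'.1, [set r : R | a < r] (enorm q'.1) & [set: R] q'.2].
  by move=> h; split=> //; exact: le_lt_trans h.
have Uq : U q by rewrite /U /= hq.
have q0 : 0 < enorm q.1 by rewrite hq.
exists (fun q => u (enorm q.1) - q.2), (fun q => enorm q.1 - rho), U.
have FD w : is_derive q w (fun q : V => u (enorm q.1) - q.2)
    (v rho * (dot q.1 w.1 / enorm q.1) - w.2).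
  apply: is_derive_sub; last exact: is_derive_snd.
  have [_ D _] := H arho; apply: (is_derive_comp (G := u) (f := fun q : V => enorm q.1)).
    by rewrite hq.
  by apply: is_derive_fst; exact: is_derive_enorm.
have GD w : is_derive q w (fun q : V => enorm q.1 - rho) (dot q.1 w.1 / enorm q.1 - 0).
  exact: is_derive_sub (is_derive_fst (is_derive_enorm w.1 q0)) (is_derive_const rho q w).
split.
- split=> // m.
    exact: (Cdiff_radial Do openT Uo (uC m) (idC m) HU).
  exact: (Cdiff_radial Do openT Uo (idC' m) (cC m) HU).
- move=> q' Uq'; rewrite /exterior_graph /= subr_ge0; split=> [[h1 ->]|[/eqP h1 h2]].
    by rewrite subrr.
  by split=> //; apply/esym/eqP; rewrite -subr_eq0.
- by rewrite hq u0 q2 !subrr.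
- exists (0, 1), (q.1, 0).
  have [_ ->] := FD (0, 1); have [_ ->] := FD (q.1, 0).
  have [_ ->] := GD (0, 1); have [_ ->] := GD (q.1, 0).
  rewrite /= dot0r -sqr_enorm hq mul0r mulr0 sub0r !subr0 mulr0 subr0.
  by rewrite mulf_neq0 ?oppr_eq0 ?oner_eq0 // gt_eqF // divr_gt0 // exprn_gt0.
Qed.

Lemma graph_boundary : boundary W = sphere_at rho 0.
Proof.
apply/seteqP; split=> q.
  move=> [Wq nI]; have [h1 h2] := Wq.
  move: h1; rewrite le_eqVlt => /predU1P[/esym h1|h1].
    by split=> //; rewrite h2 h1.
  exfalso; apply: nI; have [nu [c [_ _ pc]]] := graph_inner_point Wq h1.
  exact: principal_curvatures_interior pc.
move=> [h1 h2]; split; first by rewrite /exterior_graph /= h1 u0.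
have [_ D _] := H arho.
by apply: edge_not_interior; rewrite ?u0 //; exact: is_derive_cont D.
Qed.

Lemma graph_wing : wing_like f rho W.
Proof.
have [x0 x0E] := sphere_point n0 rho0.
have Wx0 : W (x0, 0) by rewrite /exterior_graph /= x0E u0.
split.
- split.
  + move=> q Wq; have [h1 h2] := Wq.
    move: h1; rewrite le_eqVlt => /predU1P[/esym h1|h1]; [right|left].
      exact: graph_edge.
    have [nu [c [_ _ pc]]] := graph_inner_point Wq h1.
    exact: principal_curvatures_interior pc.
  + exact: connected_graph.
  + by apply: complete_closed; exact: closed_graph.
  + exact: rotationally_symmetric_graph.
- by rewrite graph_boundary; exact: compact_sphere.
- apply: inf_snorm => //; first by move=> q [].
  by exists (x0, 0).
- move=> q Iq; have [Wq _] := Iq; have [h1 h2] := Wq.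
  move: h1; rewrite le_eqVlt => /predU1P[/esym h1|h1].
    (* [translator] constrains interior points only, and a point of the edge is not one. *)
    have [_ D _] := H arho; exfalso.
    apply: (edge_not_interior rho0 (is_derive_cont D) h1 _ Iq).
    by rewrite h2 h1.
  have [nu [c [c0 nuc pc]]] := graph_inner_point Wq h1.
  exact: speed_ode_point fF (Qv h1) c0 nuc pc.
- have [r [hr vr Fr]] := concave.
  have r0 : 0 < r by exact: lt_trans hr.
  have [x xE] := sphere_point n0 r0.
  have Wx : W (x, u r) by rewrite /exterior_graph /= xE; split=> //; exact: ltW.
  have [|nu [c [c0 nuc]]] := graph_inner_point Wx; first by rewrite xE.
  rewrite /= xE; apply: nonconvex_of_point => //.
    by rewrite pmulr_rlt0.
  by rewrite mulr_gt0 // divr_gt0.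
Qed.

Lemma graph_sphere_boundary : has_sphere_boundary_component W.
Proof.
have [x0 x0E] := sphere_point n0 rho0.
exists rho, 0, (x0, 0); rewrite graph_boundary; split=> //.
by apply: connected_component_id => //; exact: connected_sphere.
Qed.

Lemma graph_one_branch : one_branch rho W (fun x : rV => u (enorm x)).
Proof.
split=> //; have H' : profile_on rho F O u v by move=> r hr; apply: H; exact: lt_trans hr.
have [_ uC] := smooth_profile (ltW rho0) Oo FC H'.
exact: smooth_exterior (ltW rho0) _.
Qed.

End OneBranch.

End Wings.

(** * Existence of wings for an abstract field *)

Section Existence.
Variables (R : realType) (n : nat).
Local Notation V := (espace R n).

Lemma is_derive_flip (h : R -> R) (z c : R) : is_derive (- z) 1 h c ->
  is_derive z 1 (fun y => h (- y)) (- c).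
Proof.
move=> D; have := is_derive_comp D (is_derive_opp (is_derive_ident z)).
by move=> /is_derive_eq; apply; rewrite mulrN1.
Qed.

(* The lower branch is obtained from branch by the reflection z |-> - z, which
   turns F into q |-> - F (- q) and G into s |-> G (- s). *)
Lemma two_branch_existence (f : speed R n) (F G : R -> R) (O Q : set R)
    (s0 rho gam gm : R) :
  (1 < n)%N -> 0 < rho -> open O -> smooth_on O F -> speed_ode f F Q ->
  0 < s0 -> smooth_on (ball0 s0) G -> (forall s, ball0 s0 s -> 0 < G s) ->
  (forall s, ball0 s0 s -> s != 0 -> F s^-1 = - (s * G s)^-1) ->
  (forall q : R, gam < q -> Q q) -> (forall q : R, q < gm -> Q q) ->
  (forall q : R, gam <= q -> O q) -> (forall q : R, q <= gm -> O q) ->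
  gam * s0 <= 1 -> -1 <= gm * s0 ->
  (forall r : R, 0 < r -> gam <= (1 + (r * gam) ^+ 2) * F gam) ->
  (forall r : R, 0 < r -> (1 + (r * gm) ^+ 2) * F gm <= gm) ->
  (forall u1 v1 u2 v2, profile_on rho F O u1 v1 -> profile_on rho F O u2 v2 ->
     (forall r, rho < r -> gam < v1 r / r) -> (forall r, rho < r -> v2 r / r < gm) ->
     (exists2 r1, rho < r1 & forall r, rho < r < r1 -> v2 r < v1 r) ->
     forall r, rho < r -> v2 r < v1 r) ->
  speed_dom f (curvature_vec n (- (rho * G 0)^-1) rho^-1) /\
    f (curvature_vec n (- (rho * G 0)^-1) rho^-1) = 0 ->
  exists (W : set V) (u1 v1 u2 v2 : R -> R) (bet bm r0 : R),
  [/\ wing_like f rho W, boundary W = set0,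
    two_branches rho W (fun x => u1 (enorm x)) (fun x => u2 (enorm x)),
    profile_on rho F O u1 v1 /\ profile_on rho F O u2 v2 &
    [/\ forall r, rho < r -> gam < v1 r / r, forall r, r0 < r -> v1 r / r < bet,
        forall r, rho < r -> v2 r / r < gm & forall r, r0 < r -> bm < v2 r / r]].
Proof.
move=> n1 rho0 Oo FC fF s00 GC G0 FG Qp Qm Op Om gs gms Hgam Hgm Hord f_neck.
have [g [p [e [e0 g0 p0 gC neckD]]]] := neck_ode s00 rho0 GC G0.
have pD0 z : ball0 e z -> is_derive z 1 p ((1 + p z ^+ 2) / (g z * G (p z * g z))).
  by move=> /neckD[].
have pD'0 z : ball0 e z -> 0 < (1 + p z ^+ 2) / (g z * G (p z * g z)).
  move=> /neckD[h1 /G0 h2 _ _]; rewrite divr_gt0 ?mulr_gt0 //.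
  by rewrite ltr_pwDl // sqr_ge0.
(* Since p increases through p 0 = 0, it has the sign of z: g grows away from 0 on both sides. *)
have pinc x y : - e < x -> y < e -> x < y -> p x < p y.
  move=> h1 h2 xy; apply: (derive_gt0_lt xy) => z /andP[xz zy].
    by apply: pD0; apply/andP; split; lra.
  by apply: pD'0; apply/andP; split; lra.
have sub z : 0 <= z < e -> ball0 e z by move=> /andP[? ?]; apply/andP; split; lra.
have subN z : 0 <= z < e -> ball0 e (- z) by move=> /andP[? ?]; apply/andP; split; lra.
have np1 z : 0 <= z < e -> [/\ 0 < g z, p z * g z < s0, 0 < z -> 0 < p z,
    is_derive z 1 g (p z) & is_derive z 1 p ((1 + p z ^+ 2) / (g z * G (p z * g z)))].
  move=> zI; have [h1 /andP[_ h2] h3 h4] := neckD z (sub z zI); split=> // z0.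
  by rewrite -p0; apply: pinc => //; case/andP: zI => ? ?; lra.
have sB (s : R) : 0 < s < s0 -> ball0 s0 s by move=> /andP[? ?]; apply/andP; split; lra.
have sBN (s : R) : 0 < s < s0 -> ball0 s0 (- s) by move=> /andP[? ?]; apply/andP; split; lra.
have [u1 [v1 [d1 [r1 [bet [u10 u1c H1 [d10 d1e ug1 rr1] [gr1 vp1 vb1]]]]]]] :=
  branch (F := F) (G := G) (g := g) (p := p) Oo FC Op s00 gs Hgam
  (fun s h => G0 s (sB s h))
  (fun s h => FG s (sB s h) (lt0r_neq0 (proj1 (andP h)))) rho0 e0 g0 p0 np1.
pose F2 q := - F (- q); pose G2 s := G (- s).
pose O2 := [set q | O (- q)].
have O2o : open O2 by apply: open_comp => // x _; exact: oppr_continuous.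
have F2C : smooth_on O2 F2.
  move=> m; apply: Cdiff_opp => //.
  apply: (Cdiff_comp O2o Oo _ (FC m)) => //.
  by apply: Cdiff_opp => //; exact: Cdiff_ident.
have Op2 (q : R) : - gm <= q -> O2 q by move=> h; apply: Om; rewrite lerNl.
have gs2 : - gm * s0 <= 1 by rewrite mulNr lerNl.
have Hgam2 (r : R) : 0 < r -> - gm <= (1 + (r * - gm) ^+ 2) * F2 (- gm).
  move=> h; have -> : (1 + (r * - gm) ^+ 2) * F2 (- gm) = - ((1 + (r * gm) ^+ 2) * F gm).
    by rewrite /F2 opprK; ring.
  by rewrite lerN2 Hgm.
have FG2 (s : R) : 0 < s < s0 -> F2 s^-1 = - (s * G2 s)^-1.
  move=> sI; have /andP[h _] := sI.
  rewrite /F2 -[- s^-1]invrN FG ?oppr_eq0 ?lt0r_neq0 //; last exact: sBN.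
  by rewrite mulNr invrN opprK.
have np2 z : 0 <= z < e -> [/\ 0 < g (- z), - p (- z) * g (- z) < s0, 0 < z -> 0 < - p (- z),
    is_derive z 1 (fun z => g (- z)) (- p (- z)) &
    is_derive z 1 (fun z => - p (- z)) ((1 + (- p (- z)) ^+ 2) /
       (g (- z) * G2 (- p (- z) * g (- z))))].
  move=> zI; have [h1 /andP[h2 _] h3 h4] := neckD _ (subN z zI); split=> //.
  - by rewrite mulNr ltrNl.
  - move=> z0; rewrite oppr_gt0 -p0; by apply: pinc; clear - z0 zI; case/andP: zI => ? ?; lra.
  - exact: is_derive_flip.
  - have := is_derive_opp (is_derive_flip h4).
    by move=> /is_derive_eq; apply; rewrite opprK sqrrN /G2 mulNr opprK.
have g20 : g (- 0) = rho by rewrite oppr0.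
have p20 : - p (- 0) = 0 by rewrite !oppr0 p0 oppr0.
have [u2 [v2 [d2 [r2 [bm [u20 u2c H2 [d20 d2e ug2 rr2] [gr2 vp2 vb2]]]]]]] :=
  branch (F := F2) (G := G2) (g := fun z => g (- z)) (p := fun z => - p (- z))
  O2o F2C Op2 s00 gs2 Hgam2 (fun s h => G0 _ (sBN s h)) FG2 rho0 e0 g20 p20 np2.
pose w2 r := - u2 r; pose y2 r := - v2 r.
have P1 : profile_on rho F O u1 v1.
  by move=> r hr; have [h1 h2 h3] := H1 r hr; split=> //; apply: Op; exact: ltW.
have y2m r : rho < r -> y2 r / r < gm.
  by move=> hr; have [h1 _ _] := H2 r hr; rewrite /y2 mulNr ltrNl.
have P2 : profile_on rho F O w2 y2.
  move=> r hr; have [h1 h2 h3] := H2 r hr; split.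
  - by apply: Om; apply: ltW; exact: y2m.
  - exact: is_derive_opp.
  - have := is_derive_opp h3; move=> /is_derive_eq; apply.
    by rewrite /y2 /F2 sqrrN mulNr mulrN opprK.
have v1g r : rho < r -> gam < v1 r / r by move=> /H1[].
pose rm := Num.min r1 r2.
have rmr : rho < rm by rewrite lt_min rr1.
have rm1 : rm <= r1 by rewrite ge_min lexx.
have rm2 : rm <= r2 by rewrite ge_min lexx orbT.
have ord : forall r, rho < r -> y2 r < v1 r.
  apply: (Hord _ _ _ _ P1 P2 v1g y2m); exists rm => // r /andP[hr hr'].
  have := vp1 r; have := vp2 r; rewrite hr (lt_le_trans hr' rm1) (lt_le_trans hr' rm2).
  by move=> /(_ isT) a1 /(_ isT) a2; rewrite /y2; lra.
pose dm := Num.min d1 d2.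
have dm0 : 0 < dm by rewrite lt_min d10.
have dm1 : dm <= d1 by rewrite ge_min lexx.
have dm2 : dm <= d2 by rewrite ge_min lexx orbT.
(* Close to the neck both graphs together are exactly r = g z: heights z >= 0 come from the upper
   branch, z < 0 from the reflected one. *)
have neck r z : r < rm -> ball0 dm z ->
    (rho <= r /\ (z = u1 r \/ z = w2 r)) <-> r = g z.
  move=> hr /andP[z1 z2]; split=> [[hr' [zu|zu]]|->].
  - have [|z' z'I E] := gr1 r; first by rewrite hr' (lt_le_trans hr rm1).
    by have [uE _] := ug1 z' z'I; rewrite zu -E uE.
  - have [|z' z'I E] := gr2 r; first by rewrite hr' (lt_le_trans hr rm2).
    by have [uE _] := ug2 z' z'I; rewrite zu /w2 -E uE.
  - have [h|h] := leP 0 z.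
      have [|uE rg] := ug1 z; first by rewrite h (lt_le_trans z2 dm1).
      by split=> //; left; rewrite uE.
    have [|] := ug2 (- z); first by rewrite oppr_ge0 (ltW h) ltrNl (le_lt_trans _ z1) // lerN2.
    rewrite opprK => uE rg; split=> //; right; by rewrite /w2 uE opprK.
have kD : is_derive (0 : R) 1 p (rho * G 0)^-1.
  have := pD0 0; rewrite g0 p0 mul0r expr0n addr0 mul1r; apply.
  by rewrite /ball0 /= oppr_lt0 e0.
have k0 : 0 < (rho * G 0)^-1.
  by rewrite invr_gt0 mulr_gt0 // G0 // /ball0 /= oppr_lt0 s00.
have gD z : ball0 e z -> is_derive z 1 g (p z) by move=> /neckD[].
have w20 : w2 rho = 0 by rewrite /w2 u20 oppr0.
have w2c : continuous (fun r => w2 (Num.max rho r)).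
  by move=> r; apply: (@continuousN _ _ _ (fun r => u2 (Num.max rho r))); exact: u2c.
have Q1 r : rho < r -> Q (v1 r / r) by move=> /v1g; exact: Qp.
have Q2 r : rho < r -> Q (y2 r / r) by move=> /y2m; exact: Qm.
have dme := le_trans dm1 d1e.
exists (@double_graph R n rho u1 w2), u1, v1, w2, y2, bet, (- bm), (Num.max r1 r2); split.
- exact: (double_graph_wing n1 rho0 Oo FC fF u10 w20 u1c w2c P1 P2 Q1 Q2 ord dm0 dme rmr
    k0 gC p0 gD kD neck f_neck).
- exact: (double_graph_boundary n1 rho0 Oo FC u10 w20 u1c w2c P1 P2 Q1 Q2 ord dm0 dme rmr
    gC p0 gD kD neck f_neck).
- exact: (double_graph_branches n rho0 Oo FC u10 w20 u1c w2c P1 P2 ord).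
- by [].
- split=> // r; rewrite gt_max => /andP[h1 h2]; first by apply: vb1; exact: ltW.
  by rewrite /y2 mulNr ltrN2; apply: vb2; exact: ltW.
Qed.

(** The graph starts with v / r = q0 where F is negative, so the profile is concave near the edge
    while v is positive: this is the source of non-convexity. *)
Lemma one_branch_existence (f : speed R n) (F : R -> R) (O Q : set R)
    (rho gam q0 bet : R) :
  (1 < n)%N -> 0 < rho -> open O -> smooth_on O F -> speed_ode f F Q ->
  (forall q : R, gam < q -> Q q) -> (forall q : R, gam <= q <= bet -> O q) ->
  0 < gam -> gam < q0 < bet -> F q0 < 0 -> F bet < 0 ->
  (forall r : R, 0 < r -> gam <= (1 + (r * gam) ^+ 2) * F gam) ->
  exists (W : set V) (u v : R -> R),
  [/\ wing_like f rho W, has_sphere_boundary_component W,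
    one_branch rho W (fun x => u (enorm x)), profile_on rho F O u v &
    forall r, rho < r -> gam < v r / r < bet].
Proof.
move=> n1 rho0 Oo FC fF Qp Op gam0 qI Fq Fb Hgam.
have Hgam' r : rho <= r -> gam <= (1 + (r * gam) ^+ 2) * F gam.
  by move=> h; apply: Hgam; exact: lt_le_trans h.
have Hbet r : rho <= r -> (1 + (r * bet) ^+ 2) * F bet <= bet.
  move=> h; apply: (@le_trans _ _ 0); last by case/andP: qI => ? ?; lra.
  by rewrite pmulr_rle0 ?(ltW Fb) // ltr_pwDl // sqr_ge0.
have [v [d [d0 vc vr H]]] := graph_ode Oo FC Op rho0 qI Hgam' Hbet.
have [u u0 uD] := antiderivative_at rho 0 vc.
(* The solution extends to the left of rho by d; the maximum keeps the inner radius nonnegative. *)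
pose a := Num.max 0 (rho - d).
have a0 : 0 <= a by rewrite le_max lexx.
have arho : a < rho by rewrite gt_max rho0 /=; lra.
have P : profile_on a F O u v.
  move=> r; rewrite gt_max => /andP[r0 hr]; have [_ /andP[h1 h2] h3] := H r hr; split=> //.
  by apply: Op; rewrite !ltW.
have vI r : rho < r -> gam < v r / r < bet by move=> h; have [|] := H r; first lra.
have Qv r : rho < r -> Q (v r / r) by move=> /vI /andP[h _]; exact: Qp.
have concave : exists r, [/\ rho < r, 0 < v r & F (v r / r) < 0].
  have Fc : {for q0, continuous F}.
    apply: Cdiff_continuous (FC 0%N) _ _; apply: Op; by case/andP: qI => ? ?; rewrite !ltW.
  have qc : {for rho, continuous (fun r => v r / r)}.
    apply: continuousM; first exact: vc.
    by apply: continuousV; [rewrite gt_eqF|exact: cvg_id].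
  have qr : v rho / rho = q0 by rewrite vr mulrC mulKf // gt_eqF.
  have N : \forall r \near rho, F (v r / r) < 0.
    have Fc' : {for rho, continuous (fun r => F (v r / r))}.
      by apply: (@continuous_comp _ _ _ (fun r => v r / r) F) => //; rewrite qr.
    have h : F (v rho / rho) < 0 by rewrite qr.
    exact: (Fc' _ (lt_nbhsl h)).
  have /nbhs_ballP [t /= t0 Ht] := N.
  have t2 : 0 < t / 2 by rewrite divr_gt0.
  exists (rho + t / 2); have hr : rho < rho + t / 2 by lra.
  split=> //.
    have /andP[h _] := vI _ hr; have r0 : 0 < rho + t / 2 by lra.
    by rewrite -(pmulr_lgt0 _ (_ : 0 < (rho + t / 2)^-1)) ?invr_gt0 //; exact: lt_trans h.
  apply: Ht; rewrite -ball_normE /= opprD addrA subrr sub0r normrN gtr0_norm //; lra.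
exists (@exterior_graph R n rho (fun x => u (enorm x))), u, v; split.
- exact: (graph_wing n1 rho0 a0 arho Oo FC fF u0 P Qv concave).
- exact: (graph_sphere_boundary n1 rho0 arho Oo FC u0 P).
- exact: (graph_one_branch n rho0 arho Oo FC P).
- by move=> r hr; apply: P; exact: lt_trans hr.
- exact: vI.
Qed.

End Existence.

(** * Elementary symmetric functions of rotational curvatures *)

Section ElementarySymmetric.
Variables (R : realType) (n : nat).
Local Notation rV := 'rV[R]_n.

Lemma esym0 (l : rV) : Defs.esym 0 l = 1.
Proof.
rewrite /Defs.esym (big_pred1 finset.set0) ?big_set0 // => A /=.
by rewrite cards_eq0.
Qed.

(** The subsets of size k are split by whether they contain index 0. Those without it are counted
    directly, those with it by Pascal's rule. *)
Lemma esym_curvature_vec k (kap mu : R) : (0 < n)%N -> (0 < k)%N ->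
  Defs.esym k (curvature_vec n kap mu) =
  'C(n.-1, k)%:R * mu ^+ k + 'C(n.-1, k.-1)%:R * (kap * mu ^+ k.-1).
Proof.
case: k => [//|k] n0 _; pose i0 := Ordinal n0; rewrite /=.
have i0E (i : 'I_n) : ((i : nat) == 0%N) = (i == i0) by rewrite -val_eqE.
have cC : #|[set~ i0]%SET| = n.-1 by rewrite cardsC1 card_ord.
have cN : #|[set A : {set 'I_n} | (#|A| == k.+1) && (i0 \notin A)]%SET| = 'C(n.-1, k.+1).
  rewrite -cC -cards_draws; apply: eq_card => A; rewrite !inE andbC; congr (_ && _).
  apply/idP/idP => [iA|/fintype.subsetP h].
    apply/fintype.subsetP => x xA; rewrite !inE.
    by apply: contraNneq iA => <-.
  by apply/negP => /h; rewrite !inE eqxx.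
have cT : #|[set A : {set 'I_n} | #|A| == k.+1]%SET| = 'C(n, k.+1).
  by rewrite card_draws card_ord.
have cI : #|[set A : {set 'I_n} | (#|A| == k.+1) && (i0 \in A)]%SET| = 'C(n.-1, k).
  have : (#|[set A : {set 'I_n} | (#|A| == k.+1) && (i0 \in A)]%SET| +
      #|[set A : {set 'I_n} | (#|A| == k.+1) && (i0 \notin A)]%SET| = 'C(n, k.+1))%N.
    rewrite -cT -(cardsID [set A : {set 'I_n} | i0 \in A]%SET [set A : {set 'I_n} | #|A| == k.+1]%SET).
    by congr (_ + _)%N; apply: eq_card => A; rewrite !inE // andbC.
  have := binS n.-1 k; rewrite (prednK n0) cN addnC => -> /eqP.
  by rewrite eqn_add2r => /eqP.
rewrite /Defs.esym (bigID (fun A : {set 'I_n} => i0 \in A)) /= addrC; congr (_ + _).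
  rewrite (eq_bigr (fun=> mu ^+ k.+1)) => [|A /andP[/eqP cA iA]].
    rewrite sumr_const mulr_natl -cN; congr (_ *+ _); apply: eq_card => A.
    by rewrite !inE.
  rewrite (eq_bigr (fun=> mu)) => [|i iI]; first by rewrite prodr_const cA.
  by rewrite mxE i0E; case: eqP => // E; rewrite -E iI in iA.
rewrite (eq_bigr (fun=> kap * mu ^+ k)) => [|A /andP[/eqP cA iA]].
  rewrite sumr_const mulr_natl -cI; congr (_ *+ _); apply: eq_card => A.
  by rewrite !inE.
rewrite (big_setD1 i0) //= mxE i0E eqxx; congr (_ * _).
rewrite (eq_bigr (fun=> mu)) => [|i].
  by rewrite prodr_const; congr (_ ^+ _); have := cardsD1 i0 A; rewrite cA iA => -[].
by rewrite !inE mxE i0E => /andP[/negbTE ->].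
Qed.

Lemma zero_ones_curvature (t : R) :
  t *: @e_first R n + @zero_ones R n = curvature_vec n t 1.
Proof.
by apply/rowP => i; rewrite !mxE; case: eqP => _ /=; rewrite ?mulr1 ?mulr0 ?addr0 ?add0r.
Qed.

Lemma zero_onesE : @zero_ones R n = curvature_vec n 0 1.
Proof. by rewrite -zero_ones_curvature scale0r add0r. Qed.

Lemma derive_first (f : rV -> R) (d : R) :
  is_derive (0 : R) 1 (fun t : R => f (curvature_vec n t 1)) d ->
  'D_(@e_first R n) f (@zero_ones R n) = d.
Proof.
have -> : (fun t : R => f (curvature_vec n t 1)) =
    (fun t : R => f (t *: @e_first R n + @zero_ones R n)).
  by apply/funext => t; rewrite zero_ones_curvature.
by move=> H; have [_ ->] := (is_derive_line f (zero_ones R n) (e_first R n) d).2 H.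
Qed.

End ElementarySymmetric.

(** * The field of the k-th root of S_k *)

Section RootSpeed.
Variables (R : realType) (n k : nat) (hk : (1 <= k <= n.-1)%N).

Let a : R := 'C(n.-1, k)%:R.
Let b : R := 'C(n.-1, k.-1)%:R.

Let k0 : (0 < k)%N. Proof. by case/andP: hk. Qed.
Let n0 : (0 < n)%N. Proof. by case/andP: hk; case: n => //; rewrite /= leqn0 => /lt0n_neq0; case: eqP. Qed.

Let exprE (x : R) : x ^+ k = x * x ^+ k.-1.
Proof. by rewrite -exprS prednK. Qed.

Lemma choose_ge1 : 1 <= a /\ 1 <= b.
Proof.
rewrite /a /b !ler1n !bin_gt0; case/andP: hk => _ h; split=> //.
exact: leq_trans (leq_pred k) h.
Qed.

(** The solution F of S_k(F, q, ..., q) = a q^k + b F q^(k-1) = 1; by homogeneity the speed then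
    takes the value c at c (F, q, ..., q). *)
Definition root_field (q : R) : R := (1 - a * q ^+ k) / (b * q ^+ k.-1).

(** Read off from F(1 / s) = - (a - s^k) / (b s), which shows that the neck equation is regular at s
    = 0. *)
Definition root_neck (s : R) : R := b / (a - s ^+ k).

Let a0 : 0 < a. Proof. by have [h _] := choose_ge1; exact: lt_le_trans h. Qed.
Let b0 : 0 < b. Proof. by have [_ h] := choose_ge1; exact: lt_le_trans h. Qed.

Lemma root_speed_ode : speed_ode (root_speed R n k) root_field [set q | q != 0 \/ k = 1%N].
Proof.
move=> q c Qq c0.
have qk : q ^+ k.-1 != 0.
  by case: Qq => [q0|->]; rewrite ?expr0 ?oner_neq0 // expf_neq0.
have E : Defs.esym k (curvature_vec n (c * root_field q) (c * q)) = c ^+ k.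
  rewrite esym_curvature_vec // -/a -/b /root_field.
  by rewrite !exprMn !exprE; field; rewrite qk gt_eqF.
split; first by rewrite /= E exprn_ge0 // ltW.
rewrite /= E -powR_mulrn ?(ltW c0) // -powRrM mulfV ?pnatr_eq0 -?lt0n //.
by rewrite powRr1 // ltW.
Qed.

Lemma root_speed_neck (rho : R) : 0 < rho ->
  let l := curvature_vec n (- (rho * root_neck 0)^-1) rho^-1 in
  speed_dom (root_speed R n k) l /\ root_speed R n k l = 0.
Proof.
move=> rho0 l; have E : Defs.esym k l = 0.
  rewrite esym_curvature_vec // -/a -/b /root_neck expr0n.
  by rewrite (gtn_eqF k0) subr0 exprE; field; rewrite !lt0r_neq0.
by rewrite /= E lexx powR0 // invr_eq0 pnatr_eq0 -lt0n.
Qed.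

Lemma root_speed_zero_ones : root_speed R n k (zero_ones R n) = a `^ (k%:R^-1).
Proof.
rewrite /= zero_onesE esym_curvature_vec // !expr1n mul0r mulr0 addr0 mulr1 //.
Qed.

Lemma root_speed_derive :
  'D_(e_first R n) (root_speed R n k) (zero_ones R n) = k%:R^-1 * a `^ (k%:R^-1 - 1) * b.
Proof.
apply: derive_first.
have -> : (fun t : R => root_speed R n k (curvature_vec n t 1)) =
    (fun t => (a + b * t) `^ (k%:R^-1)).
  by apply/funext => t; rewrite /= esym_curvature_vec // !expr1n !mulr1.
have D : is_derive (0 : R) 1 (fun t : R => a + b * t) b.
  have := is_derive_add (is_derive_const a (0 : R) 1) (is_derive_mull b (is_derive_ident 0)).
  by move=> /is_derive_eq; apply; rewrite add0r mulr1.
have E : a + b * 0 = a by rewrite mulr0 addr0.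
have P : is_derive (a + b * 0) 1 (fun x : R => x `^ (k%:R^-1)) (k%:R^-1 * a `^ (k%:R^-1 - 1)).
  rewrite E; exact: is_derive1_powR.
exact: (is_derive_comp (G := fun x : R => x `^ (k%:R^-1)) (f := fun t : R => a + b * t) P D).
Qed.

(** The set where q^(k-1) is nonzero: for k = 1 the exponent is 0 and the field is affine on the
    whole line. *)
Definition root_domain : set R := [set q | q != 0 \/ k = 1%N].

Lemma open_root_domain : open root_domain.
Proof.
have [k1|k1] := eqVneq k 1%N.
  by have -> : root_domain = setT; [apply/seteqP; split=> q // _; right|exact: openT].
have -> : root_domain = [set q : R | q != 0]; last exact: open_neq.
by apply/seteqP; split=> q; [case=> // /eqP; rewrite (negbTE k1)|left].
Qed.

Let qk0 q : root_domain q -> q ^+ k.-1 != 0.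
Proof. by case=> [q0|->]; rewrite ?expr0 ?oner_neq0 // expf_neq0. Qed.

Lemma smooth_root_field : smooth_on root_domain root_field.
Proof.
move=> m; have Do := open_root_domain; have IC := @Cdiff_ident R m root_domain.
have XC j : Cdiff m root_domain (fun q : R => q ^+ j) by exact: Cdiff_exp.
apply: Cdiff_div => //.
- by move=> q /qk0 h; rewrite mulf_neq0 // gt_eqF.
- by apply: Cdiff_sub => //; [exact: Cdiff_const|exact: Cdiff_mull].
- exact: Cdiff_mull.
Qed.

Lemma is_derive_root_field (q : R) : 0 < q ->
  is_derive q 1 root_field (- ((k.-1)%:R / q ^+ k + a) / b).
Proof.
move=> q0; have D := is_derive_ident q.
have N := is_derive_sub (is_derive_const (1 : R) q 1) (is_derive_mull a (is_derive_exp k D)).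
have M := is_derive_mull b (is_derive_exp k.-1 D).
have h : b * q ^+ k.-1 != 0 by rewrite mulf_neq0 ?expf_neq0 // gt_eqF.
have := is_derive_mul N (is_derive_inv (f := fun y : R => b * y ^+ k.-1) h M).
move=> /is_derive_eq; apply; rewrite !exprE.
have kE : k%:R = (k.-1)%:R + 1 :> R by rewrite natr1 prednK.
rewrite kE; case: (k.-1) => [|j] /=.
  by rewrite !expr0; field; rewrite !gt_eqF.
by rewrite !exprS; field; rewrite ?expf_neq0 ?gt_eqF.
Qed.

Lemma derive_root_field_le (q : R) : 0 < q -> 'D_1 root_field q <= - (a / b).
Proof.
move=> q0; have [_ ->] := is_derive_root_field q0.
by rewrite mulNr lerN2 ler_pM2r ?invr_gt0 // lerDr divr_ge0 // exprn_ge0 // ltW.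
Qed.

(** The root of a q + b q = 1. Because gam <= 1, its powers are at most gam or 1, and replacing them
    in the field shows F(gam) >= gam. *)
Let gam : R := (a + b)^-1.

Let gam0 : 0 < gam. Proof. by rewrite invr_gt0 addr_gt0. Qed.

Let gam1 : gam <= 1.
Proof. by have [h1 h2] := choose_ge1; rewrite invf_le1 ?addr_gt0 //; lra. Qed.

Let gamk : a * gam ^+ k <= a * gam.
Proof. by rewrite ler_pM2l // exprE ler_piMr ?exprn_ile1 // ltW. Qed.

Let agam : a * gam = 1 - b * gam.
Proof. by rewrite /gam; field; rewrite gt_eqF // addr_gt0. Qed.

Lemma root_field_barrier : gam <= root_field gam.
Proof.
rewrite /root_field ler_pdivlMr ?mulr_gt0 ?exprn_gt0 //.
apply: (@le_trans _ _ (gam * b)).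
  by rewrite ler_pM2l // ler_piMr ?exprn_ile1 // ltW.
by have := gamk; rewrite agam mulrC; lra.
Qed.

Definition root_slope : R := (a `^ (k%:R^-1))^-1.

Lemma root_slope_gt0 : 0 < root_slope.
Proof. by rewrite invr_gt0 powR_gt0. Qed.

Lemma root_slopeX : a * root_slope ^+ k = 1.
Proof.
rewrite /root_slope exprVn -powR_mulrn ?powR_ge0 // -powRrM mulVf ?pnatr_eq0 -?lt0n //.
by rewrite powRr1 ?divff // ?gt_eqF // ltW.
Qed.

Lemma root_field_slope : root_field root_slope = 0.
Proof. by rewrite /root_field root_slopeX subrr mul0r. Qed.

Lemma root_barrier_le_slope : gam <= root_slope.
Proof.
rewrite leNgt; apply/negP => h.
have : a * root_slope ^+ k <= a * gam ^+ k.
  by rewrite ler_pM2l // lerXn2r ?nnegrE ?(ltW h) // ltW // root_slope_gt0.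
by rewrite root_slopeX => ?; have := gamk; have := mulr_gt0 b0 gam0; rewrite agam; lra.
Qed.

Lemma root_field_neg q : root_slope < q -> root_field q < 0.
Proof.
move=> h; have q0 : 0 < q := lt_trans root_slope_gt0 h.
rewrite /root_field pmulr_llt0 ?invr_gt0 ?mulr_gt0 ?exprn_gt0 // subr_lt0 -root_slopeX.
by rewrite ltr_pM2l // ltrXn2r -?lt0n // ?nnegrE ltW // root_slope_gt0.
Qed.

(** Identifies the two coefficients of [asym_expansion] with those of [wing_profile]. *)
Lemma root_profile_coefficients : root_slope / 2 = (2 * root_speed R n k (zero_ones R n))^-1 /\
  (root_slope * 'D_1 root_field root_slope)^-1 =
  - 'D_(e_first R n) (root_speed R n k) (zero_ones R n).
Proof.
have P0 : 0 < a `^ (k%:R^-1) by exact: powR_gt0.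
split; first by rewrite root_speed_zero_ones /root_slope; field; rewrite gt_eqF.
have [_ ->] := is_derive_root_field root_slope_gt0.
have kn : k%:R != 0 :> R by rewrite pnatr_eq0 -lt0n.
have ak : root_slope ^+ k = a^-1.
  by apply: (mulfI (lt0r_neq0 a0)); rewrite root_slopeX divff // gt_eqF.
have kE : k%:R = (k.-1)%:R + 1 :> R by rewrite natr1 prednK.
rewrite root_speed_derive ak powRB; last by apply/implyP => _; rewrite gt_eqF.
rewrite powRr1 ?(ltW a0) // /root_slope kE.
have kp : (k.-1)%:R + 1 != 0 :> R by rewrite -kE.
field; rewrite kp !gt_eqF //=.
  by rewrite -/a ltr_wpDl // mulr_ge0 // ltW.
by rewrite powR_gt0.
Qed.

Lemma root_field_odd q : ~~ odd k -> root_field (- q) = - root_field q.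
Proof.
move=> ek; rewrite /root_field; have E : (- q) ^+ k = q ^+ k.
  by rewrite exprNn -signr_odd (negbTE ek) expr0 mul1r.
have E1 : (- q) ^+ k.-1 = - q ^+ k.-1.
  rewrite exprNn -signr_odd; have -> : odd k.-1 by move: ek; rewrite -{1}(prednK k0) /= negbK.
  by rewrite expr1 mulN1r.
by rewrite E E1 mulrN invrN mulrN.
Qed.

(** For |s| < 1/2 one has |s^k| <= |s| < 1 <= a, so the radius 1/2 serves for all n and k. *)
Let small_pow s : ball0 2^-1 s -> 0 < a - s ^+ k.
Proof.
move=> /andP[s1 s2]; have [h _] := choose_ge1; rewrite subr_gt0.
have sn : `|s| < 2^-1 by rewrite ltr_norml s1.
apply: le_lt_trans (ler_norm _) _; rewrite normrX exprE.
apply: (@le_lt_trans _ _ (`|s| * 1)); last by lra.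
by rewrite ler_wpM2l // exprn_ile1 //; lra.
Qed.

Lemma smooth_root_neck : smooth_on (ball0 2^-1) root_neck.
Proof.
move=> m; have Bo := @open_ball0 R 2^-1; have IC := @Cdiff_ident R m (ball0 2^-1).
apply: Cdiff_div => //; first by move=> s /small_pow; rewrite lt0r => /andP[].
  exact: Cdiff_const.
by apply: Cdiff_sub => //; [exact: Cdiff_const|exact: Cdiff_exp].
Qed.

Lemma root_neck_gt0 s : ball0 2^-1 s -> 0 < root_neck s.
Proof. by move=> /small_pow h; rewrite divr_gt0. Qed.

Lemma root_field_inv s : ball0 2^-1 s -> s != 0 ->
  root_field s^-1 = - (s * root_neck s)^-1.
Proof.
move=> /small_pow h s0; rewrite /root_field /root_neck !exprVn exprE in h *.
by field; rewrite s0 expf_neq0 // !gt_eqF.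
Qed.

End RootSpeed.

(** * The field of S_k / S_(k-1) for k > 1 *)

Section QuotientSpeed.
Variables (R : realType) (n k : nat) (hk : (1 <= k <= n.-1)%N) (k1 : (1 < k)%N).

Let a : R := 'C(n.-1, k)%:R.
Let b : R := 'C(n.-1, k.-1)%:R.
Let c : R := 'C(n.-1, k.-2)%:R.

Let k0 : (0 < k)%N. Proof. by case/andP: hk. Qed.
Let n0 : (0 < n)%N. Proof. by case/andP: hk; case: n => //; rewrite /= leqn0 => /lt0n_neq0; case: eqP. Qed.
Let a0 : 0 < a. Proof. by have [h _] := choose_ge1 R hk; exact: lt_le_trans h. Qed.
Let b0 : 0 < b. Proof. by have [_ h] := choose_ge1 R hk; exact: lt_le_trans h. Qed.

Let c0 : 0 < c.
Proof.
rewrite ltr0n bin_gt0; case/andP: hk => _; apply: leq_trans.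
exact: leq_trans (leq_pred _) (leq_pred _).
Qed.

(** The ratio (N - j) / (j + 1) of consecutive binomial coefficients strictly decreases in j;
    denominators are cleared by the factor (j + 2) (N - j). *)
Lemma choose_log_concave : a * c < b * b.
Proof.
rewrite /a /b /c -!natrM ltr_nat; case/andP: hk => _.
case: k k1 => [//|[//|j]] _ /=; set N := n.-1 => hj.
have A := mul_bin_left N j.+1; have C := mul_bin_left N j.
have B0 : (0 < 'C(N, j.+1))%N by rewrite bin_gt0 ltnW.
have jN : (0 < N - j)%N by rewrite subn_gt0 ltnW.
rewrite -(@ltn_pmul2l (j.+2 * (N - j))) ?muln_gt0 //.
have -> : (j.+2 * (N - j) * ('C(N, j.+2) * 'C(N, j)) =
   (j.+2 * 'C(N, j.+2)) * ((N - j) * 'C(N, j)))%N by rewrite mulnACA.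
rewrite A -C.
have -> : ((N - j.+1) * 'C(N, j.+1) * (j.+1 * 'C(N, j.+1)) =
   (N - j.+1) * j.+1 * ('C(N, j.+1) * 'C(N, j.+1)))%N by rewrite mulnACA.
rewrite ltn_pmul2r ?muln_gt0 ?B0 // mulnC.
apply: (@leq_ltn_trans (j.+1 * (N - j))); first by rewrite leq_mul2l leq_sub2l ?orbT.
by rewrite ltn_pmul2r.
Qed.

Let delta0 : 0 < b * b - a * c. Proof. by rewrite subr_gt0 choose_log_concave. Qed.

(** The solution F of q (a q + b F) = b q + c F, which is S_k = S_(k-1) at (F, q, ..., q) after
    division by q^(k-2). *)
Definition quotient_field (q : R) : R := q * (b - a * q) / (b * q - c).

Definition quotient_neck (s : R) : R := (b - c * s) / (a - b * s).

Definition quotient_domain : set R := [set q | b * q - c != 0].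

Let exprE (x : R) : x ^+ k = x * (x * x ^+ k.-2).
Proof. by rewrite -!exprS; case: k k1 => [//|[]]. Qed.

Let exprE1 (x : R) : x ^+ k.-1 = x * x ^+ k.-2.
Proof. by rewrite -!exprS; case: k k1 => [//|[]]. Qed.

Let esymk kap mu : Defs.esym k (curvature_vec n kap mu) =
  mu * mu ^+ k.-2 * (a * mu + b * kap).
Proof. by rewrite esym_curvature_vec // -/a -/b exprE exprE1; ring. Qed.

Let esymk1 kap mu : Defs.esym k.-1 (curvature_vec n kap mu) =
  mu ^+ k.-2 * (b * mu + c * kap).
Proof.
rewrite esym_curvature_vec //; last by case: k k1 => [//|[]].
by rewrite -/b -/c exprE1; ring.
Qed.

(** At (F, q, ..., q) the denominator S_(k-1) equals q^k (b^2 - a c) / (b q - c): it is nonzero by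
    strict log-concavity and q != 0. *)
Lemma quotient_speed_ode : speed_ode (quotient_speed R n k) quotient_field
  [set q | q != 0 /\ b * q - c != 0].
Proof.
move=> q s [q0 qc] s0; have s00 : s != 0 by rewrite gt_eqF.
have d0 : b * b - a * c != 0 by rewrite gt_eqF.
have E1 : Defs.esym k.-1 (curvature_vec n (s * quotient_field q) (s * q)) =
    (s * q) ^+ k.-2 * (s * (q ^+ 2 * (b * b - a * c) / (b * q - c))).
  by rewrite esymk1 /quotient_field; field.
have E : Defs.esym k (curvature_vec n (s * quotient_field q) (s * q)) =
    s * ((s * q) ^+ k.-2 * (s * (q ^+ 2 * (b * b - a * c) / (b * q - c)))).
  by rewrite esymk /quotient_field; field.
have E0 : (s * q) ^+ k.-2 * (s * (q ^+ 2 * (b * b - a * c) / (b * q - c))) != 0.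
  by rewrite !mulf_neq0 ?invr_eq0 ?expf_neq0 // mulf_neq0.
by split; rewrite /= E1 ?E // mulfK.
Qed.

Lemma quotient_speed_neck (rho : R) : 0 < rho ->
  let l := curvature_vec n (- (rho * quotient_neck 0)^-1) rho^-1 in
  speed_dom (quotient_speed R n k) l /\ quotient_speed R n k l = 0.
Proof.
move=> rho0 l; have r0 : rho != 0 by rewrite gt_eqF.
have b00 : b != 0 by rewrite gt_eqF. have a00 : a != 0 by rewrite gt_eqF.
have E : Defs.esym k l = 0.
  by rewrite esymk /quotient_neck !mulr0 !subr0; field; rewrite r0 b00 a00.
have E1 : Defs.esym k.-1 l = rho^-1 ^+ k.-2 * ((b * b - a * c) / (rho * b)).
  by rewrite esymk1 /quotient_neck !mulr0 !subr0; field; rewrite ?expf_neq0 // r0 b00 ?a00.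
split; last by rewrite /= E mul0r.
rewrite /= E1 !mulf_neq0 ?invr_eq0 ?mulf_neq0 ?expf_neq0 ?invr_eq0 //.
by rewrite gt_eqF.
Qed.

Let speed_t t : quotient_speed R n k (curvature_vec n t 1) = (a + b * t) / (b + c * t).
Proof. by rewrite /= esymk esymk1 expr1n !mulr1 !mul1r. Qed.

Lemma quotient_speed_zero_ones : quotient_speed R n k (zero_ones R n) = a / b.
Proof. by rewrite zero_onesE speed_t !mulr0 !addr0. Qed.

Lemma quotient_speed_derive :
  'D_(e_first R n) (quotient_speed R n k) (zero_ones R n) = (b * b - a * c) / (b * b).
Proof.
apply: derive_first.
have -> : (fun t : R => quotient_speed R n k (curvature_vec n t 1)) =
    (fun t => (a + b * t) / (b + c * t)) by apply/funext => t; exact: speed_t.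
have D (x y : R) : is_derive (0 : R) 1 (fun t : R => x + y * t) y.
  have := is_derive_add (is_derive_const x (0 : R) 1) (is_derive_mull y (is_derive_ident 0)).
  by move=> /is_derive_eq; apply; rewrite add0r mulr1.
have h : b + c * 0 != 0 by rewrite mulr0 addr0 gt_eqF.
have := is_derive_mul (D a b) (is_derive_inv (f := fun t : R => b + c * t) h (D b c)).
by move=> /is_derive_eq; apply; rewrite !mulr0 !addr0; field; rewrite gt_eqF.
Qed.

Lemma open_quotient_domain : open quotient_domain.
Proof.
have C := @Cdiff_sub _ _ 0 setT (fun q : R => b * q) (fun=> c) openT
  (Cdiff_mull b openT (@Cdiff_ident R 0 setT)) (Cdiff_const 0 setT c).
have fc : continuous (fun q : R => b * q - c) by move=> q; exact: (Cdiff_continuous C I).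
by move/continuousP : fc => /(_ _ (@open_neq R 0)).
Qed.

Lemma smooth_quotient_field : smooth_on quotient_domain quotient_field.
Proof.
move=> m; have Do := open_quotient_domain; have IC := @Cdiff_ident R m quotient_domain.
apply: Cdiff_div => //.
- apply: Cdiff_mul => //; apply: Cdiff_sub => //; [exact: Cdiff_const|exact: Cdiff_mull].
- by apply: Cdiff_sub => //; [exact: Cdiff_mull|exact: Cdiff_const].
Qed.

Lemma is_derive_quotient_field (q : R) : b * q - c != 0 ->
  is_derive q 1 quotient_field
    (- (a / b + c * (b * b - a * c) / (b * (b * q - c) ^+ 2))).
Proof.
move=> h; have D := is_derive_ident q; have b00 : b != 0 by rewrite gt_eqF.
have N := is_derive_mul D (is_derive_sub (is_derive_const b q 1) (is_derive_mull a D)).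
have M := is_derive_sub (is_derive_mull b D) (is_derive_const c q 1).
have := is_derive_mul N (is_derive_inv (f := fun q : R => b * q - c) h M).
by move=> /is_derive_eq; apply; field; rewrite h b00.
Qed.

Lemma derive_quotient_field_le (q : R) : b * q - c != 0 ->
  'D_1 quotient_field q <= - (a / b).
Proof.
move=> h; have [_ ->] := is_derive_quotient_field h.
by rewrite lerN2 lerDl divr_ge0 // mulr_ge0 ?sqr_ge0 // ltW.
Qed.

(** The nonzero fixed point of the field: F(q) = q reduces to b - a q = b q - c. Log-concavity
    places it between the pole c / b and the zero b / a. *)
Definition quotient_barrier : R := (b + c) / (a + b).

Lemma quotient_barrier_gt : c < b * quotient_barrier.
Proof.
rewrite mulrA ltr_pdivlMr ?addr_gt0 //.
by have := choose_log_concave; lra.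
Qed.

Lemma quotient_barrier_gt0 : 0 < quotient_barrier.
Proof. by rewrite divr_gt0 ?addr_gt0. Qed.

Lemma quotient_domain_ge (q : R) : quotient_barrier <= q -> 0 < b * q - c.
Proof.
move=> h; rewrite subr_gt0; apply: lt_le_trans quotient_barrier_gt _.
by rewrite ler_pM2l.
Qed.

Lemma quotient_field_barrier : quotient_field quotient_barrier = quotient_barrier.
Proof.
have h := quotient_domain_ge (lexx _); rewrite /quotient_field.
have -> : b - a * quotient_barrier = b * quotient_barrier - c.
  by rewrite /quotient_barrier; field; rewrite gt_eqF // addr_gt0.
by rewrite mulfK // gt_eqF.
Qed.

Lemma quotient_barrier_le : quotient_barrier <= b / a.
Proof.
rewrite ler_pdivrMr ?addr_gt0 // mulrC mulrA ler_pdivlMr //.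
by have := choose_log_concave; lra.
Qed.

Lemma quotient_field_slope : quotient_field (b / a) = 0.
Proof. by rewrite /quotient_field mulrCA divff ?gt_eqF // mulr1 subrr mulr0 mul0r. Qed.

Lemma quotient_profile_coefficients :
  (b / a) / 2 = (2 * quotient_speed R n k (zero_ones R n))^-1 /\
  ((b / a) * 'D_1 quotient_field (b / a))^-1 =
  - 'D_(e_first R n) (quotient_speed R n k) (zero_ones R n).
Proof.
have b00 : b != 0 by rewrite gt_eqF.
have a00 : a != 0 by rewrite gt_eqF.
have d0 : b * b - a * c != 0 by rewrite gt_eqF.
split; first by rewrite quotient_speed_zero_ones; field; rewrite a00 b00.
have h : b * (b / a) - c = (b * b - a * c) / a by field.
have h0 : b * (b / a) - c != 0 by rewrite h mulf_neq0 // invr_eq0.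
have [_ ->] := is_derive_quotient_field h0; rewrite quotient_speed_derive h.
have E : a / b + c * (b * b - a * c) / (b * ((b * b - a * c) / a) ^+ 2) =
   a * b / (b * b - a * c) by field; rewrite d0 a00 b00.
by rewrite E; field; rewrite ?mulf_neq0 // d0 a00 b00.
Qed.

(** The radius a / b is where a - b s vanishes; log-concavity puts the zero b / c of the numerator
    further out. *)
Let neck_pos s : ball0 (a / b) s -> 0 < b - c * s /\ 0 < a - b * s.
Proof.
move=> /andP[s1 s2]; have h : 0 < a - b * s by rewrite subr_gt0 mulrC -ltr_pdivlMr.
split=> //; rewrite -(pmulr_rgt0 _ b0) mulrBr subr_gt0.
have -> : b * (c * s) = c * (b * s) by ring.
apply: (@lt_trans _ _ (c * a)); first by rewrite ltr_pM2l // -subr_gt0.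
by rewrite mulrC choose_log_concave.
Qed.

Lemma smooth_quotient_neck : smooth_on (ball0 (a / b)) quotient_neck.
Proof.
move=> m; have Bo := @open_ball0 R (a / b); have IC := @Cdiff_ident R m (ball0 (a / b)).
apply: Cdiff_div => //; first by move=> s /neck_pos [_ h]; rewrite gt_eqF.
- by apply: Cdiff_sub => //; [exact: Cdiff_const|exact: Cdiff_mull].
- by apply: Cdiff_sub => //; [exact: Cdiff_const|exact: Cdiff_mull].
Qed.

Lemma quotient_neck_gt0 s : ball0 (a / b) s -> 0 < quotient_neck s.
Proof. by move=> /neck_pos [h1 h2]; rewrite divr_gt0. Qed.

Lemma quotient_field_inv s : ball0 (a / b) s -> s != 0 ->
  quotient_field s^-1 = - (s * quotient_neck s)^-1.
Proof.
move=> /neck_pos [h1 h2] s0; rewrite /quotient_field /quotient_neck.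
have h3 : b * s^-1 - c != 0.
  have -> : b * s^-1 - c = (b - c * s) / s by field.
  by rewrite mulf_neq0 ?invr_eq0 // gt_eqF.
by field; rewrite s0 !gt_eqF.
Qed.

End QuotientSpeed.

(** * The quotient speed for k = 1 *)

Section MeanCurvature.
Variables (R : realType) (n : nat) (hn : (1 <= 1 <= n.-1)%N).

Let n0 : (0 < n)%N. Proof. by case/andP: hn; case: n. Qed.

(** For k = 1 the truncated index [k.-2] would make c equal to 1 instead of 0, so this case borrows
    the field of the root speed. As S_0 = 1, every q is admissible and a branch may cross q = 0. *)
Lemma mean_curvature_ode : speed_ode (quotient_speed R n 1) (@root_field R n 1) setT.
Proof.
move=> q c _ c0; split; first by rewrite /= esym0 oner_neq0.
rewrite /= esym0 invr1 mulr1 esym_curvature_vec // /root_field /= !expr1 !expr0 bin0.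
by field.
Qed.

Lemma mean_curvature_neck (rho : R) : 0 < rho ->
  let l := curvature_vec n (- (rho * @root_neck R n 1 0)^-1) rho^-1 in
  speed_dom (quotient_speed R n 1) l /\ quotient_speed R n 1 l = 0.
Proof.
move=> rho0 l; have [_ _] := root_speed_neck hn rho0; split.
  by rewrite /= esym0 oner_neq0.
have [h _] := choose_ge1 R hn.
rewrite /= esym0 invr1 mulr1 esym_curvature_vec // /root_neck /= !expr1 !expr0 bin0 subr0.
by field; rewrite !lt0r_neq0 // (lt_le_trans ltr01 h).
Qed.

Lemma mean_curvature_zero_ones :
  quotient_speed R n 1 (zero_ones R n) = root_speed R n 1 (zero_ones R n).
Proof.
rewrite root_speed_zero_ones // invr1 powRr1 //.
by rewrite /= zero_onesE esym0 invr1 mulr1 esym_curvature_vec // !mul0r mulr0 addr0 expr1 mulr1.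
Qed.

Lemma mean_curvature_derive :
  'D_(e_first R n) (quotient_speed R n 1) (zero_ones R n) =
  'D_(e_first R n) (root_speed R n 1) (zero_ones R n).
Proof.
rewrite root_speed_derive // invr1 subrr powRr0 !mul1r bin0; apply: derive_first.
have -> : (fun t : R => quotient_speed R n 1 (curvature_vec n t 1)) =
    (fun t => 'C(n.-1, 1)%:R + t).
  apply/funext => t; rewrite /= esym0 invr1 mulr1 esym_curvature_vec //.
  by rewrite bin0 expr1 expr0 !mulr1 mul1r.
have := is_derive_add (is_derive_const ('C(n.-1, 1)%:R : R) (0 : R) 1) (is_derive_ident 0).
by rewrite add0r.
Qed.

End MeanCurvature.

(** * Behaviour of the ends *)

Section Ends.
Variables (R : realType) (n : nat).

Lemma profile_expansion (f : speed R n) (F u v : R -> R) (O : set R)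
    (rho gam bet alp lam r0 : R) :
  open O -> smooth_on O F -> (forall q : R, gam <= q -> O q) -> 0 < gam ->
  gam <= alp -> F alp = 0 -> 0 < lam ->
  (forall q : R, gam <= q -> 'D_1 F q <= - lam) ->
  profile_on rho F O u v ->
  (forall r, rho < r -> gam < v r / r) -> (forall r, r0 < r -> v r / r < bet) ->
  alp / 2 = (2 * f (zero_ones R n))^-1 ->
  (alp * 'D_1 F alp)^-1 = - 'D_(e_first R n) f (zero_ones R n) ->
  exists (C : R) (h : R -> R), (forall m, decl m h) /\
    forall x : 'rV[R]_n, h (enorm x) = u (enorm x) - (wing_profile f x + C).
Proof.
move=> Oo FC Og gam0 ga Fa lam0 FD P vg vb E1 E2.
(* The upper bound bet comes from the pasting and need not exceed alp; the maximum puts alp inside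
   the interval. *)
have [|||||C HC] := @asym_expansion R F u v O gam (Num.max bet alp) alp lam (Num.max rho r0)
  Oo FC _ gam0 _ Fa lam0.
- by move=> q /andP[h _]; exact: Og.
- by rewrite ga le_max lexx orbT.
- by move=> q /andP[h _]; exact: FD.
- move=> r; rewrite gt_max => /andP[r1 r2]; have [_ _ D] := P r r1; split=> //.
  by rewrite (ltW (vg r r1)) le_max (ltW (vb r r2)).
- by exists rho => r /P[].
exists C, (fun r => u r - (alp / 2 * r ^+ 2 + (alp * 'D_1 F alp)^-1 * ln r + C)).
by split=> // x; rewrite E1 E2 /wing_profile mulNr [_^-1 * _]mulrC.
Qed.

Lemma enorm_gradient_radial (u : R -> R) (d : R) (x : 'rV[R]_n) : 0 < enorm x ->
  is_derive (enorm x) 1 u d -> enorm (gradient (fun y => u (enorm y)) x) = `|d|.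
Proof.
move=> x0 D; have -> : gradient (fun y => u (enorm y)) x = (d / enorm x) *: x.
  apply/rowP => i; rewrite !mxE.
  have [_ ->] := is_derive_comp D (is_derive_enorm (delta_mx 0 i) x0).
  have -> : dot x (delta_mx 0 i) = x 0 i.
    rewrite /dot (bigD1 i) //= mxE !eqxx mulr1 big1 ?addr0 // => j /negbTE ji.
    by rewrite mxE ji andbF mulr0.
  by rewrite mulrA mulrAC.
by rewrite enormZ normrM normfV (gtr0_norm x0) divfK // gt_eqF.
Qed.

(* r |-> - v r * r^lam is nonincreasing. *)
Lemma power_decay (v v' : R -> R) (rho lam e : R) : 0 < rho -> 0 < lam -> 0 < e ->
  (forall r : R, rho < r -> is_derive r 1 v (v' r)) -> (forall r, rho < r -> v r < 0) ->
  (forall r, rho < r -> lam * (- v r / r) <= v' r) ->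
  exists2 A, rho < A & forall r : R, A <= r -> `|v r| <= e.
Proof.
move=> rho0 lam0 e0 vD v0 vl.
pose g (r : R) := expR (lam * ln r).
have gD (r : R) : 0 < r -> is_derive r 1 g (g r * (lam * r^-1)).
  move=> r0; apply: (is_derive_comp (G := expR) (f := fun r : R => lam * ln r)).
  exact: is_derive_mull (is_derive1_ln r0).
pose r1 := rho + 1; have r1r : rho < r1 by rewrite ltrDl.
pose C := - v r1 * g r1.
have C0 : 0 < C by rewrite mulr_gt0 ?expR_gt0 // oppr_gt0 v0.
have H (r : R) : r1 <= r -> - v r * g r <= C.
  move=> rr; have -> : - v r * g r = - (v r * g r) by ring.
  have -> : C = - (v r1 * g r1) by rewrite /C mulNr.
  rewrite lerN2; apply: (derive_ge0_le (f := fun x => v x * g x)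
    (f' := fun x => v' x * g x + v x * (g x * (lam * x^-1))) rr) => x /andP[xr _].
    have xr' : rho < x := lt_le_trans r1r xr.
    by apply: is_derive_mul; [exact: vD|exact: gD (lt_trans rho0 xr')].
  have xr' : rho < x := lt_le_trans r1r xr.
  have -> : v' x * g x + v x * (g x * (lam * x^-1)) = (v' x - lam * (- v x / x)) * g x.
    by ring.
  by rewrite mulr_ge0 ?expR_ge0 // subr_ge0 vl.
(* Beyond the second radius lam ln r >= C / e, so r^lam >= C / e by exp(x) >= 1 + x. *)
exists (Num.max r1 (expR (C / e / lam))); first by rewrite lt_max r1r.
move=> r; rewrite ge_max => /andP[rr re].
have r0 : rho < r := lt_le_trans r1r rr.
rewrite ltr0_norm ?v0 // -(ler_pM2r (expR_gt0 (lam * ln r))).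
apply: le_trans (H r rr) _; rewrite [leRHS]mulrC -ler_pdivrMr //.
have h : C / e <= lam * ln r.
  rewrite [leRHS]mulrC -ler_pdivrMr // -[leLHS]expRK ler_ln ?posrE ?expR_gt0 //.
  exact: lt_trans rho0 r0.
by apply: (le_trans h); apply: le_trans (expR_ge1Dx _); rewrite lerDr.
Qed.

Lemma radial_gradient_cvg0 (u v : R -> R) (rho : R) : 0 < rho ->
  (forall r : R, rho < r -> is_derive r 1 u (v r)) ->
  (forall e : R, 0 < e -> exists2 A, rho < A & forall r : R, A <= r -> `|v r| <= e) ->
  (fun x => enorm (gradient (fun y => u (enorm y)) x)) @ at_infty R n --> (0 : R).
Proof.
move=> rho0 uD ve; apply/cvgrPdist_le => e e0; have [A rA HA] := ve e e0.
exists A => // x /= Ax; have xr := lt_le_trans rA Ax.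
rewrite (enorm_gradient_radial (lt_trans rho0 xr) (uD _ xr)).
by rewrite sub0r normrN normr_id HA.
Qed.

End Ends.

Lemma barrier_ge (R : realType) (gam c s : R) : 0 < gam -> gam <= c ->
  gam <= (1 + s ^+ 2) * c.
Proof.
move=> g0 gc; apply: (le_trans gc); rewrite ler_peMl ?lerDl ?sqr_ge0 //.
exact: le_trans (ltW g0) gc.
Qed.

Lemma half_le (R : realType) (g : R) : 0 < g -> g <= 1 ->
  g * 2^-1 <= 1 /\ -1 <= - g * 2^-1.
Proof. by split; lra. Qed.

(** * Wings for the k-th root of S_k *)

Section RootWings.
Variables (R : realType) (n k : nat) (hk : (1 <= k <= n.-1)%N) (rho : R) (rho0 : 0 < rho).

Let a : R := 'C(n.-1, k)%:R.
Let b : R := 'C(n.-1, k.-1)%:R.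
Let a0 : 0 < a. Proof. by have [h _] := choose_ge1 R hk; exact: lt_le_trans h. Qed.
Let b0 : 0 < b. Proof. by have [_ h] := choose_ge1 R hk; exact: lt_le_trans h. Qed.
Let gam : R := (a + b)^-1.
Let gam0 : 0 < gam. Proof. by rewrite invr_gt0 addr_gt0. Qed.
Let gam1 : gam <= 1.
Proof.
have [h1 h2] := choose_ge1 R hk; rewrite -/a -/b in h1 h2; rewrite invf_le1 ?addr_gt0 //; lra.
Qed.

Let n1 : (1 < n)%N.
Proof. by case/andP: hk; case: n => [|[|m]] //= h1 h2; have := leq_trans h1 h2. Qed.

Let pos_domain q : gam <= q -> root_domain k q.
Proof. by move=> h; left; rewrite gt_eqF // (lt_le_trans gam0). Qed.

Lemma root_expansion (f : speed R n) (u v : R -> R) (bet r0 : R) :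
  f (zero_ones R n) = root_speed R n k (zero_ones R n) ->
  'D_(e_first R n) f (zero_ones R n) = 'D_(e_first R n) (root_speed R n k) (zero_ones R n) ->
  profile_on rho (@root_field R n k) (@root_domain R k) u v ->
  (forall r, rho < r -> gam < v r / r) -> (forall r, r0 < r -> v r / r < bet) ->
  exists (C : R) (h : R -> R), (forall m, decl m h) /\
    forall x : 'rV[R]_n, h (enorm x) = u (enorm x) - (wing_profile f x + C).
Proof.
move=> E1 E2 P vg vb; have [A B] := root_profile_coefficients R hk.
apply: (profile_expansion (@open_root_domain R k) (smooth_root_field R hk) pos_domain gam0
  (root_barrier_le_slope R hk) (root_field_slope R hk) _ _ P vg vb).
- exact: (divr_gt0 a0 b0).
- by move=> q h; apply: derive_root_field_le => //; exact: lt_le_trans h.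
- by rewrite E1.
- by rewrite E2.
Qed.

Lemma root_one_branch : exists (W : set (espace R n)) (Wg : 'rV[R]_n -> R) (C : R),
  [/\ wing_like (root_speed R n k) rho W, has_sphere_boundary_component W,
      one_branch rho W Wg &
      smoothly_asymptotic_to Wg (fun x => wing_profile (root_speed R n k) x + C)].
Proof.
have s0 := root_slope_gt0 R hk; have gs := root_barrier_le_slope R hk.
(* The factors 2 and 3 are arbitrary: any two increasing values above [root_slope], where the field
   is negative, serve as start and upper barrier. *)
have [||||||W [u [v [W1 W2 W3 P vI]]]] := @one_branch_existence R n (root_speed R n k)
  (@root_field R n k) (@root_domain R k) (@root_domain R k) rho gam
  (2 * root_slope R n k) (3 * root_slope R n k) n1 rho0 (@open_root_domain R k)
  (smooth_root_field R hk) (root_speed_ode hk) _ _ gam0.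
- by move=> q /ltW; exact: pos_domain.
- by move=> q /andP[h _]; exact: pos_domain.
- by rewrite -/a -/b -/gam in gs; apply/andP; split; lra.
- by apply: root_field_neg => //; lra.
- by apply: root_field_neg => //; lra.
- by move=> r _; apply: barrier_ge => //; exact: root_field_barrier.
have [r /vI /andP[]//|r /vI /andP[]//|C [h [hd hE]]] :=
  root_expansion (f := root_speed R n k) (bet := 3 * root_slope R n k) (r0 := rho) erefl erefl P.
exists W, (fun x => u (enorm x)), C; split=> //.
by apply: smoothly_asymptotic_radial hd _; exists 0 => x _; exact: hE.
Qed.

Lemma root_two_branches : ~~ odd k ->
  exists (W : set (espace R n)) (Wp Wm : 'rV[R]_n -> R) (Cp Cm : R),
  [/\ wing_like (root_speed R n k) rho W, boundary W = set0,
      two_branches rho W Wp Wm,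
      smoothly_asymptotic_to Wp (fun x => wing_profile (root_speed R n k) x + Cp) &
      smoothly_asymptotic_to Wm (fun x => - (wing_profile (root_speed R n k) x + Cm))].
Proof.
move=> ek; have Fg := root_field_barrier R hk; rewrite -/a -/b -/gam in Fg.
have neg_domain q : q <= - gam -> root_domain k q.
  by move=> h; left; rewrite lt_eqF // (le_lt_trans h) // oppr_lt0.
have [|||||||||W [u1 [v1 [u2 [v2 [bet [bm [r0 [W1 W2 W3 [P1 P2] [g1 g2 g3 g4]]]]]]]]]] :=
  @two_branch_existence R n (root_speed R n k) (@root_field R n k) (@root_neck R n k)
  (@root_domain R k) (@root_domain R k) 2^-1 rho gam (- gam) n1 rho0 (@open_root_domain R k)
  (smooth_root_field R hk) (root_speed_ode hk) _ (smooth_root_neck R hk)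
  (@root_neck_gt0 R n k hk) (@root_field_inv R n k hk) _ _ pos_domain neg_domain.
- by rewrite invr_gt0.
- by move=> q /ltW; exact: pos_domain.
- by move=> q /ltW; exact: neg_domain.
- by have [] := half_le gam0 gam1.
- by have [] := half_le gam0 gam1.
- by move=> r _; exact: barrier_ge.
- move=> r _; rewrite root_field_odd // mulrN lerN2 mulrN sqrrN; exact: barrier_ge.
(* The slopes are ordered by sign, as v2 / r < - gam < gam < v1 / r. *)
- move=> u1 v1 u2 v2 _ _ h1 h2 _ r rr; have r0 : 0 < r := lt_trans rho0 rr.
  have : v2 r / r < v1 r / r by apply: lt_trans (h2 r rr) _; apply: lt_trans (h1 r rr); rewrite gtrN.
  by rewrite ltr_pM2r ?invr_gt0.
- exact: root_speed_neck.
(* Reflected, the lower branch satisfies the hypotheses of an upper one, so the same expansion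
   applies to its opposite. *)
have P2' : profile_on rho (@root_field R n k) (@root_domain R k) (fun r => - u2 r) (fun r => - v2 r).
  move=> r rr; have [_ D1 D2] := P2 r rr; split.
  - by apply: pos_domain; rewrite mulNr lerNr ltW // g3.
  - exact: is_derive_opp.
  - have := is_derive_opp D2; move=> /is_derive_eq; apply.
    by rewrite sqrrN mulNr root_field_odd // mulrN.
have [C [h [hd hE]]] := root_expansion (f := root_speed R n k) erefl erefl P1 g1 g2.
have [||C' [h' [hd' hE']]] := root_expansion (f := root_speed R n k) (bet := - bm) (r0 := r0)
  erefl erefl P2'.
- by move=> r rr; rewrite mulNr ltrNr g3.
- by move=> r rr; rewrite mulNr ltrN2 g4.
exists W, (fun x => u1 (enorm x)), (fun x => u2 (enorm x)), C, C'; split=> //.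
  by apply: smoothly_asymptotic_radial hd _; exists 0 => x _; exact: hE.
apply: (smoothly_asymptotic_radial (h := fun r => - h' r)); first by move=> m; exact: decl_opp.
by exists 0 => x _; rewrite hE'; ring.
Qed.

End RootWings.

(** * Wings for the mean curvature *)

Section MeanCurvatureWings.
Variables (R : realType) (n : nat) (hn : (1 <= 1 <= n.-1)%N) (rho : R) (rho0 : 0 < rho).

Let a : R := 'C(n.-1, 1)%:R.
Let a1 : 1 <= a. Proof. by have [] := choose_ge1 R hn. Qed.

Let field_eq q : @root_field R n 1 q = 1 - a * q.
Proof. by rewrite /root_field /= expr1 expr0 bin0 mulr1 divr1. Qed.

(* The equation is affine in q, so the difference d of two solutions v1 and v2
   satisfies d' = K d. *)
Lemma mean_curvature_order (O : set R) (u1 v1 u2 v2 : R -> R) (r1 : R) :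
  profile_on rho (@root_field R n 1) O u1 v1 ->
  profile_on rho (@root_field R n 1) O u2 v2 ->
  rho < r1 -> (forall r, rho < r < r1 -> v2 r < v1 r) ->
  forall r, rho < r -> v2 r < v1 r.
Proof.
move=> P1 P2 r1r H r rr; have [rr1|r1r'] := ltP r r1; first by apply: H; rewrite rr.
(* The comparison starts strictly beyond rho, where the slopes are finite and K is bounded on
   segments. *)
pose t := (rho + r1) / 2; have tr : rho < t < r1 by apply/andP; split; rewrite /t; lra.
have tr0 : rho < t by case/andP: tr.
have t_le : t <= r by apply: le_trans r1r'; rewrite ltW //; case/andP: tr.
(* The difference quotient in v of (1 + v^2) (1 - a v / x). *)
pose K (x : R) := v1 x + v2 x - a / x * (1 + v1 x ^+ 2 + v1 x * v2 x + v2 x ^+ 2).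
have KD (x : R) : t <= x <= r ->
    is_derive x 1 (fun y => v1 y - v2 y) (K x * (v1 x - v2 x)).
  move=> /andP[xt _]; have xr := lt_le_trans tr0 xt.
  have [_ _ D1] := P1 x xr; have [_ _ D2] := P2 x xr.
  by apply: is_derive_eq (is_derive_sub D1 D2) _; rewrite !field_eq /K; ring.
have Kc (x : R) : t <= x <= r -> {for x, continuous K}.
  move=> /andP[xt _]; have xr := lt_le_trans tr0 xt.
  have x0 : x != 0 by rewrite gt_eqF // (lt_trans rho0).
  have [_ _ D1] := P1 x xr; have [_ _ D2] := P2 x xr.
  have A := is_derive_mull a (is_derive_inv (f := fun y : R => y) x0 (is_derive_ident x)).
  have B := is_derive_add (is_derive_add (is_derive_add (is_derive_const (1 : R) x 1)
    (is_derive_exp 2 D1)) (is_derive_mul D1 D2)) (is_derive_exp 2 D2).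
  exact: is_derive_cont (is_derive_sub (is_derive_add D1 D2) (is_derive_mul A B)).
have [M _ KM] := bounded_segment Kc.
by rewrite -subr_gt0; apply: (linear_ode_pos t_le KD KM); rewrite subr_gt0 H.
Qed.

Lemma mean_curvature_wing :
  exists (W : set (espace R n)) (Wp Wm : 'rV[R]_n -> R) (Cp : R),
  [/\ wing_like (quotient_speed R n 1) rho W, boundary W = set0,
      two_branches rho W Wp Wm &
      asymptotic_to Wp (fun x => wing_profile (quotient_speed R n 1) x + Cp)].
Proof.
have n1 : (1 < n)%N by case/andP: hn => _; case: n => [|[]].
have a0 : 0 < a := lt_le_trans ltr01 a1.
pose gam : R := (a + 'C(n.-1, 1.-1)%:R)^-1.
have gamE : gam = (a + 1)^-1 by rewrite /gam /= bin0.
have gam0 : 0 < gam by rewrite gamE invr_gt0 addr_gt0.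
have gam1 : gam <= 1 by rewrite gamE invf_le1 ?addr_gt0 // lerDr ltW.
have Odom q : @root_domain R 1 q by right.
have am : 0 < a^-1 by rewrite invr_gt0.
(* The lower branch has as upper barrier the zero 1 / a of the field. Since gam = 1 / (a + 1) is
   smaller, the ranges of the two branches overlap and their order is left to
   [mean_curvature_order]. *)
have [|||||||W [u1 [v1 [u2 [v2 [bet [bm [r0 [W1 W2 W3 [P1 P2] [g1 g2 g3 g4]]]]]]]]]] :=
  @two_branch_existence R n (quotient_speed R n 1) (@root_field R n 1) (@root_neck R n 1)
  (@root_domain R 1) setT 2^-1 rho gam a^-1 n1 rho0 (@open_root_domain R 1)
  (smooth_root_field R hn) (mean_curvature_ode hn) _ (smooth_root_neck R hn)
  (@root_neck_gt0 R n 1 hn) (@root_field_inv R n 1 hn) (fun _ _ => I) (fun _ _ => I)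
  (fun q _ => Odom q) (fun q _ => Odom q).
- by rewrite invr_gt0.
- by have [] := half_le gam0 gam1.
- by apply: (@le_trans _ _ 0); [lra|rewrite mulr_ge0 // ltW // invr_gt0].
- by move=> r _; apply: barrier_ge => //; exact: root_field_barrier.
- by move=> r _; rewrite field_eq divff ?gt_eqF // subrr mulr0 ltW.
- by move=> u1 v1 u2 v2 P1 P2 _ _ [r1 r1r H]; exact: (mean_curvature_order P1 P2 r1r H).
- exact: mean_curvature_neck.
have [C [h [hd hE]]] := root_expansion hn (mean_curvature_zero_ones R hn)
  (mean_curvature_derive R hn) P1 g1 g2.
exists W, (fun x => u1 (enorm x)), (fun x => u2 (enorm x)), C; split=> //.
by apply: asymptotic_radial (hd 0%N) _; exists 0 => x _; exact: hE.
Qed.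

End MeanCurvatureWings.

(** * Wings for S_k / S_(k-1) with k > 1 *)

Section QuotientWings.
Variables (R : realType) (n k : nat) (hk : (1 <= k <= n.-1)%N) (k1 : (1 < k)%N).
Variables (rho : R) (rho0 : 0 < rho).

Let a : R := 'C(n.-1, k)%:R.
Let b : R := 'C(n.-1, k.-1)%:R.
Let c : R := 'C(n.-1, k.-2)%:R.
Let a0 : 0 < a. Proof. by have [h _] := choose_ge1 R hk; exact: lt_le_trans h. Qed.
Let b0 : 0 < b. Proof. by have [_ h] := choose_ge1 R hk; exact: lt_le_trans h. Qed.
Let gam : R := quotient_barrier R n k.
Let F : R -> R := @quotient_field R n k.

Let c0 : 0 < c.
Proof.
rewrite ltr0n bin_gt0; case/andP: hk => _; apply: leq_trans.
exact: leq_trans (leq_pred _) (leq_pred _).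
Qed.

Let neg_domain q : q <= 0 -> b * q - c < 0.
Proof. by move=> q0; rewrite subr_lt0 (le_lt_trans _ c0) // pmulr_rle0. Qed.

(** The difference of the two sides is - q (b^2 - a c) / (b (c - b q)), nonnegative by
    log-concavity. *)
Lemma quotient_field_lower q : q <= 0 -> a / b * - q <= F q.
Proof.
move=> q0; have d := neg_domain q0.
have d1 : b * q - c != 0 by rewrite lt_eqF.
have d0 : 0 < c - b * q by rewrite -opprB oppr_gt0.
have d2 : c - b * q != 0 by rewrite gt_eqF.
have b00 : b != 0 by rewrite gt_eqF.
have E : F q = a / b * - q + - q * (b * b - a * c) / (b * (c - b * q)).
  rewrite /F /quotient_field -/a -/b -/c; field.
  by rewrite d1 d2 b00.
rewrite E lerDl; apply: divr_ge0; last by rewrite mulr_ge0 // ltW.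
rewrite mulr_ge0 ?oppr_ge0 //; rewrite subr_ge0 ltW //.
exact: choose_log_concave.
Qed.

Lemma quotient_wing :
  exists (W : set (espace R n)) (Wp Wm : 'rV[R]_n -> R) (Cp : R),
  [/\ wing_like (quotient_speed R n k) rho W, boundary W = set0,
      two_branches rho W Wp Wm,
      asymptotic_to Wp (fun x => wing_profile (quotient_speed R n k) x + Cp) &
      (fun x => enorm (gradient Wm x)) @ at_infty R n --> (0 : R)].
Proof.
have n1 : (1 < n)%N.
  by case/andP: hk; case: n => [|[|m]] //= h1 h2; have := leq_trans h1 h2.
have gam0 : 0 < gam := quotient_barrier_gt0 R hk.
have gle : gam <= b / a := quotient_barrier_le R hk k1.
have ab0 : 0 < a / b by exact: divr_gt0.
have Op (q : R) : gam <= q -> quotient_domain n k q.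
  by move=> h; rewrite /quotient_domain /= gt_eqF // quotient_domain_ge.
have Om (q : R) : q <= 0 -> quotient_domain n k q.
  by move=> h; rewrite /quotient_domain /= lt_eqF //; exact: neg_domain.
have Qp (q : R) : gam < q -> q != 0 /\ b * q - c != 0.
  by move=> h; split; [rewrite gt_eqF // (lt_trans gam0)|exact: Op (ltW h)].
have Qm (q : R) : q < 0 -> q != 0 /\ b * q - c != 0.
  by move=> h; split; [rewrite lt_eqF|exact: Om (ltW h)].
(* The lower branch is confined to q < 0, as 0 is a zero of the field; the upper one stays above
   gam, so the pole c / b lies between the two ranges. *)
have [||||||W [u1 [v1 [u2 [v2 [bet [bm [r0 [W1 W2 W3 [P1 P2] [g1 g2 g3 g4]]]]]]]]]] :=
  @two_branch_existence R n (quotient_speed R n k) F (@quotient_neck R n k)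
  (@quotient_domain R n k) [set q | q != 0 /\ b * q - c != 0] (a / b) rho gam 0 n1 rho0
  (@open_quotient_domain R n k) (@smooth_quotient_field R n k)
  (quotient_speed_ode hk k1) ab0 (smooth_quotient_neck R hk k1)
  (@quotient_neck_gt0 R n k hk k1) (@quotient_field_inv R n k hk k1) Qp Qm Op Om.
- apply: (@le_trans _ _ (b / a * (a / b))); first by rewrite ler_pM2r.
  by rewrite mulrA divfK ?divff ?gt_eqF.
- by rewrite mul0r lerN10.
- by move=> r _; apply: barrier_ge => //; rewrite /F quotient_field_barrier.
- by move=> r _; rewrite /F /quotient_field !mul0r mulr0.
- move=> u1 v1 u2 v2 _ _ h1 h2 _ r rr; have r0 : 0 < r := lt_trans rho0 rr.
  have : v2 r / r < v1 r / r by apply: lt_trans (h2 r rr) _; apply: lt_trans (h1 r rr).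
  by rewrite ltr_pM2r ?invr_gt0.
- exact: quotient_speed_neck.
have [E1 E2] := quotient_profile_coefficients R hk k1.
have [C [h [hd hE]]] := profile_expansion (@open_quotient_domain R n k)
  (@smooth_quotient_field R n k) Op gam0 gle (quotient_field_slope R hk) ab0
  (fun q h => derive_quotient_field_le hk k1 (Op q h)) P1 g1 g2 E1 E2.
exists W, (fun x => u1 (enorm x)), (fun x => u2 (enorm x)), C; split=> //.
  by apply: asymptotic_radial (hd 0%N) _; exists 0 => x _; exact: hE.
apply: (@radial_gradient_cvg0 R n u2 v2 rho rho0); first by move=> r /P2[].
have v20 r : rho < r -> v2 r < 0.
  by move=> rr; have := g3 r rr; rewrite pmulr_llt0 // invr_gt0 (lt_trans rho0).
move=> e e0; apply: (power_decay (v' := fun r => (1 + v2 r ^+ 2) * F (v2 r / r)) rho0 ab0 e0) => //.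
  by move=> r /P2[].
move=> r rr; have q0 := ltW (g3 r rr); have lo := quotient_field_lower q0.
rewrite mulNr; apply: (le_trans lo); rewrite ler_peMl ?lerDl ?sqr_ge0 //.
by apply: le_trans lo; rewrite mulr_ge0 ?oppr_ge0 // ltW.
Qed.

End QuotientWings.

(* For k = 1 the quotient S_k / S_(k-1) is the mean curvature, and both ends of
   each of its wings are asymptotic to paraboloids: the clause on the gradient
   of the lower branch requires k > 1. *)
Theorem theorem1p4 (R : realType) (n k : nat) (hk : (1 <= k <= n.-1)%N)
    (rho : R) (hrho : 0 < rho) :
  (exists W : set (espace R n),
    wing_like (root_speed R n k) rho W /\
    (~~ odd k ->
      boundary W = set0 /\
      exists (Wp Wm : 'rV[R]_n -> R) (Cp Cm : R),
        [/\ two_branches rho W Wp Wm,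
            smoothly_asymptotic_to Wp
              (fun x => wing_profile (root_speed R n k) x + Cp) &
            smoothly_asymptotic_to Wm
              (fun x => - (wing_profile (root_speed R n k) x + Cm))]) /\
    (odd k ->
      has_sphere_boundary_component W /\
      exists (Wg : 'rV[R]_n -> R) (C : R),
        one_branch rho W Wg /\
        smoothly_asymptotic_to Wg
          (fun x => wing_profile (root_speed R n k) x + C)))
  /\
  (exists W : set (espace R n),
    wing_like (quotient_speed R n k) rho W /\
    boundary W = set0 /\
    exists (Wp Wm : 'rV[R]_n -> R) (Cp : R),
      [/\ two_branches rho W Wp Wm,
          asymptotic_to Wp
            (fun x => wing_profile (quotient_speed R n k) x + Cp) &
          (1 < k)%N ->
          (fun x => enorm (gradient Wm x)) @ at_infty R n --> (0 : R)]).
Proof.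
split.
  have [ok|ek] := boolP (odd k).
    have [W [Wg [C [W1 W2 W3 W4]]]] := root_one_branch hk hrho.
    by exists W; split=> //; split=> // _; split=> //; exists Wg, C.
  have [W [Wp [Wm [Cp [Cm [W1 W2 W3 W4 W5]]]]]] := root_two_branches hk hrho ek.
  by exists W; split=> //; split=> // _; split=> //; exists Wp, Wm, Cp, Cm.
have [k1|k1] := ltnP 1 k.
  have [W [Wp [Wm [Cp [W1 W2 W3 W4 W5]]]]] := quotient_wing hk k1 hrho.
  by exists W; split=> //; split=> //; exists Wp, Wm, Cp.
have {k1} kE : k = 1%N by apply/eqP; rewrite eqn_leq k1; case/andP: hk.
subst k; have [W [Wp [Wm [Cp [W1 W2 W3 W4]]]]] := mean_curvature_wing hk hrho.
by exists W; split=> //; split=> //; exists Wp, Wm, Cp.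
Qed.
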